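(* Let $k\geq 4$ and $n$ be integers. If one of the following holds: 1. $n \equiv 1 \pmod{k-1}$ and $n \geq k$; 2. $k = 4$, $n \neq 5$, and $n \geq 4$; 3. $k = 5$, $n \equiv 2 \pmod 4$, and $n \geq 10$; then $$f_k(n) = F(k,n) = \left\lceil \frac12\left( \left(k - \frac{2}{k-1}\right)n - \frac{k(k-3)}{k-1} \right) \right\rceil .$$
   Context: Graphs are finite and simple. A graph $G$ is $k$-critical if it is not $(k-1)$-colorable (in the sense of proper vertex colorings), but every proper subgraph of $G$ is $(k-1)$-colorable. $f_k(n)$ denotes the minimum number of edges in a $k$-critical graph with $n$ vertices (for $k \ge 4$, such graphs exist for $n=k$ and for every $n\geq k+2$). Define $F(k,n)=\left\lceil \frac{(k+1)(k-2)n-k(k-3)}{2(k-1)}\right\rceil$. *)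

(* Defs.v *)
From HB Require Import structures.
From mathcomp Require Import all_boot all_order all_algebra.

Set Implicit Arguments.
Unset Strict Implicit.
Unset Printing Implicit Defensive.

Import Order.TTheory GRing.Theory Num.Theory.

(* The vertex set is an arbitrary subset of the ambient finite type T, so that
   a graph and its subgraphs live in the same type. Edges are 2-element sets
   of vertices. *)
Record sgraph (T : finType) := SGraph {
  vertices : {set T};
  edges : {set {set T}};
  edgesP : forall e : {set T}, e \in edges -> (e \subset vertices) && (#|e| == 2)
}.

Definition adjacent (T : finType) (G : sgraph T) (x y : T) : bool :=
  [set x; y] \in edges G.

Definition subgraph (T : finType) (H G : sgraph T) : bool :=
  (vertices H \subset vertices G) && (edges H \subset edges G).

Definition proper_subgraph (T : finType) (H G : sgraph T) : bool :=
  subgraph H G && ~~ subgraph G H.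

Definition proper_coloring (T : finType) (G : sgraph T) (q : nat) (c : T -> nat) :
    Prop :=
  (forall x, x \in vertices G -> c x < q) /\
  (forall x y, adjacent G x y -> c x <> c y).

Definition colorable (T : finType) (G : sgraph T) (q : nat) : Prop :=
  exists c : T -> nat, proper_coloring G q c.

Definition critical (k : nat) (T : finType) (G : sgraph T) : Prop :=
  ~ colorable G (k - 1) /\
  (forall H : sgraph T, proper_subgraph H G -> colorable H (k - 1)).

Definition critical_edge_count (k n m : nat) : Prop :=
  exists (T : finType) (G : sgraph T),
    [/\ critical k G, #|vertices G| = n & #|edges G| = m].

Definition is_minimum (S : nat -> Prop) (m : nat) : Prop :=
  S m /\ (forall m', S m' -> m <= m').

(* [is_f k n m] says that f_k(n) is defined and equal to m. *)
Definition is_f (k n m : nat) : Prop := is_minimum (critical_edge_count k n) m.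

Local Open Scope ring_scope.

Definition F (k n : nat) : int :=
  Num.ceil
    (((k%:R + 1) * (k%:R - 2) * n%:R - k%:R * (k%:R - 3)) / (2 * (k%:R - 1)) : rat).

(* Main.v *)
(** The lower bound is the theorem of Kostochka and Yancey.  With q = k - 1,
    give a vertex set R of a graph the potential
    rho(R) = (q^2 + q - 2) |R| - 2 q e(R); the claim is that a (q+1)-critical
    graph has rho(V) <= q^2 - q - 2 = rho(K_(q+1)).  Take a counterexample with
    the fewest edges and, among these, the most pairs of vertices with equal
    closed neighbourhoods.

    Colouring a proper subset R and contracting its colour classes to a
    q-clique gives a smaller non-colourable graph, whose critical subgraph
    satisfies the bound; hence every proper R with |R| >= 2 has
    rho(R) > 2 q (q - 1) unless it is a q-clique.  Adding an edge, or deleting a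
    vertex and duplicating a neighbour of degree q, then shows that vertices of
    degree q with the same closed neighbourhood ("clusters") of size t have
    neighbours of degree at least q + t, either everywhere or inside the
    q-clique that contains the cluster.  Kernel-perfect orientations (Kierstead
    and Rabern) bound the number of edges between the vertices of degree q and
    those of degree q + 1.  A discharging argument with these facts gives
    rho(V) <= 0, a contradiction.

    The bound is attained by iterated Hajos joins with K_k, starting from K_k,
    from 4-critical graphs with 6 and 8 vertices, or from a 5-critical graph
    with 10 vertices. *)

(* The threshold 2 q (q - 1) is the potential of K_q, the least among K_2, ..., K_q. It is also what
   the bound q^2 - q - 2 becomes when a vertex of degree q is deleted: q^2 + q - 2 is lost, and 2 q
   is gained for each of q edges. So the statement on proper sets is just strong enough to make a
   q-clique of what remains when a duplicate is removed. Removing an added edge only leads to q^2 +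
   q - 2, which is below the threshold because q >= 3.

   Duplicating next to another vertex of degree q may keep the number of edges. The second
   minimality criterion, on equal closed neighbourhoods, exists for this case.

   The final contradiction is that q^2 - q - 2 = (q - 2)(q + 1) is positive.

   For the constructions, a join with K_k adds q vertices and (q^2 + q - 2)/2 edges, and it raises
   the unrounded expression in [F] by exactly this integer. One starting graph per residue of n
   modulo q is therefore enough. K_k serves the residue 1; the residue 2 starts at 8 for k = 4 and
   at 10 for k = 5, since there is no k-critical graph on k + 1 vertices. *)
Require Import Defs.
From HB Require Import structures.
From mathcomp Require Import all_boot all_order all_algebra all_fingroup.
From mathcomp Require Import zify ring lra.

Set Implicit Arguments.
Unset Strict Implicit.
Unset Printing Implicit Defensive.

Import Order.TTheory GRing.Theory Num.Theory.

(** * Arcs and critical graphs *)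

Section Arcs.
Variable T : finType.
Implicit Types (e f : rel T) (A B C V W : {set T}) (x y : T).

(* Ordered pairs: [arcs e A A] is twice the number of edges inside [A]. *)
Definition arcs e A B : nat := \sum_(x in A) \sum_(y in B) e x y.
Definition nbrs e V x : {set T} := [set y in V | e x y].

Lemma nbrsE e V x : #|nbrs e V x| = \sum_(y in V) e x y.
Proof.
rewrite -sum1_card big_mkcond [RHS]big_mkcond /=; apply: eq_bigr => y _.
by rewrite inE; case: (y \in V); case: (e x y).
Qed.

Lemma arcs_nbrs e A V : arcs e A V = \sum_(x in A) #|nbrs e V x|.
Proof. by apply: eq_bigr => x _; rewrite nbrsE. Qed.

Lemma arcs1 e V x : arcs e [set x] V = #|nbrs e V x|.
Proof. by rewrite arcs_nbrs big_set1. Qed.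

Lemma arcs0 e V : arcs e set0 V = 0.
Proof. by rewrite /arcs big_set0. Qed.

Lemma arcsC e A B : symmetric e -> arcs e A B = arcs e B A.
Proof.
move=> es; rewrite /arcs exchange_big /=.
by apply: eq_bigr => x _; apply: eq_bigr => y _; rewrite es.
Qed.

Lemma arcsIDl e D A B : arcs e A B = arcs e (A :&: D) B + arcs e (A :\: D) B.
Proof. exact: big_setID. Qed.

Lemma arcsIDr e D A B : arcs e A B = arcs e A (B :&: D) + arcs e A (B :\: D).
Proof.
by rewrite /arcs -big_split /=; apply: eq_bigr => x _; apply: big_setID.
Qed.

Lemma arcsUl e A B C : [disjoint A & B] ->
  arcs e (A :|: B) C = arcs e A C + arcs e B C.
Proof.
move=> dAB; rewrite (arcsIDl e A) setUK setDUl setDv set0U.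
by congr (_ + arcs _ _ _); apply/setDidPl; rewrite disjoint_sym.
Qed.

Lemma arcsUr e A B C : [disjoint A & B] ->
  arcs e C (A :|: B) = arcs e C A + arcs e C B.
Proof.
move=> dAB; rewrite (arcsIDr e A) setUK setDUl setDv set0U.
by congr (_ + arcs _ _ _); apply/setDidPl; rewrite disjoint_sym.
Qed.

Lemma arcsUU e A B : symmetric e -> [disjoint A & B] ->
  arcs e (A :|: B) (A :|: B) = arcs e A A + 2 * arcs e A B + arcs e B B.
Proof.
move=> es dAB; rewrite arcsUl // !arcsUr // (arcsC B A es); lia.
Qed.

Lemma leq_arcs e f A B A' B' : A \subset A' -> B \subset B' ->
  (forall x y, x \in A -> y \in B -> e x y -> f x y) ->
  arcs e A B <= arcs f A' B'.
Proof.
move=> /subsetP sA /subsetP sB sef.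
rewrite /arcs [X in X <= _]big_mkcond [X in _ <= X]big_mkcond /=.
apply: leq_sum => x _; case: ifP => // xA; rewrite sA //.
rewrite [X in X <= _]big_mkcond [X in _ <= X]big_mkcond /=.
apply: leq_sum => y _; case: ifP => // yB; rewrite sB //.
by case exy: (e x y) => //; rewrite sef.
Qed.

Lemma eq_arcs e f A B : (forall x y, x \in A -> y \in B -> e x y = f x y) ->
  arcs e A B = arcs f A B.
Proof.
by move=> ef; apply: eq_bigr => x xA; apply: eq_bigr => y yB; rewrite ef.
Qed.

Lemma arcs_card e A B : arcs e A B <= #|A| * #|B|.
Proof.
rewrite arcs_nbrs -sum_nat_const; apply: leq_sum => x _.
by apply: subset_leq_card; apply/subsetP => y; rewrite inE => /andP[].
Qed.

Lemma arcs_irr e A : irreflexive e -> arcs e A A <= #|A| * (#|A| - 1).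
Proof.
move=> ei; rewrite arcs_nbrs -sum_nat_const; apply: leq_sum => x xA.
rewrite (cardsD1 x A) xA add1n subSS subn0.
by apply: subset_leq_card; apply/subsetP => y; rewrite !inE => /andP[->]; case: eqP => // ->;
  rewrite ei.
Qed.

Lemma arcsD1 e V x : symmetric e -> irreflexive e -> x \in V ->
  arcs e V V = arcs e (V :\ x) (V :\ x) + 2 * #|nbrs e V x|.
Proof.
move=> es ei xV; rewrite -{1 2}(setD1K xV) arcsUU //; last first.
  by rewrite disjoints1 !inE eqxx.
have -> : arcs e [set x] [set x] = 0 by rewrite /arcs !big_set1 ei.
have -> : arcs e [set x] (V :\ x) = #|nbrs e V x|; last lia.
rewrite arcs1; congr #|pred_of_set _|; apply/setP => y; rewrite !inE.
by case: eqP => // ->; rewrite ei !andbF.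
Qed.

(** A missing edge costs two arcs, so a deficit of at most one arc already forces a clique. *)
Lemma clique_arcs e A : symmetric e -> irreflexive e ->
  #|A| * (#|A| - 1) <= arcs e A A + 1 ->
  forall x y, x \in A -> y \in A -> x != y -> e x y.
Proof.
move=> es ei h x y xA yA nxy; apply/negPn/negP => nexy.
have yAx : y \in A :\ x by rewrite !inE eq_sym nxy.
have h1 := arcsD1 es ei xA.
have h2 := arcs_irr (A :\ x) ei.
have h3 : #|nbrs e A x| <= #|A :\ x| - 1.
  rewrite (cardsD1 y (A :\ x)) yAx add1n subSS subn0.
  apply: subset_leq_card; apply/subsetP => z; rewrite !inE => /andP[->].
  move=> exz; rewrite andbT; apply/andP; split.
    by apply: contraNneq nexy => <-.
  by apply: contraTneq exz => ->; rewrite ei.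
have h4 : #|A| = #|A :\ x|.+1 by rewrite (cardsD1 x A) xA.
have h5 : 0 < #|A :\ x| by apply/card_gt0P; exists y.
move: h h1 h2 h3 h5; rewrite h4.
move: #|A :\ x| #|nbrs e A x| (arcs e A A) (arcs e _ _) => a n s s' h h1 h2 h3 h5.
by case: a h h2 h3 h5 => // a; rewrite subn1 /= => h h2 h3 h5; nia.
Qed.

Lemma arcs_clique e A : irreflexive e ->
  (forall x y, x \in A -> y \in A -> x != y -> e x y) ->
  arcs e A A = #|A| * (#|A| - 1).
Proof.
move=> ei cA; rewrite arcs_nbrs -sum_nat_const; apply: eq_bigr => x xA.
rewrite (cardsD1 x A) xA add1n subSS subn0.
congr #|pred_of_set _|; apply/setP => y; rewrite !inE.
have [->|nyx] := eqVneq y x; first by rewrite ei andbF.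
by case yA: (y \in A) => //=; rewrite cA // eq_sym.
Qed.

End Arcs.

Section Critical.
Variables (T : finType) (q : nat).
Implicit Types (e f : rel T) (A B C V W R : {set T}) (x y : T).

Definition sgr e := symmetric e /\ irreflexive e.

(* A graph is a vertex set [V] with a relation [e], of which only the part
   inside [V] matters. *)
Definition qcol e V : bool := [exists c : {ffun T -> 'I_q},
  [forall x in V, forall y in V, e x y ==> (c x != c y)]].

Lemma qcolP e V :
  reflect (exists c : T -> 'I_q,
    forall x y, x \in V -> y \in V -> e x y -> c x != c y) (qcol e V).
Proof.
apply: (iffP existsP) => [[c cP]|[c cP]].
  exists c => x y xV yV exy.
  by move/forall_inP/(_ x xV)/forall_inP/(_ y yV)/implyP: cP; apply.
exists [ffun x => c x]; apply/forall_inP => x xV; apply/forall_inP => y yV.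
by apply/implyP => exy; rewrite !ffunE; apply: cP.
Qed.

Lemma qcol_sub e f V W : W \subset V ->
  (forall x y, x \in W -> y \in W -> f x y -> e x y) -> qcol e V -> qcol f W.
Proof.
move=> /subsetP sW sfe /qcolP[c cP]; apply/qcolP; exists c => x y xW yW fxy.
by apply: cP; rewrite ?sW //; apply: sfe.
Qed.

Definition del e x y : rel T := fun u v =>
  e u v && ~~ ((u == x) && (v == y) || (u == y) && (v == x)).

Lemma del_sgr e x y : sgr e -> sgr (del e x y).
Proof.
move=> [es ei]; split=> [u v|u]; rewrite /del ?ei // es; congr (_ && ~~ _).
by rewrite orbC; congr (_ || _); rewrite andbC.
Qed.

(** This is (q+1)-criticality. Single deletions are enough: every proper subgraph lies in one of
    them, and colourability passes to subgraphs. *)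
Definition crit e V : Prop :=
  [/\ ~~ qcol e V, forall x, x \in V -> qcol e (V :\ x) &
      forall x y, x \in V -> y \in V -> e x y -> qcol (del e x y) V].

Lemma arcs_del e V x y : sgr e -> x \in V -> y \in V -> e x y ->
  arcs e V V = arcs (del e x y) V V + 2.
Proof.
move=> se xV yV exy; have [es ei] := se; have [ds di] := del_sgr x y se.
have nxy : x != y by apply: contraTneq exy => ->; rewrite ei.
rewrite (arcsD1 es ei xV) (arcsD1 ds di xV).
have -> : arcs (del e x y) (V :\ x) (V :\ x) = arcs e (V :\ x) (V :\ x).
  apply: eq_arcs => u v; rewrite !inE => /andP[ux _] /andP[vx _].
  by rewrite /del (negbTE ux) (negbTE vx) /= !andbF andbT.
have -> : nbrs (del e x y) V x = nbrs e V x :\ y.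
  apply/setP => z; rewrite !inE /del eqxx (negbTE nxy) /= orbF.
  by rewrite [in RHS]andbC andbA.
have yN : y \in nbrs e V x by rewrite inE yV.
by rewrite (cardsD1 y (nbrs e V x)) yN; lia.
Qed.

Lemma crit_exists e V : sgr e -> ~~ qcol e V ->
  exists f W, [/\ W \subset V, forall x y, f x y -> e x y, sgr f & crit f W].
Proof.
have [n] := ubnP (arcs e V V + #|V|); elim: n e V => // n IH e V hn se ncol.
have [/existsP[x /andP[xV nc]]|h1] :=
    boolP [exists x, (x \in V) && ~~ qcol e (V :\ x)].
  case: (IH e (V :\ x)) => // [|f [W [sW sfe sf cf]]].
    have : arcs e (V :\ x) (V :\ x) <= arcs e V V by apply: leq_arcs; rewrite ?subsetDl.
    by move: hn; rewrite (cardsD1 x V) xV; lia.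
  by exists f, W; split=> //; apply: subset_trans sW (subsetDl _ _).
have [/existsP[x /existsP[y /and4P[xV yV exy nc]]]|h2] :=
    boolP [exists x, exists y, [&& x \in V, y \in V, e x y & ~~ qcol (del e x y) V]].
  case: (IH (del e x y) V) => // [||f [W [sW sfe sf cf]]].
  - by move: hn; rewrite (arcs_del se xV yV exy); lia.
  - exact: del_sgr.
  - by exists f, W; split=> // u v /sfe /andP[].
exists e, V; split=> //; split=> // [x xV|x y xV yV exy].
  by apply: contraNT h1 => nc; apply/existsP; exists x; rewrite xV.
apply: contraNT h2 => nc; apply/existsP; exists x; apply/existsP; exists y.
by rewrite xV yV exy.
Qed.

Lemma crit_proper e V W : crit e V -> W \proper V -> qcol e W.
Proof.
move=> [_ cv _] /properP[sW [x xV xW]]; apply: qcol_sub (cv x xV) => //.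
by apply/subsetP => y yW; rewrite !inE (subsetP sW) // andbT; apply: contraNneq xW => <-.
Qed.

Lemma crit_nonsub e f V W x : crit e V -> W \subset V -> x \in V -> x \notin W ->
  (forall x y, x \in W -> y \in W -> f x y -> e x y) -> qcol f W.
Proof.
move=> cr sW xV xW sfe; apply: (@qcol_sub e f W W) => //.
apply: crit_proper cr _; apply/properP; split=> //; by exists x.
Qed.

Lemma free_colour (B : {set 'I_q}) : #|B| < q -> exists a, a \notin B.
Proof.
move=> hB; apply/existsP; rewrite -negb_forall; apply/negP => /forallP h.
have : #|'I_q| <= #|B| by apply: subset_leq_card; apply/subsetP => x _; apply: h.
by rewrite card_ord leqNgt hB.
Qed.

Lemma mindeg e V x : sgr e -> crit e V -> x \in V -> q <= #|nbrs e V x|.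
Proof.
move=> [es ei] [nc cv _] xV; rewrite leqNgt; apply: contra nc => hd.
have /qcolP[c cP] := cv x xV.
have [a aP] : exists a, a \notin c @: nbrs e V x.
  by apply: free_colour; apply: leq_ltn_trans (leq_imset_card _ _) hd.
apply/qcolP; exists (fun z => if z == x then a else c z) => u v uV vV euv.
have hN z : z \in V -> e x z -> a != c z.
  by move=> zV exz; apply: contraNneq aP => ->; apply: imset_f; rewrite inE zV.
case: (eqVneq u x) euv => [->|nux] euv; case: (eqVneq v x) euv => [->|nvx] euv.
- by rewrite ei in euv.
- exact: hN.
- by rewrite eq_sym; apply: hN => //; rewrite es.
- by apply: cP; rewrite // !inE ?nux ?nvx.
Qed.

Lemma crit_neq0 e V : 0 < q -> crit e V -> exists x, x \in V.
Proof.
move=> q0 [nc _ _]; apply/set0Pn; apply: contra nc => /eqP->.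
by apply/qcolP; exists (fun=> Ordinal q0) => x y; rewrite inE.
Qed.

Lemma nbrs_lt e V x : sgr e -> x \in V -> #|nbrs e V x| < #|V|.
Proof.
move=> [es ei] xV; rewrite (cardsD1 x V) xV ltnS; apply: subset_leq_card.
apply/subsetP => y; rewrite !inE => /andP[-> exy]; rewrite andbT.
by apply: contraTneq exy => ->; rewrite ei.
Qed.

Lemma crit_card e V : 0 < q -> sgr e -> crit e V -> q < #|V|.
Proof.
move=> q0 se cr; have [x xV] := crit_neq0 q0 cr.
exact: leq_ltn_trans (mindeg se cr xV) (nbrs_lt se xV).
Qed.

(* Shifting the colours on one side cyclically by s, each edge of the cut is
   monochromatic for exactly one of the q values of s. *)
Lemma crit_cut e V R : sgr e -> crit e V -> R \proper V -> R != set0 ->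
  q <= arcs e R (V :\: R).
Proof.
move=> [es ei] cr pR nR; rewrite leqNgt; apply/negP => hlt.
have q0 : 0 < q by apply: leq_ltn_trans hlt.
have sR := proper_sub pR.
have /qcolP[c1 c1P] := crit_proper cr pR.
have /qcolP[c2 c2P] : qcol e (V :\: R).
  apply: crit_proper cr _; apply/properP; split; first exact: subsetDl.
  by case/set0Pn: nR => x xR; exists x; rewrite ?inE ?xR // (subsetP sR).
pose sh s (a : 'I_q) : 'I_q := Ordinal (ltn_pmod (a + s) q0).
pose bad := [set s : 'I_q | [exists x in R, exists y in V :\: R, e x y && (sh s (c1 x) == c2 y)]].
have [s sP] : exists s, s \notin bad.
  apply: free_colour; apply: leq_ltn_trans hlt.
  pose E := [set p : T * T | [&& p.1 \in R, p.2 \in V :\: R & e p.1 p.2]].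
  pose F (p : T * T) : 'I_q := Ordinal (ltn_pmod (c2 p.2 + (q - c1 p.1)) q0).
  have sb : bad \subset F @: E.
    apply/subsetP => s; rewrite inE => /exists_inP[x xR /exists_inP[y yR /andP[exy /eqP hs]]].
    apply/imsetP; exists (x, y); first by rewrite inE /= xR yR exy.
    apply/val_inj; rewrite /= -hs /= modnDml.
    have -> : c1 x + s + (q - c1 x) = q + s by have := ltn_ord (c1 x); lia.
    by rewrite modnDl modn_small.
  apply: leq_trans (subset_leq_card sb) _; apply: leq_trans (leq_imset_card _ _) _.
  rewrite -sum1_card /arcs pair_big_dep /= big_mkcond [X in _ <= X]big_mkcond /=.
  by apply: leq_sum => -[x y] _; rewrite inE /= andbA; case: ifP => // /andP[-> ->].
case: cr => nc _ _; case/negP: nc; apply/qcolP.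
have hs x y : x \in R -> y \in V :\: R -> e x y -> sh s (c1 x) != c2 y.
  move=> xR yR exy; apply: contra sP => h; rewrite inE.
  by apply/exists_inP; exists x => //; apply/exists_inP; exists y => //; rewrite exy.
have inj_sh : injective (sh s).
  move=> a b /(congr1 val) /= /eqP; rewrite eqn_modDr => /eqP.
  by rewrite !modn_small // => /val_inj.
exists (fun x => if x \in R then sh s (c1 x) else c2 x) => x y xV yV exy.
case: ifPn => xR; case: ifPn => yR.
- by rewrite (inj_eq inj_sh); apply: c1P.
- by apply: hs; rewrite // inE yR.
- by rewrite eq_sym; apply: hs; rewrite // ?inE ?xR // es.
- by apply: c2P; rewrite // inE ?xR ?yR.
Qed.

End Critical.

(** * Potential and contraction *)

Section PairCover.
Variable T : finType.

(** Equal entries lie in one block of [w u] copies. Entries at distance i therefore differ as soon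
    as all blocks are shorter than i. *)
Lemma nth_flatten_nseq (w : T -> nat) (x0 : T) (l : seq T) j j' :
  uniq l -> j <= j' -> j' < size (flatten [seq nseq (w u) u | u <- l]) ->
  nth x0 (flatten [seq nseq (w u) u | u <- l]) j =
    nth x0 (flatten [seq nseq (w u) u | u <- l]) j' ->
  j' - j < w (nth x0 (flatten [seq nseq (w u) u | u <- l]) j).
Proof.
elim: l j j' => //= u l IH j j' /andP[ul ql] jj'.
rewrite size_cat size_nseq !nth_cat size_nseq => hj'.
case: (ltnP j (w u)) => hj; case: (ltnP j' (w u)) => hj'w.
- by move=> _; rewrite nth_nseq hj; lia.
- rewrite nth_nseq hj => hu; case/negP: ul; rewrite hu.
  have : nth x0 (flatten [seq nseq (w u) u | u <- l]) (j' - w u) \in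
        flatten [seq nseq (w u) u | u <- l] by apply: mem_nth; move: hj hj' hj'w; clear;
          move: (size _) => n; lia.
  by case/flattenP => _ /mapP[y yl ->] /nseqP[-> _].
- by lia.
- move=> hn; have := IH (j - w u) (j' - w u) ql.
  by rewrite subnBA // subnK // => h; apply: h => //; lia.
Qed.

(** A vertex of weight at least i becomes the centre of a star of pairs. If there is none, each
    vertex is listed as often as its weight says and position j is paired with position j + i. A set
    that contains no pair then misses one position of each of the i pairs. *)
Lemma pair_cover (R : {set T}) (w : T -> nat) i :
  2 * i <= \sum_(u in R) w u ->
  exists s : seq (T * T), [/\ size s <= i, (forall p, p \in s -> p.1 != p.2) &
    forall M : {set T}, (forall p, p \in s -> ~~ ((p.1 \in M) && (p.2 \in M))) ->
      forall a b, a \in M -> b \in M -> a \in R -> b \in R -> a != b ->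
        0 < w a -> 0 < w b -> i <= \sum_(u in R :\: M) w u].
Proof.
move=> hw.
have [/exists_inP[u uR wu]|small] := boolP [exists u in R, i <= w u].
  pose L := take i (enum [set z in R | (0 < w z) && (z != u)]).
  have LR z : z \in L -> [/\ z \in R, 0 < w z & z != u].
    by move=> /mem_take; rewrite mem_enum inE => /and3P[].
  exists [seq (u, z) | z <- L]; split.
  - by rewrite size_map size_take; case: ltnP => // /ltnW.
  - by move=> p /mapP[z zL ->] /=; have [_ _] := LR z zL; rewrite eq_sym.
  move=> M Mind a b aM bM aR bR nab wa wb.
  have [uM|uM] := boolP (u \in M); last first.
    by rewrite (bigD1 u) /=; [exact: leq_trans wu (leq_addr _ _) | rewrite inE uM].
  have LM z : z \in L -> z \notin M.
    by move=> zL; have := Mind (u, z) (map_f _ zL); rewrite /= uM.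
  (* The second weighted vertex [c] of [M] cannot be a leaf of the star, so the leaves did not run
     out: there are i of them, all outside [M] and of positive weight. *)
  have [c [cM cR nc wc]] : exists c, [/\ c \in M, c \in R, c != u & 0 < w c].
    by have [eau|] := eqVneq a u; [exists b; rewrite -eau eq_sym | exists a].
  have szL : size L = i.
    rewrite /L size_takel // leqNgt; apply/negP => hlt.
    have /LM : c \in L by rewrite /L take_oversize ?(ltnW hlt) // mem_enum inE cR wc.
    by rewrite cM.
  have uL : uniq L by rewrite take_uniq ?enum_uniq.
  rewrite -szL -(card_uniqP uL) -sum1_card.
  rewrite big_mkcond [X in _ <= X]big_mkcond /=; apply: leq_sum => z _.
  by case: ifPn => // zL; have [zR wz _] := LR z zL; rewrite inE LM ?zR.
have {}small u : u \in R -> w u < i.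
  by move=> uR; rewrite ltnNge; apply: contra small => h; apply/exists_inP; exists u.
have [i0|ipos] := posnP i.
  by exists [::]; split=> // M _ a b *; rewrite i0.
have [x0 x0R] : exists x0, x0 \in R.
  apply/set0Pn; apply: contraTneq hw => ->; rewrite big_set0; lia.
pose l := enum R.
pose s0 := flatten [seq nseq (w u) u | u <- l].
have sumE (P : pred T) : \sum_(x <- s0) (P x : nat) = \sum_(u in R | P u) w u.
  rewrite /s0 big_flatten /= big_map /l big_enum /= [RHS]big_mkcondr /=.
  by apply: eq_bigr => u _; rewrite big_nseq iter_addn_0; case: (P u); rewrite ?mul1n ?mul0n.
have sz : size s0 = \sum_(u in R) w u.
  by rewrite -sum1_size (sumE xpredT); apply: eq_bigl => u; rewrite andbT.
have s0R z : z \in s0 -> z \in R.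
  by case/flattenP => _ /mapP[y yl ->] /nseqP[-> _]; rewrite /l mem_enum in yl.
exists [seq (nth x0 s0 j, nth x0 s0 (j + i)) | j <- iota 0 i]; split.
- by rewrite size_map size_iota.
- move=> p /mapP[j]; rewrite mem_iota add0n => /andP[_ ji] -> /=.
  apply/negP => /eqP heq.
  have hs : j + i < size s0 by rewrite sz; apply: leq_trans hw; lia.
  have := @nth_flatten_nseq w x0 l j (j + i) (enum_uniq _) (leq_addr _ _) hs heq.
  have hR : nth x0 s0 j \in R by apply/s0R/mem_nth; apply: leq_ltn_trans hs; apply: leq_addr.
  by have := small _ hR; rewrite addKn -/s0; move: (w _) => n; lia.
move=> M Mind _ _ _ _ _ _ _ _ _.
have -> : \sum_(u in R :\: M) w u = \sum_(x <- s0) ((x \notin M) : nat).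
  by rewrite sumE; apply: eq_bigl => u; rewrite inE andbC.
rewrite (big_nth x0) (@big_cat_nat _ _ _ (2 * i)) //=; last by rewrite sz.
rewrite (@big_cat_nat _ _ _ i) //=; last lia.
apply: leq_trans (leq_addr _ _).
have -> : \sum_(i <= j < 2 * i) ((nth x0 s0 j \notin M) : nat) =
    \sum_(0 <= j < i) ((nth x0 s0 (j + i) \notin M) : nat).
  by rewrite -{1}[i]add0n mul2n -addnn big_addn addnK.
rewrite -big_split /=.
rewrite -{1}[i]subn0 -[X in X <= _]muln1 -sum_nat_const_nat.
rewrite big_nat [X in _ <= X]big_nat; apply: leq_sum => j /andP[_ ji].
have /Mind /= : (nth x0 s0 j, nth x0 s0 (j + i)) \in
  [seq (nth x0 s0 j, nth x0 s0 (j + i)) | j <- iota 0 i].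
  by apply: map_f; rewrite mem_iota add0n.
by case: (_ \in M) => //=; case: (_ \in M).
Qed.

End PairCover.

Section AddPairs.
Variables (T : finType) (e : rel T).

Definition addp (s : seq (T * T)) : rel T := fun u v =>
  e u v || ((u, v) \in s) || ((v, u) \in s).

Lemma addp_sgr s : sgr e -> (forall p, p \in s -> p.1 != p.2) -> sgr (addp s).
Proof.
move=> [es ei] sirr; split=> [u v|u]; rewrite /addp.
  by rewrite es -!orbA; congr (_ || _); rewrite orbC.
by rewrite ei orbb /=; apply/negP => /sirr; rewrite eqxx.
Qed.

Lemma arcs_addp s (W : {set T}) : arcs (addp s) W W <= arcs e W W + 2 * size s.
Proof.
have hs : \sum_(x in W) \sum_(y in W) (((x, y) \in s) : nat) <= size s.
  apply: leq_trans (card_size s).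
  rewrite pair_big_dep -sum1_card /= big_mkcond [X in _ <= X]big_mkcond /=.
  by apply: leq_sum => -[x y] _ /=; case: ifP; case: ((x, y) \in s).
apply: (@leq_trans (arcs e W W + \sum_(x in W) \sum_(y in W) (((x, y) \in s) : nat)
   + \sum_(x in W) \sum_(y in W) (((y, x) \in s) : nat))).
  rewrite /arcs -!big_split /=; apply: leq_sum => x _.
  rewrite -!big_split /=; apply: leq_sum => y _; rewrite /addp.
  by case: (e x y); case: (_ \in s); case: (_ \in s).
have -> : \sum_(x in W) \sum_(y in W) (((y, x) \in s) : nat) =
  \sum_(x in W) \sum_(y in W) (((x, y) \in s) : nat) by rewrite exchange_big.
by move: hs; move: (\sum_(x in W) _) (arcs e W W) => a b; lia.
Qed.

End AddPairs.

(** * Potentials of cliques, and contraction of a coloured set *)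

Section Potential.
Variables (T : finType) (q : nat).
Implicit Types (e f : rel T) (A B C V W R : {set T}) (x y : T).

Local Open Scope ring_scope.
(** [arcs] counts every edge twice, hence the factor q instead of 2 q. *)
Definition rho e R : int :=
  (q%:Z * q%:Z + q%:Z - 2) * #|R|%:Z - q%:Z * (arcs e R R)%:Z.

Definition ky_bound : int := q%:Z * q%:Z - q%:Z - 2.

Definition qclique e V C : bool :=
  [&& C \subset V, #|C| == q & [forall x in C, forall y in C, (x != y) ==> e x y]].

Lemma qcliqueP e V C :
  reflect [/\ C \subset V, #|C| = q &
    forall x y, x \in C -> y \in C -> x != y -> e x y] (qclique e V C).
Proof.
apply: (iffP and3P) => [[sC /eqP hC /forall_inP h]|[sC hC h]]; split=> //.
- by move=> x y xC yC; have /forall_inP/(_ y yC)/implyP := h x xC.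
- exact/eqP.
- by apply/forall_inP=> x xC; apply/forall_inP=> y yC; apply/implyP; apply: h.
Qed.

Lemma rhoU e A B : symmetric e -> [disjoint A & B] ->
  rho e (A :|: B) = rho e A + rho e B - 2 * q%:Z * (arcs e A B)%:Z.
Proof.
move=> es dAB; rewrite /rho arcsUU // cardsU (disjoint_setI0 dAB) cards0 subn0.
by move: (arcs _ _ _) (arcs _ _ _) (arcs _ _ _) => a b c; lia.
Qed.

Lemma rho_sub e f A : (forall x y, x \in A -> y \in A -> f x y -> e x y) ->
  rho e A <= rho f A.
Proof.
move=> sfe; rewrite /rho lerB // ler_wpM2l // lez_nat.
exact: leq_arcs.
Qed.

Lemma rho_ge e A (j : nat) : irreflexive e -> #|A| = j ->
  (q%:Z * q%:Z + q%:Z - 2) * j%:Z - q%:Z * (j%:Z * (j%:Z - 1)) <= rho e A.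
Proof.
move=> ei hj; rewrite /rho hj lerB // ler_wpM2l //.
have := arcs_irr A ei; rewrite hj; case: j {hj} => [|j]; first by lia.
by rewrite subn1 /= => h; nia.
Qed.

(** The right-hand side is the potential of K_j, and it exceeds that of K_q by (q - j)(q (j - 2) +
    2). *)
Lemma clique_pot (j : nat) : (1 < j)%N -> (j <= q)%N ->
  2 * q%:Z * (q%:Z - 1) <=
  (q%:Z * q%:Z + q%:Z - 2) * j%:Z - q%:Z * (j%:Z * (j%:Z - 1)).
Proof.
move=> j1 jq; rewrite -subr_ge0.
have -> : (q%:Z * q%:Z + q%:Z - 2) * j%:Z - q%:Z * (j%:Z * (j%:Z - 1)) -
    2 * q%:Z * (q%:Z - 1) = (q%:Z - j%:Z) * (q%:Z * (j%:Z - 2) + 2) by ring.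
by apply: mulr_ge0; nia.
Qed.

Lemma small_gap e R : sgr e -> (1 < #|R|)%N -> (#|R| <= q)%N ->
  rho e R <= 2 * q%:Z * (q%:Z - 1) ->
  #|R| = q /\ forall x y, x \in R -> y \in R -> x != y -> e x y.
Proof.
move=> [es ei] R1 Rq hR.
have hg := rho_ge ei (erefl #|R|).
have hRq : #|R| = q.
  apply/eqP; rewrite eqn_leq Rq leqNgt; apply/negP => hlt.
  have : 2 * q%:Z * (q%:Z - 1) + (q%:Z - #|R|%:Z) * (q%:Z * (#|R|%:Z - 2) + 2) <= 2 * q%:Z * (q%:Z - 1).
    by apply: le_trans hR; apply: le_trans hg; rewrite le_eqVlt; apply/orP; left; apply/eqP; ring.
  rewrite gerDl; apply/negP; rewrite -ltNge; apply: mulr_gt0; nia.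
split=> //; apply: clique_arcs => //; rewrite hRq.
move: hR; rewrite /rho hRq; move: (arcs e R R) => n.
case: q Rq R1 => [|p] _ _; first by lia.
by rewrite subn1 /=; nia.
Qed.

(** A colouring of the contracted graph pulls back along [phi] to one of [V], so the contraction has
    a critical subgraph. The last clause traces an edge at a clique vertex back to a member of its
    colour class; this bounds the edges across by original ones. *)
Lemma contract e V R (X : {set T}) (phi : T -> T) :
  sgr e -> ~~ qcol q e V -> R \subset V -> X \subset R -> #|X| = q ->
  (forall u, u \in R -> phi u \in X) ->
  (forall u v, u \in R -> v \in R -> e u v -> phi u != phi v) ->
  exists (f : rel T) (W : {set T}), [/\ sgr f /\ crit q f W, W :&: R \subset X, W \subset V,
    (forall u v, u \in W :\: R -> v \in W :\: R -> f u v -> e u v) &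
    forall u v, u \in W :&: R -> v \in W :\: R -> f u v ->
      exists2 w, w \in R & (phi w = u) /\ e w v].
Proof.
move=> [es ei] nc sR sX cX phX php.
(* [g] is complete on all of [R], but only the q vertices of [X] are kept below. *)
pose g : rel T := fun u v =>
  if u \in R then (if v \in R then u != v else [exists w in R, (phi w == u) && e w v])
  else (if v \in R then [exists w in R, (phi w == v) && e w u] else e u v).
have sg : sgr g.
  split=> [u v|u]; rewrite /g; last by rewrite eqxx ei; case: (u \in R).
  by case: ifP => uR; case: ifP => vR //; rewrite ?es // eq_sym.
have ncg : ~~ qcol q g ((V :\: R) :|: X).
  apply: contra nc => /qcolP[c cP]; apply/qcolP.
  exists (fun z => if z \in R then c (phi z) else c z).
  have inU z : z \in V -> z \notin R -> z \in (V :\: R) :|: X by move=> zV zR; rewrite !inE zV zR.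
  have inX z : z \in R -> phi z \in (V :\: R) :|: X by move=> zR; rewrite inE phX ?orbT.
  have XR z : z \in R -> phi z \in R by move=> /phX; apply: (subsetP sX).
  have cross u v : u \in R -> v \in V -> v \notin R -> e u v -> c (phi u) != c v.
    move=> uR vV vR euv; apply: cP; rewrite ?inX ?inU //.
    by rewrite /g XR // (negbTE vR); apply/exists_inP; exists u; rewrite ?eqxx.
  move=> u v uV vV euv; case: ifPn => uR; case: ifPn => vR.
  - by apply: cP; rewrite ?inX // /g !XR //; apply: php.
  - exact: cross.
  - by rewrite eq_sym; apply: cross; rewrite // es.
  - by apply: cP; rewrite ?inU // /g (negbTE uR) (negbTE vR).
have [f [W [sW sf sgf cf]]] := crit_exists sg ncg.
exists f, W; split=> //.
- apply/subsetP => z; rewrite inE => /andP[/(subsetP sW)]; rewrite !inE.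
  by case/orP => // /andP[/negbTE->].
- apply: subset_trans sW _; rewrite subUset subsetDl.
  exact: subset_trans sX sR.
- move=> u v; rewrite !inE => /andP[uR _] /andP[vR _] /sf.
  by rewrite /g (negbTE uR) (negbTE vR).
- move=> u v; rewrite !inE => /andP[_ uR] /andP[vR _] /sf.
  rewrite /g uR (negbTE vR) => /exists_inP[w wR /andP[/eqP h ewv]].
  by exists w.
Qed.

End Potential.

Ltac gen_arith := repeat match goal with
  | |- context [arcs ?f ?A ?B] => generalize (arcs f A B); intro
  | |- context [card ?A] => generalize (card A); intro
  | |- context [rho ?q ?f ?A] => generalize (rho q f A); intro
  end; clear; intros.

(** * List colouring from kernels *)

Section Orientation.
Variable T : finType.
Implicit Types (E : {set T * T}) (Z : {set T}) (d : T -> nat).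

Definition incident E Z : nat := \sum_(p in E) ((p.1 \in Z) || (p.2 \in Z)).

Definition head (o : T * T -> bool) (p : T * T) : T := if o p then p.1 else p.2.

Lemma incidentD1 E Z p : p \in E ->
  incident E Z = ((p.1 \in Z) || (p.2 \in Z)) + incident (E :\ p) Z.
Proof. by move=> pE; rewrite /incident (big_setD1 p). Qed.

(** The edge ab is counted for [Z1] and for [Z2], but for the union only and not for the
    intersection; this makes the inequality strict. *)
Lemma incident_submod E Z1 Z2 a b : (a, b) \in E ->
  a \notin Z1 -> b \in Z1 -> a \in Z2 -> b \notin Z2 ->
  incident E (Z1 :|: Z2) + incident E (Z1 :&: Z2) < incident E Z1 + incident E Z2.
Proof.
move=> pE a1 b1 a2 b2; rewrite !(incidentD1 _ pE) /= !inE a2 b1 (negbTE a1) (negbTE b2) /=.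
have : incident (E :\ (a, b)) (Z1 :|: Z2) + incident (E :\ (a, b)) (Z1 :&: Z2) <=
    incident (E :\ (a, b)) Z1 + incident (E :\ (a, b)) Z2.
  rewrite /incident -!big_split /=; apply: leq_sum => -[x y] _ /=; rewrite !inE.
  by case: (x \in Z1); case: (x \in Z2); case: (y \in Z1); case: (y \in Z2).
by rewrite ?orbT ?andbF /=;
  move: (incident _ _) (incident _ _) (incident _ _) (incident _ _) => i j k l; lia.
Qed.

(* Each edge is assigned to one of its ends. If neither assignment of an edge
   ab preserves Hall's condition, there are tight sets separating a from b in
   both ways, which contradicts submodularity. *)
Lemma hall_orientation E d : (forall p, p \in E -> p.1 != p.2) ->
  (forall Z, \sum_(z in Z) d z <= incident E Z) ->
  exists o : T * T -> bool, forall z, d z <= #|[set p in E | head o p == z]|.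
Proof.
have [n] := ubnP #|E|; elim: n E d => // n IH E d hn Eirr hall.
have [E0|[[a b] pE]] := set_0Vmem E.
  exists xpredT => z; have := hall [set z].
  by rewrite big_set1 /incident E0 big_set0 leqn0 => /eqP->.
have nab : a != b by apply: (Eirr _ pE).
pose E' := E :\ (a, b).
have cE : #|E| = #|E'|.+1 by rewrite (cardsD1 (a, b)) pE.
pose dec c z := d z - (z == c).
have step c : (c = a) \/ (c = b) ->
    (forall Z, \sum_(z in Z) dec c z <= incident E' Z) ->
    exists o : T * T -> bool, forall z, d z <= #|[set p in E | head o p == z]|.
  move=> cab hall'; have [||//|o oP] := IH E' (dec c).
  - by move: hn; rewrite cE; lia.
  - by move=> p /setD1P[_]; apply: Eirr.
  exists (fun p => if p == (a, b) then c == a else o p) => z.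
  have := oP z; rewrite /dec.
  have -> : #|[set p in E | head (fun p => if p == (a, b) then c == a else o p) p == z]| =
      (c == z) + #|[set p in E' | head o p == z]|.
    rewrite (cardsD1 (a, b)) !inE pE /head eqxx /=; congr (_ + _).
      by case: cab => ->; rewrite ?eqxx // [b == a]eq_sym (negbTE nab).
    congr #|pred_of_set _|; apply/setP => p; rewrite !inE.
    by case: eqVneq.
  by rewrite eq_sym; case: (z == c); lia.
(* If Hall's condition fails after ab has been assigned to [c], then some set that contains [c'] but
   not [c] was already tight: [c] is dropped from [Z] if it is there. *)
have tight c c' Z : (c = a /\ c' = b) \/ (c = b /\ c' = a) ->
    incident E' Z < \sum_(z in Z) dec c z ->
    exists Z', [/\ c \notin Z', c' \in Z' & incident E Z' <= \sum_(z in Z') d z].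
  move=> cc hlt.
  have incE Y : incident E Y = ((c \in Y) || (c' \in Y)) + incident E' Y.
    by rewrite (incidentD1 _ pE); case: cc => -[-> ->] //=; rewrite orbC.
  have [cZ|cZ] := boolP (c \in Z); last first.
    have sdec : \sum_(z in Z) dec c z = \sum_(z in Z) d z.
      by apply: eq_bigr => z zZ; rewrite /dec; case: eqP => [zc|_];
        rewrite ?subn0 // -zc zZ in cZ *.
    exists Z; have := hall Z; rewrite incE (negbTE cZ) /=; move: hlt; rewrite sdec.
    by case: (c' \in Z) => /=; [split=> //; lia | lia].
  have h1 := hall Z; have h2 := hall (Z :\ c).
  have sdec : \sum_(z in Z) dec c z = (d c - 1) + \sum_(z in Z :\ c) d z.
    rewrite (big_setD1 c) //= {1}/dec eqxx; congr (_ + _).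
    by apply: eq_bigr => z /setD1P[/negbTE zc _]; rewrite /dec zc subn0.
  rewrite (big_setD1 c cZ) /= in h1.
  have i1 := incE Z; have i2 := incE (Z :\ c); rewrite cZ /= in i1.
  have mono : incident E' (Z :\ c) <= incident E' Z.
    apply: leq_sum => p _; rewrite !inE.
    by case: (_ == c); case: (_ == c); case: (_ \in Z); case: (_ \in Z).
  exists (Z :\ c); move: i2; rewrite !inE eqxx /=.
  move: hlt h1 h2 i1 mono; rewrite sdec.
  move: (incident E' _) (incident E' _) (incident E _) (incident E _) (\sum_(_ in _) _) => i j k l s.
  by case: (_ && _) => hlt h1 h2 i1 mono /= i2; split=> //; lia.
have [/forallP h|] := boolP [forall Z : {set T}, \sum_(z in Z) dec a z <= incident E' Z].
  by apply: step h; left.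
rewrite negb_forall => /existsP[Z1]; rewrite -ltnNge => /(tight a b)[|Z1' [a1 b1 t1]];
  first by left.
have [/forallP h|] := boolP [forall Z : {set T}, \sum_(z in Z) dec b z <= incident E' Z].
  by apply: step h; right.
rewrite negb_forall => /existsP[Z2]; rewrite -ltnNge => /(tight b a)[|Z2' [b2 a2 t2]];
  first by right.
have := incident_submod pE a1 b1 a2 b2.
have := hall (Z1' :|: Z2'); have := hall (Z1' :&: Z2').
have : \sum_(z in Z1' :|: Z2') d z + \sum_(z in Z1' :&: Z2') d z =
    \sum_(z in Z1') d z + \sum_(z in Z2') d z.
  rewrite [X in X + _ = _](big_setID Z1') /= setUK setDUl setDv set0U.
  rewrite [X in _ = _ + X](big_setID Z1') /= [Z2' :&: _]setIC -addnA.
  by congr (_ + _); apply: addnC.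
move: (incident _ _) (incident _ _) (incident _ _) (incident _ _) t1 t2 => i j k l t1 t2.
by move: (\sum_(_ in _) _) (\sum_(_ in _) _) t1 t2 (\sum_(_ in _) _) (\sum_(_ in _) _) => s t t1 t2 u v; lia.
Qed.

End Orientation.

Section KernelMethod.
Variables (T : finType) (q : nat) (e : rel T) (A : {set T}) (o : T * T -> bool).
Hypotheses (se : sgr e) (indA : forall x y, x \in A -> y \in A -> ~~ e x y).
Implicit Types S K : {set T}.

Let es : symmetric e. Proof. by case: se. Qed.
Let ei : irreflexive e. Proof. by case: se. Qed.

(** Edges that meet [A] point to their [head], the pair being listed with its end in [A] first.
    Edges outside [A] count in both directions. *)
Definition arrow : rel T := fun x y => e x y &&
  (if x \in A then ~~ o (x, y) else if y \in A then o (y, x) else true).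

(* If every vertex outside [A] has an arrow into [A], then [A] is a kernel; a
   vertex without one is put into the kernel and its neighbours are deleted. *)
Lemma kernel_exists S : exists K, [/\ K \subset S,
  forall x y, x \in K -> y \in K -> ~~ e x y &
  forall v, v \in S -> v \notin K -> exists2 w, w \in K & arrow v w].
Proof.
have [n] := ubnP #|S|; elim: n S => // n IH S hn.
have [/forall_inP h|] := boolP [forall b in S :\: A, [exists a in S :&: A, arrow b a]].
  exists (S :&: A); split; first exact: subsetIl.
    by move=> x y /setIP[_ xA] /setIP[_ yA]; apply: indA.
  move=> v vS; rewrite inE vS /= => vA.
  have vSA : v \in S :\: A by rewrite inE vA.
  by have /exists_inP[w wS aw] := h v vSA; exists w.
rewrite negb_forall => /existsP[b]; rewrite negb_imply => /andP[/setDP[bS bA] hb].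
have [|K [KS Kind Kabs]] := IH (S :\: (b |: [set w | e b w])).
  apply: leq_trans (_ : #|S| <= n) => //; apply: proper_card; apply/properP.
  by split; [apply: subsetDl | exists b; rewrite // !inE eqxx].
have KSp z : z \in K -> [/\ z \in S, z != b & ~~ e b z].
  by move=> /(subsetP KS); rewrite !inE negb_or => /andP[/andP[-> ->] ->].
exists (b |: K); split.
- by rewrite subUset sub1set bS; apply/subsetP => z /KSp[].
- move=> x y; rewrite !in_setU1 => /orP[/eqP->|xK] /orP[/eqP->|yK].
  + by rewrite ei.
  + by have [] := KSp y yK.
  + by rewrite es; have [] := KSp x xK.
  + exact: Kind.
move=> v vS; rewrite in_setU1 negb_or => /andP[vb vK].
have [ebv|nebv] := boolP (e b v); last first.
  have [||w wK aw] := Kabs v; rewrite // ?inE ?negb_or ?vb ?nebv //.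
  by exists w; rewrite // in_setU1 wK orbT.
exists b; rewrite ?in_setU1 ?eqxx //.
rewrite /arrow es ebv (negbTE bA) /=; case: ifPn => // vA.
apply: contra hb => ovb; apply/exists_inP; exists v; first by rewrite inE vS.
by rewrite /arrow ebv (negbTE bA) vA.
Qed.

(** A colour [al] is given to a kernel of the set of vertices whose lists contain it. Every other
    vertex of that set loses one colour but also an out-neighbour, so the hypothesis survives. *)
Lemma kernel_colour (q0 : 0 < q) S (L : T -> {set 'I_q}) :
  (forall v, v \in S -> #|[set w in S | arrow v w]| < #|L v|) ->
  exists c : T -> 'I_q, (forall v, v \in S -> c v \in L v) /\
    forall u v, u \in S -> v \in S -> e u v -> c u != c v.
Proof.
have [n] := ubnP #|S|; elim: n S L => // n IH S L hn hL.
have [S0|[v0 v0S]] := set_0Vmem S.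
  by exists (fun=> Ordinal q0); split=> [v|u v]; rewrite S0 inE.
have [al alL] : exists a, a \in L v0.
  by apply/card_gt0P; apply: leq_trans (hL v0 v0S).
pose Sa := [set v in S | al \in L v].
have [K [KS Kind Kabs]] := kernel_exists Sa.
have KSp z : z \in K -> z \in S /\ al \in L z.
  by move=> /(subsetP KS); rewrite inE => /andP.
have [k0 k0K] : exists k, k \in K.
  have [|nv] := boolP (v0 \in K); first by exists v0.
  by have [|w wK _] := Kabs v0 _ nv; [rewrite inE v0S | exists w].
have [||c [cL cP]] := IH (S :\: K) (fun v => L v :\ al).
- apply: leq_trans (_ : #|S| <= n) => //; apply: proper_card; apply/properP.
  by split; [apply: subsetDl | exists k0; rewrite ?inE ?k0K //; have [] := KSp k0 k0K].
- move=> v /setDP[vS vK].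
  have sub : [set w in S :\: K | arrow v w] \subset [set w in S | arrow v w].
    by apply/subsetP => w; rewrite !inE => /andP[/andP[_ ->] ->].
  have := hL v vS; rewrite (cardsD1 al (L v)).
  have [aL|aL] := boolP (al \in L v); last first.
    by rewrite add0n; apply: leq_ltn_trans; apply: subset_leq_card.
  have [||w wK avw] := Kabs v; rewrite ?inE ?vS //.
  rewrite add1n ltnS; apply: leq_trans.
  apply: proper_card; apply/properP; split=> //; exists w.
    by rewrite inE avw andbT; have [] := KSp w wK.
  by rewrite !inE wK.
exists (fun v => if v \in K then al else c v); split.
  move=> v vS; case: ifPn => vK; first by have [] := KSp v vK.
  by have := cL v; rewrite !inE vK vS => /(_ isT) /andP[].
have key v : v \in S -> v \notin K -> al != c v.
  by move=> vS vK; have := cL v; rewrite !inE vK vS => /(_ isT) /andP[]; rewrite eq_sym.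
move=> u v uS vS euv; case: ifPn => uK; case: ifPn => vK.
- by have := Kind u v uK vK; rewrite euv.
- exact: key.
- by rewrite eq_sym; apply: key.
- by apply: cP; rewrite // inE ?uK ?vK.
Qed.

End KernelMethod.

Lemma kernel_bound (T : finType) (q : nat) (e : rel T) (V A B : {set T}) :
  0 < q -> sgr e -> crit q e V -> A \subset V -> B \subset V -> [disjoint A & B] ->
  (forall x y, x \in A -> y \in A -> ~~ e x y) ->
  arcs e A B <= \sum_(v in A :|: B) (#|nbrs e V v|.+1 - q).
Proof.
move=> q0 se cr sA sB dAB indA; rewrite leqNgt; apply/negP => hlt.
have [es ei] := se.
pose d v := #|nbrs e V v|.+1 - q.
pose P (S : {set T}) := [&& S \subset A :|: B, S != set0 & \sum_(v in S) d v <= arcs e (A :&: S) (B :&: S)].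
have sV : A :|: B \subset V by rewrite subUset sA.
have exP : exists S, P S.
  exists (A :|: B); rewrite /P subxx /=.
  rewrite (setIidPl (subsetUl A B)) (setIidPl (subsetUr A B)) ltnW // andbT.
  apply: contraTneq hlt => AB0; rewrite -leqNgt.
  have := subsetUl A B; rewrite AB0 subset0 => /eqP ->.
  by rewrite arcs0.
have [S PS minS] : exists2 S, P S & forall S', P S' -> #|S| <= #|S'|.
  have [S0 PS0] := exP; case: (@arg_minnP _ S0 P (fun S => #|S|) PS0) => S PS h.
  by exists S.
have /and3P[sS nS hS] := PS.
pose E := [set p : T * T | [&& p.1 \in A :&: S, p.2 \in B :&: S & e p.1 p.2]].
have incE Z : incident E Z = \sum_(x in A :&: S) \sum_(y in B :&: S) (e x y && ((x \in Z) || (y \in Z))).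
  rewrite pair_big_dep /= /incident big_mkcond [RHS]big_mkcond /=.
  apply: eq_bigr => -[x y] _; rewrite inE /=.
  by case: (x \in _); case: (y \in B :&: S); case: (e x y).
pose d' v := if v \in S then d v else 0.
have [p|Z|o oP] := @hall_orientation _ E d'.
- rewrite inE => /and3P[/setIP[pA _] /setIP[pB _] _].
  by apply: contraTneq pA => ->; rewrite (disjointFl dAB).
- have -> : \sum_(z in Z) d' z = \sum_(z in S :&: Z) d z.
    rewrite /d' -big_mkcondr; apply: eq_bigl => z.
    by rewrite inE andbC.
  (* If [Z] violated Hall's condition, [S :\: Z] would satisfy [P] and be smaller. *)
  rewrite leqNgt; apply/negP => hZ.
  have hsum : \sum_(v in S) d v = \sum_(z in S :&: Z) d z + \sum_(z in S :\: Z) d z by exact: big_setID.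
  have harc : arcs e (A :&: S) (B :&: S) = incident E Z + arcs e (A :&: (S :\: Z)) (B :&: (S :\: Z)).
    rewrite incE !setIDA /arcs.
    rewrite [X in _ = _ + X]big_mkcond [X in _ = X + _]big_mkcond [LHS]big_mkcond -big_split /=.
    apply: eq_bigr => x _; rewrite in_setD; case xAS: (x \in A :&: S); last by rewrite andbF.
    rewrite andbT; case xZ: (x \in Z) => /=.
      by rewrite addn0; apply: eq_bigr => y _; rewrite andbT.
    rewrite [X in _ = _ + X]big_mkcond [X in _ = X + _]big_mkcond [LHS]big_mkcond -big_split /=.
    apply: eq_bigr => y _; rewrite in_setD; case: (y \in B :&: S); last by rewrite andbF.
    by case: (y \in Z); rewrite ?andbT ?andbF ?addn0.
  have : P (S :\: Z).
    apply/and3P; split; first by apply: subset_trans sS; apply: subsetDl.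
      apply: contraTneq hZ => SZ0; rewrite -leqNgt.
      by move: hS; rewrite hsum harc SZ0 big_set0 setI0 arcs0 !addn0.
    by move: hS hZ; rewrite hsum harc;
      move: (incident _ _) (arcs _ _ _) (\sum_(_ in _) _) (\sum_(_ in _) _) => i j k l; lia.
  move=> /minS; rewrite -(cardsID Z S) -{2}[#|S :\: Z|]add0n leq_add2r leqn0 cards_eq0 => /eqP SZ.
  by rewrite SZ big_set0 in hZ.
have SV := subset_trans sS sV.
have /qcolP[c0 c0P] : qcol q e (V :\: S).
  apply: crit_proper cr _; apply/properP; split; first exact: subsetDl.
  by case/set0Pn: nS => x xS; exists x; rewrite ?inE ?xS // (subsetP SV).
pose L v := ~: (c0 @: nbrs e (V :\: S) v).
have [v vS|c [cL cP]] := @kernel_colour T q e A o se indA q0 S L.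
  have h1 : #|c0 @: nbrs e (V :\: S) v| <= #|nbrs e (V :\: S) v| by apply: leq_imset_card.
  have h2 := cardsC (c0 @: nbrs e (V :\: S) v); rewrite card_ord -/(L v) in h2.
  have h3 : #|nbrs e V v| = #|nbrs e S v| + #|nbrs e (V :\: S) v|.
    by rewrite -!arcs1 (arcsIDr e S) (setIidPr SV).
  have h4 := mindeg se cr (subsetP SV v vS).
  (* The other end of an edge with head [v], given by [oth], is a neighbour to which [v] has no
     arrow. *)
  have h5 : d v <= #|nbrs e S v :\: [set w in S | arrow e A o v w]|.
    have := oP v; rewrite /d' vS => h; apply: leq_trans h _.
    pose oth (p : T * T) := if o p then p.2 else p.1.
    rewrite -(card_in_imset (f := oth)).
      apply: subset_leq_card; apply/subsetP => _ /imsetP[[x y] hp ->].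
      move: hp; rewrite !inE /= => /andP[/and3P[/andP[xA xS] /andP[yB yS] exy]].
      have yA : y \in A = false by rewrite (disjointFl dAB).
      rewrite /head /oth; case oxy: (o (x, y)) => /= /eqP <-.
        by rewrite /arrow yS exy xA oxy.
      by rewrite /arrow xS es exy yA xA oxy.
    move=> [x y] [x' y']; rewrite !inE /= => /andP[/and3P[/andP[xA _] /andP[yB _] _] h1'].
    move=> /andP[/and3P[/andP[xA' _] /andP[yB' _] _] h2'].
    have nAB z w : z \in A -> w \in B -> z = w -> False.
      by move=> zA wB zw; move: zA; rewrite zw (disjointFl dAB).
    move: h1' h2'; rewrite /head /oth.
    case: (o (x, y)); case: (o (x', y')) => /= /eqP h1' /eqP h2'.
    - by move=> ->; rewrite h1' h2'.
    - by case: (nAB x y'); rewrite // h1'.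
    - by case: (nAB x' y); rewrite // h2'.
    - by move=> ->; rewrite h1' h2'.
  have h6 : #|nbrs e S v| = #|[set w in S | arrow e A o v w]| + #|nbrs e S v :\: [set w in S | arrow e A o v w]|.
    rewrite -(cardsID [set w in S | arrow e A o v w] (nbrs e S v)); congr (_ + _).
    congr #|pred_of_set _|; apply/setP => w; rewrite !inE /arrow.
    by case: (w \in S); case: (e v w).
  have h7 : q <= #|nbrs e (V :\: S) v| + #|L v| by rewrite -[X in X <= _]h2 leq_add2r.
  have : #|[set w in S | arrow e A o v w]| + #|nbrs e (V :\: S) v| < q.
    by move: h3 h4 h5 h6; rewrite /d; gen_arith; lia.
  by move=> h8; move: (leq_trans h8 h7); rewrite addnC ltn_add2l.
have [nc _ _] := cr; case/negP: nc; apply/qcolP.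
exists (fun v => if v \in S then c v else c0 v) => x y xV yV exy.
have cross u w : u \in S -> w \in V -> w \notin S -> e u w -> c u != c0 w.
  move=> uS wV wS euw; have := cL u uS; rewrite inE; apply: contraNneq => ->.
  by apply: imset_f; rewrite !inE wS wV.
case: ifPn => xS; case: ifPn => yS.
- exact: cP.
- exact: cross.
- by rewrite eq_sym; apply: cross; rewrite // es.
- by apply: c0P; rewrite // inE ?xS ?yS.
Qed.

(** * Minimal counterexamples *)

Section PotentialArith.
Local Open Scope ring_scope.

(** A set with more than q vertices and potential at most that of K_q has more arcs than K_q.
    Contracting it therefore loses edges, so that minimality applies to the result. *)
Lemma gap_edges (q r a : nat) : (2 < q)%N -> (q < r)%N ->
  (q%:Z * q%:Z + q%:Z - 2) * r%:Z - q%:Z * a%:Z <= 2 * q%:Z * (q%:Z - 1) ->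
  (q * (q - 1) < a)%N.
Proof.
move=> q3 qr h; rewrite ltnNge; apply/negP => ha.
have h6 : (q%:Z * q%:Z + q%:Z - 2) * (q%:Z + 1) <= (q%:Z * q%:Z + q%:Z - 2) * r%:Z.
  by apply: ler_wpM2l; [move: q3; clear; nia | lia].
have h7 : q%:Z * a%:Z <= q%:Z * (q%:Z * (q%:Z - 1)).
  by apply: ler_wpM2l => //; move: ha q3; clear; case: q => // p; rewrite subn1 /=; nia.
have h8 : (q%:Z * q%:Z + q%:Z - 2) * (q%:Z + 1) <=
    q%:Z * (q%:Z * (q%:Z - 1)) + 2 * q%:Z * (q%:Z - 1) by lra.
by move: h8 q3; clear; nia.
Qed.

Lemma ky_lt_clique (q j : nat) : (2 < q)%N -> (0 < j)%N -> (j <= q)%N ->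
  ky_bound q < (q%:Z * q%:Z + q%:Z - 2) * j%:Z - q%:Z * (j%:Z * (j%:Z - 1)).
Proof.
move=> q3 j0 jq; rewrite /ky_bound; case: (ltngtP j 1) => [|j1|->]; first by case: j j0 {jq}.
  apply: lt_le_trans (clique_pot j1 jq); move: q3; clear; nia.
by move: q3; clear; lia.
Qed.

End PotentialArith.

(** A lost edge costs arcs, and so does a lost vertex, because no vertex is isolated. *)
Lemma arcs_eq (T : finType) (f g : rel T) (V W : {set T}) : sgr f -> sgr g ->
  W \subset V -> (forall a b, f a b -> g a b) -> arcs f W W = arcs g V V ->
  (forall z, z \in V -> nbrs g V z != set0) ->
  W = V /\ forall a b, a \in V -> b \in V -> f a b = g a b.
Proof.
move=> sf sg sW sfg hE hN; have [gs gi] := sg.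
have WV : W = V.
  apply/eqP; rewrite eqEsubset sW /=; apply/subsetP => z zV; apply: contraT => zW.
  have : arcs f W W <= arcs g (V :\ z) (V :\ z).
    by have sWz : W \subset V :\ z; [rewrite subsetD1 sW zW | apply: leq_arcs => // a b _ _;
      apply: sfg].
  by rewrite hE (arcsD1 gs gi zV); have := hN z zV; rewrite -card_gt0; gen_arith; lia.
split=> // a b aV bV; apply/idP/idP => [/sfg //|gab]; apply: contraT => nf.
have : arcs f W W <= arcs (del g a b) V V.
  apply: leq_arcs => // u v _ _ fuv; rewrite /del sfg //=.
  apply: contra nf => /orP[] /andP[/eqP <- /eqP <-] //.
  by case: sf => fs _; rewrite fs.
by rewrite hE (arcs_del sg aV bV gab) -[X in _ <= X]addn0 leq_add2l.
Qed.

Section CliqueArith.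
Local Open Scope ring_scope.

Lemma two_cliques_cast (q b a : nat) : (0 < b)%N -> (b.+2 <= q)%N ->
  (q * (q - 1) + 2 * (q - b) * b + b * (b - 1) <= a)%N ->
  q%:Z * (q%:Z - 1) + 2 * (q%:Z - b%:Z) * b%:Z + b%:Z * (b%:Z - 1) <= a%:Z.
Proof.
case: b => // b _ bq; have [c ->] : exists c, q = (c + b.+1)%N.
  by exists (q - b.+1)%N; lia.
by rewrite addnK addnS !subn1 /=; clear; lia.
Qed.

(** Here b vertices of one q-clique lie outside another, and the two share q - b, at least two. The
    three terms count the first clique, the arcs between the intersection and the b vertices, and
    those among the b vertices. *)
Lemma two_cliques_arith (q b a : nat) : (0 < b)%N -> (b.+2 <= q)%N ->
  (q * (q - 1) + 2 * (q - b) * b + b * (b - 1) <= a)%N ->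
  (q%:Z * q%:Z + q%:Z - 2) * (q + b)%:Z - q%:Z * a%:Z <= 2 * q%:Z * (q%:Z - 1).
Proof.
move=> b0 bq ha.
have h1 : (q%:Z * (q%:Z - 1) + 2 * (q%:Z - b%:Z) * b%:Z + b%:Z * (b%:Z - 1)) <= a%:Z.
  exact: two_cliques_cast.
have h2 : q%:Z * (q%:Z * (q%:Z - 1) + 2 * (q%:Z - b%:Z) * b%:Z + b%:Z * (b%:Z - 1)) <= q%:Z * a%:Z.
  exact: ler_wpM2l.
have h3 : 0 <= b%:Z * (q%:Z * (q%:Z - 2 - b%:Z) + 2).
  by apply: mulr_ge0 => //; move: bq; clear; nia.
by move: h2 h3; clear; lia.
Qed.

(** The extra 2 b stands for b further edges between the two differences of the cliques. *)
Lemma two_cliques_span_arith (q b a : nat) : (2 < q)%N -> (0 < b)%N -> (b.+2 <= q)%N ->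
  (q * (q - 1) + 2 * (q - b) * b + b * (b - 1) + 2 * b <= a)%N ->
  (q%:Z * q%:Z + q%:Z - 2) * (q + b)%:Z - q%:Z * a%:Z <= ky_bound q.
Proof.
move=> q3 b0 bq ha; rewrite /ky_bound.
have h1 : (q%:Z * (q%:Z - 1) + 2 * (q%:Z - b%:Z) * b%:Z + b%:Z * (b%:Z - 1)) + 2 * b%:Z <= a%:Z.
  have ha2 : (2 * b <= a)%N by apply: leq_trans ha; apply: leq_addl.
  have -> : a%:Z = (a - 2 * b)%N%:Z + 2 * b%:Z by move: ha2; clear; lia.
  by rewrite lerD2r; apply: two_cliques_cast; rewrite // leq_subRL // addnC.
have h2 : q%:Z * (q%:Z * (q%:Z - 1) + 2 * (q%:Z - b%:Z) * b%:Z + b%:Z * (b%:Z - 1) + 2 * b%:Z) <= q%:Z * a%:Z.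
  exact: ler_wpM2l.
have h3 : 0 <= (b%:Z - 1) * (q%:Z * (q%:Z - 1 - b%:Z) + 2).
  by apply: mulr_ge0 => //; move: bq b0; clear; nia.
by move: h2 h3; clear; lia.
Qed.

Lemma near_clique_arith (q a : nat) : (2 < q)%N -> (q * (q - 1) + 2 * (q - 1) <= a)%N ->
  (q%:Z * q%:Z + q%:Z - 2) * (q.+1)%:Z - q%:Z * a%:Z <= 2 * q%:Z * (q%:Z - 1).
Proof.
move=> q3 ha.
have h1 : q%:Z * (q%:Z - 1) + 2 * (q%:Z - 1) <= a%:Z.
  by move: ha q3; clear; case: q => // q; rewrite subn1 /=; nia.
have h2 : q%:Z * (q%:Z * (q%:Z - 1) + 2 * (q%:Z - 1)) <= q%:Z * a%:Z by exact: ler_wpM2l.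
by move: h2 q3; clear; nia.
Qed.

End CliqueArith.

Section DischargeArith.

(** For d > q this is q d - (q^2 + q - 2), the amount by which a vertex of degree d lowers the
    potential of the whole graph. A vertex of degree q raises it by q - 2. *)
Definition surplus (q d : nat) : nat := q * (d - q - 1) + 2.

Lemma surplus_ge (q d : nat) : 1 < q -> q.+1 < d -> d <= surplus q d.
Proof.
move=> q1 hd; rewrite /surplus; have [j ->] : exists j, d = q + 2 + j by exists (d - (q + 2)); lia.
have -> : q + 2 + j - q - 1 = j.+1 by lia.
by move: q1; clear; nia.
Qed.

Lemma surplus_half (d : nat) : 3 < d -> d <= 2 * surplus 3 d.
Proof. by rewrite /surplus; lia. Qed.

(** If the q + 1 - t neighbours outside a cluster of size t each send surplus / d to a cluster
    vertex, that vertex receives q - 2. *)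
Lemma surplus_cluster (q d t : nat) : 1 < t -> t.+2 <= q -> q + t <= d ->
  (q - 2) * d <= surplus q d * (q.+1 - t).
Proof.
move=> t1 tq hd; rewrite /surplus.
have [u ht] : exists u, t = u + 2 by exists (t - 2); lia.
have [m hq] : exists m, q = t + 2 + m by exists (q - (t + 2)); lia.
have [j ->] : exists j, d = q + t + j by exists (d - (q + t)); lia.
have -> : q + t + j - q - 1 = u + 1 + j by lia.
have -> : q - 2 = u + 2 + m by lia.
have -> : q.+1 - t = m + 3 by lia.
by rewrite hq ht; clear; nia.
Qed.

(** The same for a cluster of size t inside a q-clique: the other q - t vertices together provide
    t. *)
Lemma surplus_clique (q d t : nat) : 1 < t -> t.+2 <= q -> q + t <= d ->
  t * d <= surplus q d * (q - t).
Proof.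
move=> t1 tq hd; rewrite /surplus.
have [u ht] : exists u, t = u + 2 by exists (t - 2); lia.
have [m hq] : exists m, q = t + 2 + m by exists (q - (t + 2)); lia.
have [j ->] : exists j, d = q + t + j by exists (d - (q + t)); lia.
have -> : q + t + j - q - 1 = u + 1 + j by lia.
have -> : q - t = m + 2 by lia.
by rewrite hq ht; clear; nia.
Qed.

Local Open Scope ring_scope.

Lemma sum_share_ge (T : finType) (A : {set T}) (s d : T -> nat) (a : nat) :
  A != set0 -> (forall v, v \in A -> 0 < d v)%N ->
  (forall v, v \in A -> a * d v <= s v * #|A|)%N ->
  a%:R <= \sum_(v in A) (s v)%:R / (d v)%:R :> rat.
Proof.
rewrite -card_gt0 => A0 d0 h.
have -> : a%:R = \sum_(v in A) (a%:R / #|A|%:R) :> rat.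
  by rewrite sumr_const -[RHS]mulr_natr divfK // pnatr_eq0 -lt0n.
apply: ler_sum => v vA; rewrite ler_pdivrMr ?ltr0n // mulrAC ler_pdivlMr ?ltr0n ?d0 //.
by rewrite -!natrM ler_nat h.
Qed.

End DischargeArith.

Section MinimalCounterexample.
Variables (T : finType) (q : nat) (e : rel T) (V : {set T}).
Implicit Types (f : rel T) (A B C W R X S : {set T}) (x y u v : T).
Hypotheses (q3 : 2 < q) (se : sgr e) (cr : crit q e V).

Definition cnbrs (f : rel T) (W : {set T}) (x : T) : {set T} :=
  [set y in W | (y == x) || f x y].

Definition twins (f : rel T) (W : {set T}) : nat :=
  arcs (fun x y => cnbrs f W x == cnbrs f W y) W W.

Hypothesis IH : forall f W, sgr f -> crit q f W ->
  arcs f W W < arcs e V V \/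
    arcs f W W = arcs e V V /\ twins e V < twins f W ->
  (rho q f W <= ky_bound q)%R.
Hypothesis large : (ky_bound q < rho q e V)%R.

Let es : symmetric e. Proof. by case: se. Qed.
Let ei : irreflexive e. Proof. by case: se. Qed.
Let q0 : 0 < q. Proof. exact: leq_trans q3. Qed.

(* For a set R of minimal potential, at most i edges are added between the
   boundary vertices of R, so that a colour class with two boundary vertices
   misses at least i edges of the cut; these are lost by the contraction. *)
Lemma gap_large R : R \proper V -> q < #|R| -> (2 * q%:Z * (q%:Z - 1) < rho q e R)%R.
Proof.
move=> pR0 hRq0; rewrite ltNge; apply/negP => hR0.
pose P (S : {set T}) := (S \proper V) && (q < #|S|).
have PR0 : P R by rewrite /P pR0 hRq0.
case: (Order.TotalTheory.arg_minP (rho q e) PR0) => S /andP[pR hRq] minS.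
have {hR0} hR := le_trans (minS _ PR0) hR0.
move: S pR hRq minS hR => {PR0 hRq0 pR0}R pR hRq minR hR.
have sR := proper_sub pR.
have Rn0 : R != set0 by rewrite -card_gt0; apply: leq_ltn_trans hRq.
pose m := rho q e R; rewrite -/m in minR hR.
(* The least such i has two uses. If positive, it satisfies [ky_bound] + 2 q i < m, so i added edges
   create no critical graph inside [R]. And i missed edges make up for the difference between m and
   the potential q^2 + q - 2 of a single vertex. *)
pose Q i := (m <= q%:Z * q%:Z + q%:Z - 2 + 2 * q%:Z * i%:Z)%R.
have exQ : exists i, Q i by exists q; rewrite /Q; nia.
have [i Qi mini] := ex_minnP exQ.
have predQ : 0 < i -> (q%:Z * q%:Z + q%:Z - 2 + 2 * q%:Z * (i%:Z - 1) < m)%R.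
  move=> i0; rewrite ltNge; apply/negP => h.
  have : Q i.-1 by rewrite /Q -subn1 -subzn.
  by move/mini; rewrite leqNgt ltn_predL i0.
have i2 : 2 * i <= q.
  case: (posnP i) => [->//|i0]; have := predQ i0; nia.
have cutR := crit_cut se cr pR Rn0.
pose w u := #|nbrs e (V :\: R) u|.
have sw : arcs e R (V :\: R) = \sum_(u in R) w u by rewrite arcs_nbrs.
have [s [ss sirr scov]] : exists s : seq (T * T), [/\ size s <= i,
    (forall p, p \in s -> p.1 != p.2) &
    forall M : {set T}, (forall p, p \in s -> ~~ ((p.1 \in M) && (p.2 \in M))) ->
      forall a b, a \in M -> b \in M -> a \in R -> b \in R -> a != b ->
        0 < w a -> 0 < w b -> i <= \sum_(u in R :\: M) w u].
  by apply: pair_cover; rewrite -sw; apply: leq_trans cutR.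
pose h := addp e s.
have sh : sgr h by apply: addp_sgr.
have harcs W : arcs h W W <= arcs e W W + 2 * i.
  by apply: leq_trans (arcs_addp e s W) _; rewrite leq_add2l leq_mul2l ss.
(* A critical subgraph on [W] has fewer edges than the whole graph, since the cut around [W] has at
   least q >= 2 i edges. Hence [W] has original potential at most [ky_bound] + 2 q i, which
   contradicts the choice of [R]; for i = 0 nothing was added and [W] is colourable anyway. *)
have colR : qcol q h R.
  have [//|ncol] := boolP (qcol q h R); exfalso.
  have [f [W [sW sf sgf cf]]] := crit_exists sh ncol.
  have sWV := subset_trans sW sR.
  have Wq : q < #|W| by apply: (crit_card _ sgf cf).
  have pW : W \proper V by apply: sub_proper_trans pR.
  have fh : arcs f W W <= arcs h W W by apply: leq_arcs => // x y _ _; apply: sf.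
  have eV : arcs e V V = arcs e W W + 2 * arcs e W (V :\: W) + arcs e (V :\: W) (V :\: W).
    by rewrite -arcsUU ?disjoints_subset ?setDE ?subsetIr // ?setUIr ?setUCr ?setIT ?(setUidPr _) //;
      rewrite setCI setCK subsetUr.
  have cW : q <= arcs e W (V :\: W).
    by apply: crit_cut => //; rewrite -card_gt0; apply: leq_ltn_trans Wq.
  have rW : (rho q f W <= ky_bound q)%R.
    by apply: IH => //; left; move: (harcs W) fh eV cW i2 q0; gen_arith; lia.
  have mW : (m <= rho q e W)%R by apply: minR; rewrite /P pW.
  have hWi := harcs W.
  case: (posnP i) => [i0|ipos].
    have s0 : s = [::] by apply/eqP; rewrite -size_eq0 -leqn0 -i0.
    case: cf => /negP[]; have [_ [z zV zW]] := properP pW.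
    apply: (crit_nonsub cr sWV zV zW) => x y _ _ /sf.
    by rewrite /h /addp s0 !in_nil !orbF.
  have := predQ ipos; move: rW mW; rewrite /rho /ky_bound.
  by move: hWi fh q3; gen_arith; nia.
have /qcolP[c cP] := colR.
(* Any q vertices of [R] serve as names of the colours. *)
have [X sX cX] : exists2 X : {set T}, X \subset R & #|X| = q.
  exists [set x in take q (enum R)].
    by apply/subsetP => x; rewrite inE => /mem_take; rewrite mem_enum.
  rewrite cardsE (card_uniqP _) ?take_uniq ?enum_uniq // size_takel // -cardE.
  exact: ltnW.
have [x0 x0R] := set0Pn _ Rn0.
pose phi u := nth x0 (enum X) (c u).
have phX u : phi u \in X by rewrite -mem_enum mem_nth // -cardE cX.
have phI u v : phi u = phi v -> c u = c v.
  move/eqP; rewrite nth_uniq ?enum_uniq -?cardE ?cX //.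
  by move/eqP => /val_inj.
have [f [W [[sgf cf] WX WV fo fx]]] : exists (f : rel T) (W : {set T}),
    [/\ sgr f /\ crit q f W, W :&: R \subset X, W \subset V,
    (forall u v, u \in W :\: R -> v \in W :\: R -> f u v -> e u v) &
    forall u v, u \in W :&: R -> v \in W :\: R -> f u v ->
      exists2 w, w \in R & (phi w = u) /\ e w v].
  apply: contract => //; first by case: cr.
  by move=> u v uR vR euv; apply: contraTneq (cP u v uR vR _) => [/phI ->|];
    rewrite ?eqxx ///h /addp ?euv.
pose Wx := W :&: R; pose Wo := W :\: R; rewrite -/Wx -/Wo in WX fo fx.
have Wq : q < #|W| by apply: (crit_card _ sgf cf).
have WE : W = Wo :|: Wx by rewrite setUC setID.
have dW : [disjoint Wo & Wx] by rewrite disjoints_subset; apply/subsetP => z;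
  rewrite !inE => /andP[/negbTE->]; rewrite andbF.
have dR : [disjoint Wo & R] by rewrite disjoint_sym disjoints_subset /Wo setCD subsetUr.
have [fs fi] := sgf.
pose M := [set w in R | phi w \in Wx].
have sM : M \subset R by apply/subsetP => z; rewrite inE => /andP[].
have aWx : arcs f Wo Wx <= arcs e Wo M.
  rewrite (arcsC Wo Wx fs) (arcsC Wo M es) /arcs exchange_big [X in _ <= X]exchange_big /=.
  apply: leq_sum => v vW.
  rewrite [X in _ <= X](partition_big phi (mem Wx)) /=; last by move=> u; rewrite inE => /andP[].
  apply: leq_sum => u uW; case fuv: (f u v) => //.
  have [z zR [phz ezv]] := fx u v uW vW fuv.
  by rewrite (bigD1 z) /= ?ezv // inE zR phz uW /=.
have aMR : arcs e Wo M <= arcs e Wo R by apply: leq_arcs.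
pose j := #|Wx|.
have jq : j <= q by rewrite -cX subset_leq_card.
have j0 : 0 < j.
  rewrite card_gt0; apply/negP => /eqP Wx0; case: cf => nc _ _; case/negP: nc.
  have WoE : W = Wo by rewrite WE Wx0 setU0.
  apply: (crit_nonsub cr WV (subsetP sR _ x0R)); last by rewrite WoE.
  by apply: contraTN x0R => x0W; have := x0W; rewrite WoE inE => /andP[].
have card_W : #|W| = #|Wo| + j.
  by rewrite {1}WE cardsU (disjoint_setI0 dW) cards0 subn0.
have wxpot := rho_ge q fi (erefl j : #|Wx| = j).
have rhoW := rhoU q fs dW; rewrite -WE in rhoW.
have rhoUR := rhoU q es dR; rewrite -/m in rhoUR.
have arcsW := arcsUU fs dW; rewrite -WE in arcsW.
have arcsR := arcsUU es dR.
have rhoWo : (rho q e Wo <= rho q f Wo)%R by apply: rho_sub.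
have sUV : Wo :|: R \subset V.
  by rewrite subUset sR andbT (subset_trans _ WV) // subsetDl.
have sarc : arcs f W W < arcs e V V.
  have h1 : arcs e (Wo :|: R) (Wo :|: R) <= arcs e V V by apply: leq_arcs.
  have h2 : arcs f Wo Wo <= arcs e Wo Wo by apply: leq_arcs.
  have h3 := arcs_irr Wx fi.
  have h4 : q * (q - 1) < arcs e R R.
    exact: gap_edges hR.
  have h5 : #|Wx| * (#|Wx| - 1) <= q * (q - 1) by apply: leq_mul => //; apply: leq_sub2r.
  by move: h1 h2 h3 h4 h5 aWx aMR; rewrite arcsW arcsR; gen_arith; lia.
have rW : (rho q f W <= ky_bound q)%R by apply: IH => //; left.
have Won0 : Wo != set0 by rewrite -card_gt0; move: card_W Wq jq; rewrite /j; gen_arith; lia.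
have dis : forall z, z \in Wo -> z \notin R by move=> z; rewrite inE => /andP[].
(* [R] is put back in the place of [Wx]. Edges from [Wo] to [R] outside [M] were not seen by the
   contraction and are an additional gain. *)
have U_bound : (rho q e (Wo :|: R) <=
    ky_bound q - rho q f Wx + m - 2 * q%:Z * ((arcs e Wo R)%:Z - (arcs e Wo M)%:Z))%R.
  rewrite rhoUR; move: rW; rewrite rhoW.
  have : (2 * q%:Z * (arcs f Wo Wx)%:Z <= 2 * q%:Z * (arcs e Wo M)%:Z)%R by apply: ler_wpM2l.
  by move: rhoWo; rewrite /ky_bound /m; gen_arith; lia.
have wxpos : (ky_bound q < rho q f Wx)%R.
  exact: lt_le_trans (ky_lt_clique q3 j0 jq) wxpot.
have aMRq : (0 <= 2 * q%:Z * ((arcs e Wo R)%:Z - (arcs e Wo M)%:Z))%R.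
  by apply: mulr_ge0 => //; rewrite subr_ge0 lez_nat.
(* Otherwise this set would be proper with potential below the minimum m, as [Wx] has potential
   above [ky_bound]. *)
have UV : Wo :|: R = V.
  apply/eqP; rewrite eqEproper sUV /=; apply/negP => pU.
  have : (m <= rho q e (Wo :|: R))%R.
    apply: minR; rewrite /P pU; apply: leq_trans hRq _; apply: subset_leq_card.
    exact: subsetUr.
  by move: U_bound wxpos aMRq; move: (2 * _ * (_ - _))%R (ky_bound q); rewrite /m; gen_arith; lia.
have WoE : Wo = V :\: R.
  by apply/setP => z; rewrite -UV !inE; case: (z \in R) => //=; rewrite orbF.
rewrite UV in U_bound.
(* Two or more clique vertices have potential at least 2 q (q - 1) >= m, which suffices. A single
   one needs the i missed edges. *)
case: (ltngtP j 1) => j1; first by rewrite ltnNge j0 in j1.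
  have := clique_pot j1 jq => hp; have := large; move: U_bound wxpot hp aMRq hR.
  by move: (2 * _ * (_ - _))%R (ky_bound q); rewrite /m; gen_arith; lia.
have Mi : i <= arcs e Wo R - arcs e Wo M.
  have wE : arcs e Wo R - arcs e Wo M = \sum_(u in R :\: M) w u.
    rewrite (arcsIDr e M Wo R) (setIidPr sM) addKn (arcsC _ _ es) arcs_nbrs.
    by rewrite WoE.
  have [i0|ipos] := posnP i; first by rewrite i0.
  pose Mp := [set u in M | 0 < w u].
  have [/existsP[a /existsP[b /and3P[aM bM nab]]]|hone] :=
      boolP [exists a, exists b, [&& a \in Mp, b \in Mp & a != b]].
    rewrite wE; move: aM bM; rewrite !inE => /andP[/andP[aR aM] wa] /andP[/andP[bR bM] wb].
    apply: (scov _ _ a b) => //; rewrite ?inE ?aR ?bR //.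
    move=> [u v] /= us; apply/negP; rewrite !inE => /andP[/andP[uR ux] /andP[vR vx]].
    have : c u != c v by apply: cP; rewrite // /h /addp us orbT.
    have /cards1P[x Wx1] : #|Wx| == 1 by rewrite -/j j1.
    have {}ux : phi u \in Wx by rewrite inE.
    have {}vx : phi v \in Wx by rewrite inE.
    move: ux vx; rewrite Wx1 => /set1P ux /set1P vx.
    by rewrite (phI u v) ?eqxx // ux vx.
  have Mp1 a b : a \in Mp -> b \in Mp -> a = b.
    move=> aM bM; apply/eqP; apply: contraNT hone => nab.
    by apply/existsP; exists a; apply/existsP; exists b; rewrite aM bM.
  (* With at most one boundary vertex in the class, a colouring of [Wo :|: Mp] in the original graph
     colours the contraction. If [Mp] is empty, the default [c x0] goes to a vertex without edges to
     [Wo]. *)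
  exfalso; have [ncf _ _] := cf; case/negP: ncf.
  have /qcolP[c1 c1P] : qcol q e (Wo :|: Mp).
    apply: crit_proper cr _; rewrite properE.
    have sMp : Mp \subset R by apply: subset_trans sM; apply/subsetP => z; rewrite inE => /andP[].
    rewrite -{1}UV setUS //=; apply/negP => hV.
    have RM z : z \in R -> z \in Mp.
      move=> zR; have := subsetP hV z (subsetP sR z zR).
      by rewrite inE => /orP[/dis|//]; rewrite zR.
    have : #|R| <= 1.
      rewrite -(cards1 x0); apply: subset_leq_card; apply/subsetP => z zR.
      by rewrite inE (Mp1 z x0) // RM.
    by rewrite leqNgt (leq_trans _ hRq).
  apply/qcolP;
    exists (fun z => if z \in R then (if [pick u in Mp] is Some u then c1 u else c x0) else c1 z).
  have key x y : x \in Wx -> y \in Wo -> f x y ->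
      (if [pick u in Mp] is Some u then c1 u else c x0) != c1 y.
    move=> xW yW fxy; have [z zR [phz ezy]] := fx x y xW yW fxy.
    have zM : z \in Mp.
      have zM : z \in M by rewrite inE zR phz xW.
      rewrite inE zM /= /w card_gt0; apply/set0Pn; exists y.
      by rewrite inE -WoE yW.
    case: pickP => [u uM|/(_ z)]; last by rewrite zM.
    by rewrite (Mp1 u z uM zM); apply: c1P; rewrite // in_setU ?yW ?zM ?orbT.
  move=> x y xW yW fxy.
  have inWo z : z \in W -> z \notin R -> z \in Wo by move=> zW zR; rewrite inE zR.
  have inWx z : z \in W -> z \in R -> z \in Wx by move=> zW zR; rewrite inE zW.
  case: ifPn => xR; case: ifPn => yR.
  - have /cards1P[z Wx1] : #|Wx| == 1 by rewrite -/j j1.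
    have := inWx x xW xR; have := inWx y yW yR; rewrite Wx1 !inE => /eqP hy /eqP hx.
    by move: fxy; rewrite hx hy fi.
  - by apply: key fxy; [apply: inWx | apply: inWo].
  - by rewrite eq_sym; apply: (key y x); rewrite ?inWx ?inWo // fs.
  - by apply: c1P; rewrite ?in_setU ?inWo //; apply: fo; rewrite ?inWo.
have := large; move: U_bound Mi aMR Qi wxpot; rewrite /ky_bound /Q j1 /m.
move: (rho q f Wx) (rho q e V) (arcs e Wo R) (arcs e Wo M) (rho q e R) => r v a b m'.
clear=> h1 h2 h3 h4 h5 h6.
have : (2 * q%:Z * i%:Z <= 2 * q%:Z * (a%:Z - b%:Z))%R by apply: ler_wpM2l => //; lia.
by move: h1 h2 h3 h4 h5 h6; clear; lia.
Qed.

Lemma gap R : R \proper V -> 1 < #|R| ->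
  (rho q e R <= 2 * q%:Z * (q%:Z - 1))%R -> qclique q e V R.
Proof.
move=> pR R1 hR; have [hRq|hRq] := leqP #|R| q.
  have [h1 h2] := small_gap se R1 hRq hR.
  by apply/qcliqueP; split=> //; apply: proper_sub.
by have := gap_large pR hRq; rewrite ltNge hR.
Qed.

Lemma deg_ge x : x \in V -> q <= #|nbrs e V x|.
Proof. exact: mindeg. Qed.

Lemma card_cnbrs x : x \in V -> #|cnbrs e V x| = #|nbrs e V x|.+1.
Proof.
move=> xV; rewrite (cardsD1 x) !inE xV eqxx /= add1n; congr _.+1.
congr #|pred_of_set _|; apply/setP => y; rewrite !inE.
by case: eqVneq => [->|] //=; rewrite ei andbF.
Qed.

(** As a proper subset, K_(q+1) minus an edge has too small a potential. As the whole graph, it has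
    all degrees at least q and hence satisfies the bound. Taking a = b covers the complete graph. *)
Lemma no_near_clique S a b : S \subset V -> #|S| = q.+1 -> a \in S ->
  (forall x y, x \in S -> y \in S -> x != y -> [|| e x y, (x == a) && (y == b) | (x == b) && (y == a)]) ->
  False.
Proof.
move=> sS cS aS cl.
have [SV|pS] := eqVproper sS.
  have : (rho q e V <= ky_bound q)%R.
    have : #|V| * q <= arcs e V V.
      by rewrite arcs_nbrs -sum_nat_const; apply: leq_sum => x; apply: deg_ge.
    rewrite /rho /ky_bound -SV cS; by gen_arith; nia.
  by rewrite leNgt large.
have := gap_large pS; rewrite cS => /(_ (leqnn _)).
rewrite ltNge => /negP; apply; rewrite /rho cS; apply: near_clique_arith => //.
have cSa : #|S :\ a| = q by move: cS; rewrite (cardsD1 a S) aS => -[].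
rewrite (arcsD1 es ei aS) (@arcs_clique _ e (S :\ a)) // ?cSa; last first.
  move=> x y; rewrite !inE => /andP[xa xS] /andP[ya yS] nxy.
  by have := cl x y xS yS nxy; rewrite (negbTE xa) (negbTE ya) !andbF !orbF.
rewrite leq_add2l leq_mul2l /= -cSa (cardsD1 b (S :\ a)) leq_subLR.
rewrite leq_add ?leq_b1 //; apply: subset_leq_card; apply/subsetP => y.
rewrite !inE => /and3P[yb ya yS]; rewrite yS /=.
have := cl a y aS yS; rewrite eq_sym ya eqxx (negbTE yb) /= => /(_ isT).
by rewrite (negbTE ya) andbF !orbF.
Qed.

(** With two common vertices the union would be too dense for a proper subset. If it is all of [V],
    minimum degree q gives each vertex of [C1 :\: C2] a neighbour in [C2 :\: C1], and the bound
    holds. *)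
Lemma two_cliques C1 C2 : qclique q e V C1 -> qclique q e V C2 -> C1 != C2 ->
  #|C1 :&: C2| <= 1.
Proof.
move=> /qcliqueP[s1 c1 k1] /qcliqueP[s2 c2 k2] n12; rewrite leqNgt; apply/negP => hI.
pose D := C2 :\: C1.
have cI : #|C1 :&: C2| + #|D| = q by rewrite /D -c2 setIC cardsID.
have D0 : 0 < #|D|.
  rewrite card_gt0; apply: contraNneq n12 => D0.
  by rewrite eq_sym eqEcard c1 c2 leqnn andbT -setD_eq0; apply/eqP.
have dD : [disjoint C1 & D] by rewrite disjoints_subset /D setCD subsetUr.
have UE : C1 :|: C2 = C1 :|: D.
  by apply/setP => z; rewrite !inE; case: (z \in C1).
have cU : #|C1 :|: C2| = q + #|D|.
  by rewrite UE cardsU (disjoint_setI0 dD) cards0 subn0 c1.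
have aD : arcs e D D = #|D| * (#|D| - 1).
  by apply: arcs_clique => // x y /setDP[xC _] /setDP[yC _]; apply: k2.
have aI : arcs e (C1 :&: C2) D = (q - #|D|) * #|D|.
  rewrite arcs_nbrs -[q - _]/(q - #|D|) -{1}cI addnK -sum_nat_const; apply: eq_bigr.
  move=> x /setIP[x1 x2]; congr #|pred_of_set _|; apply/setP => y; rewrite !inE.
  case y2 : (y \in C2); rewrite ?andbF //= andbT; case y1 : (y \in C1) => //=.
  by apply: k2 => //; apply: contraFneq y1 => <-.
have aU : arcs e (C1 :|: C2) (C1 :|: C2) =
    q * (q - 1) + 2 * (arcs e (C1 :&: C2) D + arcs e (C1 :\: C2) D) + #|D| * (#|D| - 1).
  by rewrite UE arcsUU // aD (arcs_clique ei k1) c1 -arcsIDl.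
have sU : C1 :|: C2 \subset V by rewrite subUset s1.
have [UV|pU] := eqVproper sU; last first.
  have := gap_large pU.
  rewrite cU => /(_ _); rewrite -[X in X < _]addn0 ltn_add2l D0 => /(_ isT).
  rewrite ltNge => /negP; apply; rewrite /rho cU; apply: two_cliques_arith => //.
    by move: cI hI; gen_arith; lia.
  by rewrite aU aI leq_add2r leq_add2l -mulnA leq_mul2l leq_addr.
have : (rho q e V <= ky_bound q)%R; last by rewrite leNgt large.
rewrite -UV /rho cU; apply: two_cliques_span_arith => //.
  by move: cI hI; gen_arith; lia.
rewrite aU aI; have : #|D| <= arcs e (C1 :\: C2) D.
  2: by rewrite -mulnA; move: (_ * _) ((q - _) * _) (_ * (_ - 1)) => z t r; gen_arith; lia.
have -> : #|D| = #|C1 :\: C2|.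
  by have := cardsID C2 C1; have := cardsID C1 C2; rewrite (setIC C2) -/D c1 c2; lia.
rewrite arcs_nbrs -sum1_card; apply: leq_sum => x /setDP[x1 x2].
rewrite lt0n; apply/negP => /eqP/cards0_eq N0.
have : nbrs e V x \subset C1 :\ x.
  apply/subsetP => y; rewrite inE => /andP[yV exy]; rewrite !inE.
  have -> /= : y != x by apply: contraTneq exy => ->; rewrite ei.
  apply: contraT => y1; move: yV; rewrite -UV in_setU (negbTE y1) /= => y2.
  have : y \in nbrs e D x by rewrite inE exy /D inE y1 y2.
  by rewrite N0 inE.
move/subset_leq_card; have := deg_ge (subsetP s1 x x1).
by have := cardsD1 x C1; rewrite x1 c1; gen_arith; lia.
Qed.

Lemma clique_sub_cnbrs C x : qclique q e V C -> x \in C -> C \subset cnbrs e V x.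
Proof.
move=> /qcliqueP[sC _ kC] xC; apply/subsetP => y yC; rewrite inE (subsetP sC) //=.
by have [//|nyx] := eqVneq y x; apply: kC; rewrite // eq_sym.
Qed.

(** Otherwise the neighbours a of u and b of v outside [C] differ. Delete u and v and add the edge
    ab. A colouring would give a and b different colours; the other q - 2 clique vertices leave two
    colours, which can then be distributed to u and v. So there is a critical subgraph, and without
    the added edge its vertex set violates [gap_large]. *)
Lemma clique_low C u v : qclique q e V C -> u \in C -> v \in C ->
  #|nbrs e V u| = q -> #|nbrs e V v| = q -> cnbrs e V u = cnbrs e V v.
Proof.
move=> qC uC vC du dv; apply/eqP; apply: contraT => nN.
have /qcliqueP[sC cC kC] := qC.
have uV := subsetP sC u uC; have vV := subsetP sC v vC.
have nuv : u != v by apply: contraNneq nN => ->.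
have outer w : w \in C -> #|nbrs e V w| = q -> exists2 a, a \notin C &
    cnbrs e V w = a |: C.
  move=> wC dw; have wV := subsetP sC w wC; have sN := clique_sub_cnbrs qC wC.
  have := cardsID C (cnbrs e V w); rewrite (setIidPr sN) card_cnbrs // dw cC.
  rewrite -addn1 => /addnI/eqP/cards1P[a ha].
  have aN : a \in cnbrs e V w :\: C by rewrite ha inE.
  exists a; first by case/setDP: aN.
  by rewrite -ha setUC -{1}(setIidPr sN) setID.
have [a aC Nu] := outer u uC du; have [b bC Nv] := outer v vC dv.
have nab : a != b by apply: contraNneq nN => ab; rewrite Nu Nv ab.
have [aV eua] : a \in V /\ e u a.
  have : a \in cnbrs e V u by rewrite Nu setU11.
  by rewrite inE => /andP[-> /orP[/eqP h|]//]; rewrite h uC in aC.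
have [bV evb] : b \in V /\ e v b.
  have : b \in cnbrs e V v by rewrite Nv setU11.
  by rewrite inE => /andP[-> /orP[/eqP h|]//]; rewrite h vC in bC.
pose g := addp e [:: (a, b)].
have sg : sgr g by apply: addp_sgr => // p; rewrite inE => /eqP->.
pose V' := V :\ u :\ v.
have ncg : ~~ qcol q g V'.
  case: cr => nc _ _; apply: contra nc => /qcolP[c cP].
  have ninV' z : z \in V -> z \notin C -> z \in V'.
    move=> zV zC; rewrite !inE zV andbT.
    by rewrite (contraNneq _ zC) ?(contraNneq _ zC) // => ->.
  have cab : c a != c b.
    by apply: cP; rewrite ?ninV' // /g /addp mem_head orbT.
  pose K := c @: (C :\ u :\ v).
  have cK : #|K| + 2 <= q.
    have := leq_imset_card c (C :\ u :\ v); rewrite -/K.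
    have := cardsD1 u C; have := cardsD1 v (C :\ u).
    by rewrite uC !inE vC eq_sym nuv cC /=; gen_arith; lia.
  have [p pK] : exists p, p \notin K by apply: free_colour; apply: leq_trans cK; rewrite addn2.
  have [r] : exists r, r \notin p |: K by apply: free_colour; rewrite cardsU1 pK;
    apply: leq_trans cK; rewrite addn2.
  rewrite !inE negb_or => /andP[rp rK].
  have [pu [pv [puK pvK npp pua pvb]]] : exists pu pv,
      [/\ pu \notin K, pv \notin K, pu != pv, pu != c a & pv != c b].
    have [pa|pa] := eqVneq p (c a); last have [rb|rb] := eqVneq r (c b).
    + by exists r, p; split=> //; [rewrite -pa | rewrite pa].
    + exists r, p; split=> //; last by rewrite -rb eq_sym.
      by rewrite rb eq_sym.
    + by exists p, r; split=> //; rewrite eq_sym.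
  apply/qcolP; exists (fun z => if z == u then pu else if z == v then pv else c z).
  have keyu z : z \in V -> e u z -> z != v -> pu != c z.
    move=> zV euz zv; have : z \in cnbrs e V u by rewrite inE zV euz orbT.
    rewrite Nu inE => /orP[/set1P->//|zC]; apply: contraNneq puK => ->.
    apply: imset_f; rewrite !inE zv zC andbT /=.
    by apply: contraTneq euz => ->; rewrite ei.
  have keyv z : z \in V -> e v z -> z != u -> pv != c z.
    move=> zV evz zu; have : z \in cnbrs e V v by rewrite inE zV evz orbT.
    rewrite Nv inE => /orP[/set1P->//|zC]; apply: contraNneq pvK => ->.
    apply: imset_f; rewrite !inE zu zC !andbT /=.
    by apply: contraTneq evz => ->; rewrite ei.
  move=> x y xV yV exy.
  case: (eqVneq x u) exy => [->|xu] exy.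
    case: (eqVneq y u) exy => [->|yu] exy; first by rewrite ei in exy.
    by case: (eqVneq y v) exy => [->|yv] exy //; apply: keyu.
  case: (eqVneq x v) exy => [->|xv] exy.
    case: (eqVneq y u) exy => [->|yu] exy; first by rewrite eq_sym.
    by case: (eqVneq y v) exy => [->|yv] exy; [rewrite ei in exy | apply: keyv].
  rewrite es in exy.
  case: (eqVneq y u) exy => [->|yu] exy; first by rewrite eq_sym; apply: keyu.
  case: (eqVneq y v) exy => [->|yv] exy; first by rewrite eq_sym; apply: keyv.
  by apply: cP; rewrite ?inE ?xu ?xv ?yu ?yv // /g /addp es exy.
have [f [W [sW sf sgf cf]]] := crit_exists sg ncg.
have sWu : W \subset V :\ u by apply: subset_trans sW _; apply: subsetDl.
have pW : W \proper V by apply: sub_proper_trans sWu _; apply: properD1.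
have Wq : q < #|W| by apply: (crit_card _ sgf cf).
have fe : arcs f W W <= arcs e W W + 2.
  apply: leq_trans (arcs_addp e [:: (a, b)] W); apply: leq_arcs => // x y _ _; exact: sf.
have rW : (rho q f W <= ky_bound q)%R.
  apply: IH => //; left; apply: leq_ltn_trans fe _.
  have : arcs e W W <= arcs e (V :\ u) (V :\ u) by apply: leq_arcs.
  by rewrite (arcsD1 es ei uV) du; move: q3; gen_arith; lia.
have := gap_large pW Wq; rewrite ltNge => /negP[].
by move: rW fe q3; rewrite /rho /ky_bound; gen_arith; nia.
Qed.

Definition cluster x : {set T} := [set y in V | cnbrs e V y == cnbrs e V x].

Lemma cluster_deg_eq x y : x \in V -> y \in cluster x -> #|nbrs e V y| = #|nbrs e V x|.
Proof.
move=> xV; rewrite inE => /andP[yV /eqP h].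
by apply/eqP; rewrite -eqSS -!card_cnbrs // h.
Qed.

Lemma cluster_adj x y z : x \in V -> y \in cluster x -> z \in V -> z != y ->
  e y z = (z \in cnbrs e V x).
Proof. by move=> xV; rewrite inE => /andP[yV /eqP <-] zV zy; rewrite inE zV (negbTE zy). Qed.

Lemma cluster_cnbrs x y : y \in cluster x -> y \in cnbrs e V x.
Proof. by rewrite inE => /andP[yV /eqP <-]; rewrite inE yV eqxx. Qed.

Lemma cluster_refl x : x \in V -> x \in cluster x.
Proof. by rewrite inE eqxx andbT. Qed.

(** * Replacing a neighbour by a duplicate of a vertex of degree q *)

Section Twin.
Variables (x v : T).
Hypotheses (xV : x \in V) (lowx : #|nbrs e V x| = q) (vN : v \in cnbrs e V x).
Hypothesis ncv : cnbrs e V v != cnbrs e V x.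

Let vV : v \in V. Proof. by move: vN; rewrite inE => /andP[]. Qed.

(* [v] is deleted and its name is reused for a new twin of [x]. *)
Definition twin_rel : rel T := fun a b =>
  if a == v then (b != v) && (b \in cnbrs e V x)
  else if b == v then a \in cnbrs e V x else e a b.

Lemma twin_sgr : sgr twin_rel.
Proof.
split=> [a b|a]; rewrite /twin_rel; last by rewrite ei; case: eqP.
by case: (eqVneq a v) => [_|av]; case: (eqVneq b v) => [_|bv] //=; apply: es.
Qed.

Lemma twin_nbrs : nbrs twin_rel V v = cnbrs e V x :\ v.
Proof.
apply/setP => z; rewrite !inE /twin_rel eqxx !inE.
by case: (z \in V); rewrite ?andbF.
Qed.

Lemma card_twin_nbrs : #|nbrs twin_rel V v| = q.
Proof. by rewrite twin_nbrs; have := cardsD1 v (cnbrs e V x);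
  rewrite vN card_cnbrs // lowx => -[]. Qed.

Lemma twin_restr : arcs twin_rel (V :\ v) (V :\ v) = arcs e (V :\ v) (V :\ v).
Proof.
apply: eq_arcs => a b /setD1P[av _] /setD1P[bv _].
by rewrite /twin_rel (negbTE av) (negbTE bv).
Qed.

(** To restore v in a colouring, give it a colour [a] absent from its neighbours outside the cluster
    of x; there are fewer than q of these. A cluster vertex coloured [a] takes the colour of the
    duplicate instead. *)
Lemma twin_ncol : #|nbrs e V v| < q + #|cluster x| -> ~~ qcol q twin_rel V.
Proof.
move=> dv; have [nc _ _] := cr; apply: contra nc => /qcolP[c cP].
have nvT z : z \in cluster x -> z != v.
  by apply: contraTneq => ->; rewrite inE vV (negbTE ncv).
have sT : cluster x \subset nbrs e V v.
  apply/subsetP => z zT; have zv := nvT z zT.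
  rewrite inE es (cluster_adj xV zT) ?vN ?andbT //; last by rewrite eq_sym.
  by move: zT; rewrite inE => /andP[].
have [a aP] : exists a, a \notin c @: (nbrs e V v :\: cluster x).
  apply: free_colour; apply: leq_ltn_trans (leq_imset_card _ _) _.
  have := cardsID (cluster x) (nbrs e V v); rewrite (setIidPr sT).
  by move: dv; gen_arith; lia.
have cvz z : z \in V -> z != v -> z \in cnbrs e V x -> c v != c z.
  by move=> zV zv zN; apply: cP => //; rewrite /twin_rel eqxx zv.
pose c' z := if z == v then a else if (z \in cluster x) && (c z == a) then c v else c z.
apply/qcolP; exists c'.
have keyv z : z \in V -> z != v -> e v z -> a != c' z.
  move=> zV zv evz; rewrite /c' (negbTE zv).
  case: ifPn => [/andP[zT /eqP <-]|].
    by rewrite eq_sym; apply: cvz => //; apply: cluster_cnbrs.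
  rewrite negb_and => /orP[zT|]; last by rewrite eq_sym.
  by apply: contraNneq aP => ->; apply: imset_f; rewrite !inE zV evz /= andbT; move: zT;
    rewrite inE zV.
have key y z : y \in V -> z \in V -> y != v -> z != v -> e y z -> y \in cluster x ->
    c y == a -> c v != c z.
  move=> yV zV yv zv eyz yT _; apply: cvz => //.
  by rewrite -(cluster_adj xV yT) //; apply: contraTneq eyz => ->; rewrite ei.
move=> y z yV zV eyz.
have [yv|yv] := eqVneq y v.
  rewrite {1}/c' yv eqxx; rewrite yv in eyz; apply: keyv => //.
  by apply: contraTneq eyz => ->; rewrite ei.
have [zv|zv] := eqVneq z v.
  by rewrite eq_sym {1}/c' zv eqxx; rewrite zv es in eyz; apply: keyv.
have cyz : c y != c z by apply: cP; rewrite // /twin_rel (negbTE yv) (negbTE zv).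
rewrite /c' (negbTE yv) (negbTE zv).
case: ifPn => [/andP[yT ca]|_]; case: ifPn => [/andP[zT cb]|_] //.
- by case/eqP: cyz; rewrite (eqP ca) (eqP cb).
- exact: (key y).
- by rewrite eq_sym; apply: (key z) => //; rewrite es.
Qed.

(** Pairs away from v stay equal, since equal neighbourhoods gain or lose v together. In its row and
    column v had 2 #|cluster v| - 1 pairs and now has at least 2 #|cluster x| + 1. *)
Lemma twin_twins : #|cluster v| <= #|cluster x| -> twins e V < twins twin_rel V.
Proof.
have split_at (r : rel T) : symmetric r -> arcs r V V =
    arcs r (V :\ v) (V :\ v) + #|nbrs r V v| + #|nbrs r (V :\ v) v|.
  move=> rs; have Vv : V :&: [set v] = [set v] by apply/setIidPr; rewrite sub1set.
  rewrite (arcsIDl r [set v] V) Vv arcs1 (arcsIDr r [set v] (V :\: _)) Vv (arcsC _ [set v] rs) arcs1.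
  by lia.
have rs (f : rel T) : symmetric (fun a b => cnbrs f V a == cnbrs f V b) by move=> a b;
  apply: eq_sym.
move=> hc; rewrite /twins split_at // [X in _ < X]split_at //.
have cN z : z \in V -> z != v -> cnbrs twin_rel V z =
    if z \in cnbrs e V x then v |: cnbrs e V z else cnbrs e V z :\ v.
  move=> zV zv; apply/setP => w;
    rewrite [in LHS]inE /twin_rel (negbTE zv) (fun_if (fun S : {set T} => w \in S)) in_setU1 in_setD1 [w \in cnbrs e V z]inE.
  by have [->|wv] := eqVneq w v; rewrite ?vV ?andbF ?andbT //= 1?eq_sym ?(negbTE zv); case: ifP.
have cNv : cnbrs twin_rel V v = cnbrs e V x.
  apply/setP => w; rewrite [in LHS]inE /twin_rel eqxx.
  have [->|wv] := eqVneq w v; first by rewrite vV vN.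
  by rewrite /= andb_idl // inE => /andP[].
have clT z : z \in cluster x -> z != v /\ cnbrs twin_rel V z = cnbrs e V x.
  move=> zT; have zv : z != v by apply: contraTneq zT => ->; rewrite inE vV (negbTE ncv).
  have zN := cluster_cnbrs zT; split=> //.
  move: zT; rewrite inE => /andP[zV /eqP hz]; rewrite cN // zN hz.
  by apply/setUidPr; rewrite sub1set.
have h1 : arcs (fun a b => cnbrs e V a == cnbrs e V b) (V :\ v) (V :\ v) <=
    arcs (fun a b => cnbrs twin_rel V a == cnbrs twin_rel V b) (V :\ v) (V :\ v).
  apply: leq_arcs => // a b /setD1P[av aV] /setD1P[bv bV] /eqP hab.
  rewrite !cN // hab.
  have xin z : z \in V -> (z \in cnbrs e V x) = (x \in cnbrs e V z).
    by move=> zV; rewrite !inE zV xV es eq_sym.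
  by rewrite !xin // hab.
have h2 : #|nbrs (fun a b => cnbrs e V a == cnbrs e V b) V v| = #|cluster v|.
  by congr #|pred_of_set _|; apply/setP => z; rewrite !inE eq_sym.
have h3 : #|nbrs (fun a b => cnbrs e V a == cnbrs e V b) (V :\ v) v|.+1 = #|cluster v|.
  rewrite (cardsD1 v (cluster v)) cluster_refl // add1n; congr _.+1.
  by congr #|pred_of_set _|; apply/setP => z; rewrite !inE [cnbrs e V v == _]eq_sym andbA.
have h4 : #|cluster x| < #|nbrs (fun a b => cnbrs twin_rel V a == cnbrs twin_rel V b) V v|.
  rewrite [X in _ < X](cardsD1 v) inE vV eqxx add1n ltnS; apply: subset_leq_card;
    apply/subsetP => z zT.
  have [zv hz] := clT z zT; rewrite !inE zv hz cNv eqxx andbT /=.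
  by move: zT; rewrite inE => /andP[].
have h5 : #|cluster x| <= #|nbrs (fun a b => cnbrs twin_rel V a == cnbrs twin_rel V b) (V :\ v) v|.
  apply: subset_leq_card; apply/subsetP => z zT.
  have [zv hz] := clT z zT; rewrite !inE zv hz cNv eqxx andbT /=.
  by move: zT; rewrite inE => /andP[].
by move: hc h1 h2 h3 h4 h5; gen_arith; lia.
Qed.

(** A critical subgraph after the replacement must contain the duplicate, and it satisfies the bound
    by minimality. Without the duplicate its vertex set reaches the threshold of [gap], so it is a
    q-clique. The duplicate still has degree at least q, which identifies this clique. *)
Lemma twin_clique : #|nbrs e V v| < q + #|cluster x| ->
  (#|nbrs e V v| = q -> #|cluster v| <= #|cluster x|) ->
  qclique q e V (cnbrs e V x :\ v).
Proof.
move=> dv hv; have [ts ti] := twin_sgr.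
have [f [W [sW sf sgf cf]]] := crit_exists twin_sgr (twin_ncol dv).
have [fs fi] := sgf.
have aE := arcsD1 es ei vV; have aG := arcsD1 ts ti vV.
rewrite twin_restr card_twin_nbrs in aG.
have aF : arcs f W W <= arcs twin_rel V V by apply: leq_arcs => // a b _ _; apply: sf.
have dvq := deg_ge vV.
have Wq : q < #|W| by apply: (crit_card _ sgf cf).
have rW : (rho q f W <= ky_bound q)%R.
  (* The duplicate has degree q, not more than v had. Equality forces v to have degree q and the
     critical subgraph to be the whole graph, and then the number of twins has grown. *)
  apply: IH => //; have [hlt|hge] := ltnP (arcs f W W) (arcs e V V); [by left | right].
  have hEq : arcs f W W = arcs twin_rel V V.
    by apply/eqP; rewrite eqn_leq aF; move: aE aG dvq hge; gen_arith; lia.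
  have dq : #|nbrs e V v| = q by move: aE aG dvq hge hEq; gen_arith; lia.
  split; first by rewrite hEq aE aG dq.
  have [z zV|WV fE] := arcs_eq sgf twin_sgr sW sf hEq.
    have [->|zv] := eqVneq z v; first by rewrite -card_gt0 card_twin_nbrs.
    have : 0 < #|nbrs e V z :\ v|.
      by have := cardsD1 v (nbrs e V z); have := deg_ge zV; have := leq_b1 (v \in nbrs e V z);
        move: q3; case: (_ \in _) => /=; gen_arith; lia.
    case/card_gt0P => w; rewrite !inE => /and3P[wv wV ezw]; apply/set0Pn; exists w.
    by rewrite inE wV /twin_rel (negbTE zv) (negbTE wv).
  suff -> : twins f W = twins twin_rel V by apply: twin_twins; apply: hv.
  rewrite /twins WV; apply: eq_arcs => a b aV bV.
  have cE u : u \in V -> cnbrs f V u = cnbrs twin_rel V u.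
    by move=> uV; apply/setP => w; rewrite !inE; case wV: (w \in V) => //=; rewrite fE.
  by rewrite !cE.
have vW : v \in W.
  apply: contraT => vW; have [ncf _ _] := cf; case/negP: ncf.
  apply: (crit_nonsub cr sW vV vW) => a b aW bW /sf.
  rewrite /twin_rel; case: eqP aW => [->|_ _]; first by rewrite (negbTE vW).
  by case: eqP bW => [->|_ _] //; rewrite (negbTE vW).
pose R := W :\ v.
have sR : R \subset V by apply: subset_trans sW; apply: subsetDl.
have pR : R \proper V by apply/properP; split=> //; exists v; rewrite // !inE eqxx.
have cR : #|W| = #|R|.+1 by rewrite (cardsD1 v W) vW.
have nf : nbrs f W v \subset cnbrs e V x :\ v.
  apply/subsetP => z; rewrite inE => /andP[zW /sf fz]; rewrite -twin_nbrs inE fz andbT.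
  exact: (subsetP sW).
have cN : #|cnbrs e V x :\ v| = q by rewrite -twin_nbrs card_twin_nbrs.
have qR : qclique q e V R.
  apply: gap => //; first by move: q3 Wq cR; gen_arith; lia.
  have h1 := arcsD1 fs fi vW; rewrite -/R in h1.
  have h2 : arcs f R R <= arcs e R R.
    apply: leq_arcs => // a b /setD1P[av _] /setD1P[bv _] /sf.
    by rewrite /twin_rel (negbTE av) (negbTE bv).
  have h3 := subset_leq_card nf; rewrite cN in h3.
  by move: rW h1 h2 h3 q3; rewrite /rho /ky_bound cR; gen_arith; nia.
suff <- : R = cnbrs e V x :\ v by [].
have nE : nbrs f W v = cnbrs e V x :\ v.
  by apply/eqP; rewrite eqEcard nf cN; apply: mindeg cf vW.
have /qcliqueP[_ cRq _] := qR.
apply/esym/eqP; rewrite eqEcard cN cRq leqnn andbT -nE.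
apply/subsetP => z; rewrite inE => /andP[zW fvz]; rewrite !inE zW andbT.
by apply: contraTneq fvz => ->; rewrite fi.
Qed.

End Twin.

(** Otherwise [cnbrs e V x :\ v] is a second q-clique sharing q - 1 vertices with [C]. *)
Lemma clique_deg C x v : qclique q e V C -> x \in C -> #|nbrs e V x| = q ->
  v \in C -> cnbrs e V v != cnbrs e V x -> q + #|cluster x| <= #|nbrs e V v|.
Proof.
move=> qC xC lowx vC nvx; have /qcliqueP[sC cC kC] := qC.
rewrite leqNgt; apply/negP => dv.
have xV := subsetP sC x xC; have sN := clique_sub_cnbrs qC xC.
have qD : qclique q e V (cnbrs e V x :\ v).
  apply: twin_clique => //; first exact: (subsetP sN).
  by move=> dvq; case/eqP: nvx; apply: (clique_low qC).
have nCD : C != cnbrs e V x :\ v by apply: contraTneq vC => ->; rewrite !inE eqxx.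
have := two_cliques qC qD nCD; rewrite leqNgt => /negP[].
have : #|C :\ v| <= #|C :&: (cnbrs e V x :\ v)|.
  apply: subset_leq_card; apply/subsetP => z /setD1P[zv zC].
  by rewrite in_setI zC in_setD1 zv; apply: (subsetP sN).
by have := cardsD1 v C; rewrite vC cC; move: q3; gen_arith; lia.
Qed.

(** If v also has degree q, the vertex with the larger cluster is duplicated. When that is v, a
    second member y of the cluster of x lies with v in a q-clique, and [clique_low] identifies their
    neighbourhoods. *)
Lemma cluster_deg x v : x \in V -> #|nbrs e V x| = q ->
  (forall C, qclique q e V C -> x \notin C) -> 1 < #|cluster x| ->
  v \in cnbrs e V x -> cnbrs e V v != cnbrs e V x -> q + #|cluster x| <= #|nbrs e V v|.
Proof.
move=> xV lowx ncx cl1 vN nvx; rewrite leqNgt; apply/negP => dv.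
have vV : v \in V by move: vN; rewrite inE => /andP[].
have nxv : x != v by apply: contraNneq nvx => ->.
have [dq|dq] := eqVneq #|nbrs e V v| q; last first.
  have /ncx : qclique q e V (cnbrs e V x :\ v).
    by apply: twin_clique => // h; rewrite h eqxx in dq.
  by rewrite !inE nxv xV eqxx.
have [hle|hlt] := leqP #|cluster v| #|cluster x|.
  have /ncx : qclique q e V (cnbrs e V x :\ v) by apply: twin_clique.
  by rewrite !inE nxv xV eqxx.
have qD : qclique q e V (cnbrs e V v :\ x).
  apply: twin_clique => //; first by move: vN; rewrite !inE xV es eq_sym => /andP[].
  - by rewrite eq_sym.
  - by rewrite lowx; move: hlt; gen_arith; lia.
  - by move=> _; apply: ltnW.
have [y] : exists y, y \in cluster x :\ x.
  by apply/card_gt0P; have := cardsD1 x (cluster x); rewrite cluster_refl //; move: cl1;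
    gen_arith; lia.
rewrite in_setD1 => /andP[yx yT].
have nyv : v != y by apply: contraNneq nvx => ->; move: yT; rewrite inE => /andP[].
have yV : y \in V by move: yT; rewrite inE => /andP[].
have yD : y \in cnbrs e V v :\ x.
  by rewrite !inE yx yV es (cluster_adj xV yT) // vN orbT.
have vD : v \in cnbrs e V v :\ x by rewrite !inE eq_sym nxv vV eqxx.
have := clique_low qD yD vD; rewrite (cluster_deg_eq xV yT) => /(_ lowx dq) h.
by case/eqP: nvx; rewrite -h; move: yT; rewrite inE => /andP[_ /eqP].
Qed.

(** With at most two vertices of [cnbrs e V x] outside the cluster, these q + 1 vertices lack at
    most one edge. *)
Lemma card_cluster x : x \in V -> #|nbrs e V x| = q -> #|cluster x|.+2 <= q.
Proof.
move=> xV lowx; rewrite leqNgt; apply/negP => hlt.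
have cS : #|cnbrs e V x| = q.+1 by rewrite card_cnbrs // lowx.
have sS : cnbrs e V x \subset V by apply/subsetP => z; rewrite inE => /andP[].
have xS : x \in cnbrs e V x by rewrite inE xV eqxx.
have sT : cluster x \subset cnbrs e V x by apply/subsetP => z; apply: cluster_cnbrs.
have adj u w : u \in cluster x -> w \in cnbrs e V x -> u != w -> e u w.
  by move=> uT wS nuw; rewrite (cluster_adj xV uT) // ?(subsetP sS) // eq_sym.
pose D := cnbrs e V x :\: cluster x.
have cD : #|D| <= 2.
  by have := cardsID (cluster x) (cnbrs e V x); rewrite (setIidPr sT) -/D; move: hlt cS;
    gen_arith; lia.
have [a [b [aS hD]]] : exists a b, a \in cnbrs e V x /\
    forall u w, u \in D -> w \in D -> u != w -> (u == a) && (w == b) || (u == b) && (w == a).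
  have [D0|[a aD]] := set_0Vmem D.
    by exists x, x; split=> // u w; rewrite D0 inE.
  have aS : a \in cnbrs e V x by move: aD; rewrite inE => /andP[].
  have [D0|[b bD]] := set_0Vmem (D :\ a).
    exists a, a; split=> // u w uD wD nuw; case/eqP: nuw.
    have h z : z \in D -> z = a.
      by move=> zD; apply/eqP; apply: contraT => za; have := in_set0 z; rewrite -D0 in_setD1 za zD.
    by rewrite (h u) // (h w).
  exists a, b; split=> // u w uD wD nuw.
  have h z : z \in D -> (z == a) || (z == b).
    move=> zD; apply: contraT; rewrite negb_or => /andP[za zb].
    have : 2 < #|D|; last by rewrite ltnNge cD.
    rewrite (cardsD1 a) aD (cardsD1 b) bD (cardsD1 z).
    by rewrite !in_setD1 zb za zD.
  by move: (h u uD) (h w wD) nuw => /orP[] /eqP-> /orP[] /eqP->; rewrite !eqxx ?orbT.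
apply: (@no_near_clique (cnbrs e V x) a b) => // u w uS wS nuw.
have [uT|uT] := boolP (u \in cluster x); first by rewrite adj.
have [wT|wT] := boolP (w \in cluster x); first by rewrite es adj // eq_sym.
by rewrite hD ?orbT // in_setD ?uT ?wT.
Qed.

Lemma cluster_sub_clique C x : qclique q e V C -> x \in C -> cluster x \subset C.
Proof.
move=> qC xC; have /qcliqueP[sC cC kC] := qC; apply/subsetP => z zT; apply: contraT => zC.
have xV := subsetP sC x xC.
have zV : z \in V by move: zT; rewrite inE => /andP[].
have sN := clique_sub_cnbrs qC xC.
have adj u : u \in C -> e z u.
  move=> uC; rewrite (cluster_adj xV zT) ?(subsetP sC) ?(subsetP sN) //.
  by apply: contraNneq zC => <-.
exfalso; apply: (@no_near_clique (z |: C) x x).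
- by rewrite subUset sub1set zV.
- by rewrite cardsU1 zC cC.
- by rewrite inE xC orbT.
move=> u w; rewrite !in_setU1 => /orP[/eqP->|uC] /orP[/eqP->|wC] nuw.
- by rewrite eqxx in nuw.
- by rewrite adj.
- by rewrite es adj.
- by rewrite kC.
Qed.

(** * Discharging *)

Local Notation d v := #|nbrs e V v|.
Definition low : {set T} := [set v in V | d v == q].

Lemma lowP v : reflect (v \in V /\ d v = q) (v \in low).
Proof. by rewrite inE; apply: (iffP andP) => -[vV /eqP]. Qed.

Lemma not_low v : v \in V -> v \notin low -> q < d v.
Proof. by move=> vV; rewrite inE vV /= ltn_neqAle eq_sym deg_ge // andbT. Qed.

Lemma discharge_rho :
  (q - 2) * #|low| <= \sum_(v in V :\: low) surplus q (d v) -> (rho q e V <= 0)%R.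
Proof.
move=> h.
have hlow : \sum_(v in low) d v = q * #|low|.
  rewrite -[RHS]mulnC -sum_nat_const; apply: eq_bigr => v /lowP[_ ->] //.
have hhigh : \sum_(v in V :\: low) surplus q (d v) + (q * q + q - 2) * #|V :\: low| =
    q * \sum_(v in V :\: low) d v.
  rewrite mulnC -sum_nat_const -big_split /= big_distrr /=; apply: eq_bigr => v /setDP[vV vl].
  have := not_low vV vl; rewrite /surplus; move: (d v) => n; move: q3; clear => q3 hn.
  have [j ->] : exists j, n = q + 1 + j by exists (n - (q + 1)); lia.
  have -> : q + 1 + j - q - 1 = j by lia.
  by nia.
have cV : #|V| = #|low| + #|V :\: low|.
  rewrite -(cardsID low V); congr (_ + _); congr #|pred_of_set _|.
  by apply/setIidPr/subsetP => v /lowP[].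
have aV : arcs e V V = q * #|low| + \sum_(v in V :\: low) d v.
  rewrite arcs_nbrs (big_setID low) /= -hlow; congr (_ + _); apply: eq_bigl => v.
  by rewrite inE; case: lowP => [[->]|]; rewrite ?andbF.
rewrite /rho aV cV; move: (\sum_(v in _) d v) (\sum_(v in _) _) hhigh h => a s.
move: #|low| #|V :\: low| q3; clear => l n q3 h1 h2.
have [p hp] : exists p, q = p + 2 by exists (q - 2); lia.
move: h1 h2; rewrite hp addnK; have -> : (p + 2) * (p + 2) + (p + 2) - 2 = p * p + 5 * p + 4 by nia.
by nia.
Qed.

(** Clusters are singletons here. Two low neighbours y and z of a low x are impossible: replacing y
    makes x and z part of a triangle, hence twins. So each low vertex sends at least two edges to
    higher degrees, where the surplus is at least half the degree. *)
Lemma discharge_three : q = 3 -> (rho q e V <= 0)%R.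
Proof.
move=> hq; apply: discharge_rho.
have low1 x : x \in low -> #|nbrs e low x| <= 1.
  move=> xl; have [xV dx] := lowP _ xl; rewrite leqNgt; apply/negP => h2.
  have [y] : exists y, y \in nbrs e low x by apply/card_gt0P; apply: ltn_trans h2.
  rewrite inE => /andP[yl exy]; have [yV dy] := lowP _ yl.
  have [z] : exists z, z \in nbrs e low x :\ y.
    by apply/card_gt0P; move: h2; rewrite (cardsD1 y) inE yl exy.
  rewrite !inE => /and3P[zy /andP[zV /eqP dz] exz].
  have clx w : w \in V -> d w = q -> #|cluster w| = 1.
    move=> wV dw; have := card_cluster wV dw; have := cluster_refl wV.
    rewrite hq => wc; rewrite 2!ltnS => h; apply/eqP; rewrite eqn_leq h card_gt0.
    by apply/set0Pn; exists w.
  have hx := clx x xV dx.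
  have one w : w \in V -> cnbrs e V w == cnbrs e V x -> w = x.
    move=> wV hw; move/eqP/cards1P: hx => [x' hx'].
    have : w \in cluster x by rewrite inE wV.
    have : x \in cluster x by apply: cluster_refl.
    by rewrite hx' !inE => /eqP-> /eqP.
  have nyx : cnbrs e V y != cnbrs e V x.
    by apply: contraTneq exy => /eqP/(one _ yV) ->; rewrite ei.
  have qC : qclique q e V (cnbrs e V x :\ y).
    apply: twin_clique => //; first by rewrite inE yV exy orbT.
      by rewrite dy hx addn1.
    by rewrite hx clx.
  have xC : x \in cnbrs e V x :\ y.
    by rewrite !inE xV eqxx andbT; apply: contraTneq exy => ->; rewrite ei.
  have zC : z \in cnbrs e V x :\ y by rewrite !inE zy zV exz orbT.
  have /eqP/(one _ zV) zx := clique_low qC zC xC dz dx.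
  by rewrite zx ei in exz.
have h1 : 2 * #|low| <= arcs e (V :\: low) low.
  rewrite (arcsC _ _ es) arcs_nbrs mulnC -sum_nat_const; apply: leq_sum => x xl.
  have [xV dx] := lowP _ xl; have := low1 x xl.
  have : d x = #|nbrs e low x| + #|nbrs e (V :\: low) x|.
    rewrite -!arcs1 (arcsIDr e low); congr (arcs _ _ _ + _).
    by apply/setIidPr/subsetP => v /lowP[].
  by rewrite dx hq; lia.
have h2 : arcs e (V :\: low) low <= 2 * \sum_(v in V :\: low) surplus q (d v).
  rewrite arcs_nbrs big_distrr /=; apply: leq_sum => v /setDP[vV vl].
  apply: leq_trans (_ : d v <= _).
    by apply: subset_leq_card; apply/subsetP => w; rewrite !inE => /andP[/andP[-> _] ->].
  by have := not_low vV vl; rewrite hq; apply: surplus_half.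
by move: h1 h2; rewrite hq; move: (\sum_(_ in _) _); gen_arith; lia.
Qed.

Section Discharge.
Hypothesis q4 : 3 < q.

Definition in_clique x : bool := [exists C, qclique q e V C && (x \in C)].
Definition big : {set T} := [set v in V | q.+1 < d v].
Definition mid : {set T} := [set v in V | d v == q.+1].
Definition rich_clique C : bool := qclique q e V C && [exists v in C, v \in big].
(** The low vertices are sorted by who pays for them: big vertices pay for [grouped] and [rich], the
    kernel bound handles [poor], and [lone] uses both. *)
Definition lone : {set T} := [set x in low | ~~ in_clique x && (#|cluster x| == 1)].
Definition grouped : {set T} := [set x in low | ~~ in_clique x && (1 < #|cluster x|)].
Definition rich : {set T} := [set x in low | [exists C, rich_clique C && (x \in C)]].
Definition poor : {set T} :=
  [set x in low | in_clique x && ~~ [exists C, rich_clique C && (x \in C)]].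

Let bigP v : reflect (v \in V /\ q.+1 < d v) (v \in big).
Proof. by rewrite inE; apply: andP. Qed.

Let midP v : reflect (v \in V /\ d v = q.+1) (v \in mid).
Proof. by rewrite inE; apply: (iffP andP) => -[vV /eqP]. Qed.

Let no_clique x : ~~ in_clique x -> forall C, qclique q e V C -> x \notin C.
Proof.
move=> h C qC; apply: contra h => xC; apply/existsP; exists C.
by rewrite qC.
Qed.

Lemma in_cliqueI C x : qclique q e V C -> x \in C -> in_clique x.
Proof. by move=> qC xC; apply/existsP; exists C; rewrite qC. Qed.

Let high_cases v : v \in V -> v \notin low -> (v \in big) || (v \in mid).
Proof.
move=> vV vl; rewrite !inE vV /= orbC.
by have := not_low vV vl; rewrite leq_eqVlt eq_sym.
Qed.

Lemma clique_high C x v : qclique q e V C -> x \in C -> x \in low -> v \in C ->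
  v \notin cluster x -> q + #|cluster x| <= d v.
Proof.
move=> qC xC /lowP[xV dx] vC vcl; apply: (clique_deg qC) => //.
have /qcliqueP[sC _ _] := qC.
by apply: contra vcl => h; rewrite inE (subsetP sC).
Qed.

Lemma cluster_low C x v : qclique q e V C -> x \in C -> x \in low -> v \in C ->
  v \in low -> v \in cluster x.
Proof.
move=> qC xC /lowP[xV dx] vC /lowP[vV dv].
by rewrite inE vV (clique_low qC vC xC dv dx) eqxx.
Qed.

Lemma cluster_in_low x v : x \in low -> v \in cluster x -> v \in low.
Proof.
move=> /lowP[xV dx] vc; apply/lowP; rewrite (cluster_deg_eq xV vc).
by split=> //; move: vc; rewrite inE => /andP[].
Qed.

Lemma cluster_pos x : x \in V -> 0 < #|cluster x|.
Proof. by move=> xV; apply/card_gt0P; exists x; apply: cluster_refl. Qed.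

(** In a cluster of size at least two, [clique_high] would make the other clique vertices big. *)
Lemma poor_clique x C : x \in poor -> qclique q e V C -> x \in C ->
  #|cluster x| = 1 /\ forall v, v \in C -> v != x -> v \in mid.
Proof.
rewrite inE => /and3P[xl _ nr] qC xC; have [xV dx] := lowP _ xl.
have /qcliqueP[sC cC _] := qC.
have nbig v : v \in C -> v \notin big.
  move=> vC; apply: contra nr => vb; apply/existsP; exists C.
  by rewrite /rich_clique qC xC andbT; apply/existsP; exists v; rewrite vC.
have sT := cluster_sub_clique qC xC.
have c1 : #|cluster x| = 1.
  apply/eqP; rewrite eqn_leq cluster_pos // andbT leqNgt; apply/negP => c2.
  have [v /setDP[vC vT]] : exists v, v \in C :\: cluster x.
    apply/card_gt0P; have := cardsID (cluster x) C; rewrite (setIidPr sT) cC.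
    by move: (card_cluster xV dx); gen_arith; lia.
  have /negP[] := nbig v vC; apply/bigP; split; first exact: (subsetP sC).
  by apply: leq_trans (clique_high qC xC xl vC vT); rewrite -addn2 leq_add2l.
split=> // v vC vx.
have vT : v \notin cluster x.
  have /cards1P[z hz] : #|cluster x| == 1 by rewrite c1.
  have : x \in cluster x by apply: cluster_refl.
  by rewrite hz !inE => /eqP <-.
have vl : v \notin low.
  by apply: contra vT; apply: (cluster_low qC).
by have := high_cases (subsetP sC v vC) vl; rewrite (negbTE (nbig v vC)).
Qed.

(** Since x lies in no q-clique, duplicating it at y is impossible unless y has a larger cluster. If
    y lay in no q-clique, its cluster would force the degree of x above q. And poor vertices have
    singleton clusters. *)
Lemma lone_nbr x y : x \in lone -> y \in low -> e x y -> y \in rich.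
Proof.
rewrite inE => /and3P[xl nx /eqP cx] yl exy.
have [xV dx] := lowP _ xl; have [yV dy] := lowP _ yl.
have nxy : x != y by apply: contraTneq exy => ->; rewrite ei.
have ncl : cnbrs e V y != cnbrs e V x.
  apply/negP => h; have /cards1P[z hz] : #|cluster x| == 1 by rewrite cx.
  have : x \in cluster x by apply: cluster_refl.
  have : y \in cluster x by rewrite inE yV.
  by rewrite hz !inE => /eqP xz /eqP yz; rewrite xz yz eqxx in nxy.
have cy : 1 < #|cluster y|.
  rewrite ltnNge; apply/negP => cy.
  have qC : qclique q e V (cnbrs e V x :\ y).
    apply: twin_clique => //; first by rewrite inE yV exy orbT.
      by rewrite dy cx addn1.
    by rewrite cx.
  by have /negP[] := no_clique nx qC; rewrite !inE nxy xV eqxx.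
have iy : in_clique y.
  apply: contraT => ny.
  have : q + #|cluster y| <= d x.
    apply: cluster_deg => //; first exact: no_clique.
      by rewrite inE xV es exy orbT.
    by rewrite eq_sym.
  by rewrite dx -[X in _ <= X]addn0 leq_add2l; move: cy; case: #|_|.
apply: contraT => nr.
have /existsP[C /andP[qC yC]] := iy.
have yp : y \in poor by move: nr; rewrite !inE yV dy eqxx iy.
by have [h _] := poor_clique yp qC yC; rewrite h in cy.
Qed.

Lemma low_partition : #|low| = #|lone| + #|grouped| + #|rich| + #|poor|.
Proof.
rewrite -!sum1_card !(big_mkcond (fun x => x \in _)) -!big_split /=.
apply: eq_bigr => x _; rewrite /lone /grouped /rich /poor ![in RHS]inE.
have [xl|] := boolP (x \in low); last by rewrite inE => /negbTE->.
have [xV dx] := lowP _ xl; rewrite xV dx eqxx /=.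
have := cluster_pos xV; have [iq|niq] := boolP (in_clique x) => /=.
  by case: [exists C, _].
have -> : [exists C, rich_clique C && (x \in C)] = false.
  apply/existsP => -[C /andP[/andP[qC _] xC]].
  by have := no_clique niq qC; rewrite xC.
by case: #|_| => [|[|n]].
Qed.

Lemma rich_lone : arcs e lone rich <= #|rich|.
Proof.
rewrite (arcsC _ _ es) arcs_nbrs -sum1_card; apply: leq_sum => x.
rewrite inE => /andP[xl /existsP[C /andP[/andP[qC _] xC]]].
have [xV dx] := lowP _ xl; have sN := clique_sub_cnbrs qC xC.
have /qcliqueP[_ cC _] := qC.
have : #|cnbrs e V x :\: C| = 1.
  by have := cardsID C (cnbrs e V x); rewrite (setIidPr sN) cC card_cnbrs // dx; gen_arith; lia.
move=> <-; apply: subset_leq_card; apply/subsetP => y; rewrite inE => /andP[yl exy].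
move: yl; rewrite inE => /and3P[/lowP[yV _] ny _].
by rewrite in_setD (no_clique ny qC) inE yV exy orbT.
Qed.

Definition home x : {set T} := odflt set0 [pick C | qclique q e V C && (x \in C)].

Lemma homeP x : x \in poor -> qclique q e V (home x) /\ x \in home x.
Proof.
rewrite inE => /and3P[_ /existsP[C hC] _]; rewrite /home.
by case: pickP => [C' /andP[]|/(_ C)] //; rewrite hC.
Qed.

Lemma home_mid x v : x \in poor -> v \in home x -> v != x -> v \in mid.
Proof. by move=> xp; have [qC xC] := homeP xp; have [_] := poor_clique xp qC xC; apply. Qed.

(** Two cliques through v would give it 2 q - 1 vertices in its closed neighbourhood, but v has
    degree q + 1; this is where q >= 4 enters. *)
Lemma home_disjoint x y v : x \in poor -> y \in poor -> x != y -> v \in home x ->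
  v \in home y -> v != x -> v != y -> False.
Proof.
move=> xp yp nxy vx vy nvx nvy.
have [qx xC] := homeP xp; have [qy yC] := homeP yp.
have yl : y \in low by move: yp; rewrite inE => /andP[].
have nh : home x != home y.
  apply/negP => /eqP h; have : y \in mid by apply: (home_mid xp); rewrite // ?h // eq_sym.
  by move/midP=> [_]; have [_ ->] := lowP _ yl; move/eqP; rewrite ltn_eqF.
have h1 := two_cliques qx qy nh.
have /midP[vV dv] := home_mid xp vx nvx.
have : home x :|: home y \subset cnbrs e V v.
  by rewrite subUset !clique_sub_cnbrs.
move/subset_leq_card; rewrite card_cnbrs // dv.
have /qcliqueP[_ cx _] := qx; have /qcliqueP[_ cy _] := qy.
by rewrite cardsU cx cy; move: h1 q4; gen_arith; lia.
Qed.

Lemma poor_nbr x y z : x \in poor -> y \in poor -> z \in poor -> e x y -> e x z -> y = z.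
Proof.
move=> xp yp zp exy exz; have [qC xC] := homeP xp.
have xl : x \in low by move: xp; rewrite inE => /andP[].
have [xV dx] := lowP _ xl.
have out w : w \in poor -> e x w -> w \in cnbrs e V x :\: home x.
  move=> wp exw; have wl : w \in low by move: wp; rewrite inE => /andP[].
  have [wV dw] := lowP _ wl; rewrite in_setD andbC inE wV exw orbT /=.
  apply/negP => wC; have : w \in mid.
    by apply: (home_mid xp) => //; apply: contraTneq exw => ->; rewrite ei.
  by move/midP=> [_]; rewrite dw => /eqP; rewrite ltn_eqF.
have : #|cnbrs e V x :\: home x| == 1.
  have /qcliqueP[_ cC _] := qC; have sN := clique_sub_cnbrs qC xC.
  by have := cardsID (home x) (cnbrs e V x); rewrite (setIidPr sN) cC card_cnbrs // dx => h;
    apply/eqP; move: h; gen_arith; lia.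
case/cards1P => w hw; have := out y yp exy; have := out z zp exz.
by rewrite hw !inE => /eqP-> /eqP.
Qed.

(* The edges between poor vertices form a matching, so the poor vertices split
   into two independent sets, to which the kernel bound is applied separately. *)
Lemma poor_bound :
  arcs e lone mid + (q - 1) * #|poor| <= 2 * #|lone| + #|poor| + 2 * #|mid|.
Proof.
(* [N2] takes the end of smaller rank of each edge between poor vertices. *)
pose N2 := [set x in poor | [exists y in poor, e x y && (enum_rank x < enum_rank y)]].
pose N1 := poor :\: N2.
have sN2 : N2 \subset poor by apply/subsetP => x; rewrite inE => /andP[].
have sN1 : N1 \subset poor by apply: subsetDl.
have ind1 x y : x \in N1 -> y \in N1 -> ~~ e x y.
  move=> /setDP[xp x2] /setDP[yp y2]; apply/negP => exy.
  have [r|r|r] := ltngtP (enum_rank x) (enum_rank y).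
  - by case/negP: x2; rewrite inE xp; apply/exists_inP; exists y; rewrite ?exy.
  - by case/negP: y2; rewrite inE yp; apply/exists_inP; exists x; rewrite // es exy.
  - by move: exy; rewrite (enum_rank_inj (val_inj r)) ei.
have ind2 x y : x \in N2 -> y \in N2 -> ~~ e x y.
  move=> /setIdP[xp /exists_inP[x' xp' /andP[exx' rx]]] /setIdP[yp /exists_inP[y' yp' /andP[eyy' ry]]].
  apply/negP => exy; have hx := poor_nbr xp xp' yp exx' exy.
  rewrite es in exy; have hy := poor_nbr yp yp' xp eyy' exy.
  by move: rx ry; rewrite hx hy => r1 r2; have := ltn_trans r1 r2; rewrite ltnn.
pose B2 := \bigcup_(x in N2) (home x :\ x).
pose B1 := mid :\: B2.
have sB2 : B2 \subset mid.
  by apply/bigcupsP => x x2; apply/subsetP => v /setD1P[vx vh];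
    apply: (home_mid (subsetP sN2 x x2)).
have slow A : A \subset low -> A \subset V.
  by move=> sA; apply/subsetP => x /(subsetP sA)/lowP[].
have lone_low : lone \subset low by apply/subsetP => x; rewrite inE => /andP[].
have poor_low : poor \subset low by apply/subsetP => x; rewrite inE => /andP[].
have lone_ind x y : x \in lone -> y \in lone :|: poor -> ~~ e x y.
  move=> xl; rewrite in_setU => yl; apply/negP => exy.
  have yl' : y \in low by case/orP: yl => [/(subsetP lone_low)|/(subsetP poor_low)].
  have := lone_nbr xl yl' exy; rewrite inE => /andP[_ hr].
  case/orP: yl; rewrite inE => /and3P[_]; last by rewrite hr.
  move=> ny _; case/existsP: hr => C /andP[/andP[qC _] yC].
  by have := no_clique ny qC; rewrite yC.
have mid_V : mid \subset V by apply/subsetP => x /midP[].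
(* The lone vertices join both halves, hence their factor 2 in the sum. In the kernel bound a vertex
   of degree q counts 1 and one of degree q + 1 counts 2. *)
have bound (N B : {set T}) : N \subset poor -> B \subset mid -> (forall x y, x \in N -> y \in N -> ~~ e x y) ->
    (forall x, x \in N -> home x :\ x \subset B) ->
    arcs e lone B + (q - 1) * #|N| <= #|lone| + #|N| + 2 * #|B|.
  move=> sN sB indN hN.
  have dLN : [disjoint lone & N].
    rewrite disjoints_subset; apply/subsetP => x; rewrite !inE => /and3P[xl nx _].
    by apply: contra nx => /(subsetP sN); rewrite inE => /and3P[].
  have ULN_low : lone :|: N \subset low by rewrite subUset lone_low (subset_trans sN).
  have dAB : [disjoint lone :|: N & B].
    rewrite disjoints_subset; apply/subsetP => x /(subsetP ULN_low)/lowP[_ dx]; rewrite inE.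
    by apply/negP => /(subsetP sB)/midP[_]; rewrite dx; move/eqP; rewrite ltn_eqF.
  have indLN x y : x \in lone :|: N -> y \in lone :|: N -> ~~ e x y.
    rewrite in_setU => /orP[xl|xN] yU.
      apply: lone_ind => //; move: yU; rewrite !in_setU => /orP[->//|/(subsetP sN)->].
      by rewrite orbT.
    case/setUP: yU => [yl|yN]; last exact: indN.
    by rewrite es; apply: lone_ind => //; rewrite in_setU (subsetP sN x xN) orbT.
  have := kernel_bound q0 se cr (slow _ ULN_low) (subset_trans sB mid_V) dAB indLN.
  rewrite arcsUl // => h.
  have h1 : (q - 1) * #|N| <= arcs e N B.
    rewrite arcs_nbrs mulnC -sum_nat_const; apply: leq_sum => x xN.
    have [qC xC] := homeP (subsetP sN x xN); have /qcliqueP[_ cC kC] := qC.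
    have <- : #|home x :\ x| = q - 1 by have := cardsD1 x (home x); rewrite xC cC; gen_arith; lia.
    apply: subset_leq_card; apply/subsetP => z zh; rewrite inE (subsetP (hN x xN)) //.
    by case/setD1P: zh => zx zh; apply: kC; rewrite // eq_sym.
  have h2 : \sum_(v in (lone :|: N) :|: B) ((d v).+1 - q) = #|lone| + #|N| + 2 * #|B|.
    rewrite (big_setID (lone :|: N)) /= setUK setDUl setDv set0U.
    have -> : B :\: (lone :|: N) = B by apply/setDidPl; rewrite disjoint_sym.
    have -> : #|lone| + #|N| = #|lone :|: N| by rewrite cardsU (disjoint_setI0 dLN) cards0 subn0.
    rewrite -!sum1_card big_distrr /=; congr (_ + _); apply: eq_bigr => v.
      by move=> /(subsetP ULN_low)/lowP[_ ->]; rewrite subSnn.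
    by move=> /(subsetP sB)/midP[_ ->]; rewrite -addn2 addKn.
  by move: h h1; rewrite h2; gen_arith; lia.
have b2 := bound N2 B2 sN2 sB2 ind2.
have {}b2 := b2 (fun x xN => bigcup_sup x xN).
have b1 := bound N1 B1 sN1 (subsetDl _ _) ind1.
have {}b1 := b1 _.
have hN1 x : x \in N1 -> home x :\ x \subset B1.
  move=> x1; have xp := subsetP sN1 x x1; apply/subsetP => z /setD1P[zx zh].
  rewrite inE (home_mid xp zh zx) andbT; apply/negP => /bigcupP[y y2 /setD1P[zy zhy]].
  apply: (home_disjoint xp (subsetP sN2 y y2) _ zh zhy zx zy).
  by apply: contraTneq x1 => ->; rewrite inE y2.
move: (b1 hN1) b2.
have -> : arcs e lone mid = arcs e lone B2 + arcs e lone B1.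
  by rewrite (arcsIDr e B2) (setIidPr sB2).
have -> : #|mid| = #|B2| + #|B1| by rewrite -(cardsID B2 mid) (setIidPr sB2).
have -> : #|poor| = #|N2| + #|N1| by rewrite -(cardsID N2 poor) (setIidPr sN2).
by rewrite mulnDr; move: (_ * #|N1|) (_ * #|N2|); gen_arith; lia.
Qed.

(* A big vertex of degree d sends surplus / d along each of its edges; what it
   sends into a rich clique goes to the vertices of degree q of that clique. *)
Local Notation share v := ((surplus q (d v))%:R / (d v)%:R : rat)%R.

Lemma share_ge0 v : (0 <= share v)%R.
Proof. by rewrite divr_ge0 ?ler0n. Qed.

Lemma share_ge1 v : v \in big -> (1 <= share v)%R.
Proof.
move=> /bigP[vV hd]; rewrite ler_pdivlMr ?ltr0n ?mul1r ?ler_nat; last by apply: leq_ltn_trans hd.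
by apply: surplus_ge => //; apply: ltn_trans q3.
Qed.

(** No edge is counted twice: two q-cliques through v share no other vertex, and lone and grouped
    vertices lie in no q-clique. *)
Lemma half_edges v : v \in big ->
  #|nbrs e lone v| + #|nbrs e grouped v| +
    \sum_(C : {set T} | rich_clique C && (v \in C)) (q - 1) <= d v.
Proof.
move=> vb.
have cC (C : {set T}) : rich_clique C && (v \in C) ->
    q - 1 = \sum_(u in V) ((u \in C) && (u != v)).
  move=> /andP[/andP[/qcliqueP[sC cC kC] _] vC].
  have -> : q - 1 = #|C :\ v| by have := cardsD1 v C; rewrite vC cC; gen_arith; lia.
  rewrite -sum1_card big_mkcond [RHS]big_mkcond /=; apply: eq_bigr => u _.
  rewrite !inE andbC; case uC: (u \in C) => /=; last by case: (u \in V).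
  by rewrite (subsetP sC) //; case: (_ != _).
rewrite (eq_bigr _ cC) exchange_big /= !nbrsE.
have toV A : A \subset low -> \sum_(u in A) (e v u : nat) = \sum_(u in V) ((u \in A) && e v u).
  move=> sA; rewrite big_mkcond [RHS]big_mkcond /=; apply: eq_bigr => u _.
  case uA: (u \in A) => /=; last by case: (u \in V).
  by have [-> _] := lowP _ (subsetP sA u uA).
rewrite (toV lone) ?(toV grouped); try by apply/subsetP => x; rewrite inE => /andP[].
rewrite -!big_split /=; apply: leq_sum => u uV.
have [/existsP[C /and4P[hC vC uC uv]]|hno] :=
    boolP [exists C, [&& rich_clique C, v \in C, u \in C & u != v]].
  have [qC _] := andP hC; have /qcliqueP[_ _ kC] := qC.
  have iu := in_cliqueI qC uC.
  have -> : u \in lone = false by rewrite inE iu andbF.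
  have -> : u \in grouped = false by rewrite inE iu andbF.
  have vu : v != u by rewrite eq_sym.
  rewrite (kC v u vC uC vu) /= !add0n (bigD1 C) ?hC ?vC //= uC uv big1 //.
  move=> C' /andP[/andP[hC' vC'] nC]; have [qC' _] := andP hC'.
  case uC' : (u \in C') => //.
  have := two_cliques qC' qC nC; rewrite leqNgt => /negP[].
  by rewrite (cardsD1 u) (cardsD1 v) !inE uC' uC vC' vC vu.
rewrite big1 ?addn0; last first.
  move=> C /andP[hC vC]; apply/eqP; rewrite eqb0; apply: contra hno => /andP[uC uv].
  by apply/existsP; exists C; rewrite hC vC uC.
have [ul|ul] := boolP (u \in lone); last by rewrite add0n; case: (u \in grouped); case: (e v u).
have -> : u \in grouped = false.
  by move: ul; rewrite !inE => /and3P[_ _ /eqP->]; rewrite !andbF.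
by rewrite addn0.
Qed.

Lemma grouped_share u : u \in grouped ->
  ((q - 2)%:R <= \sum_(v in big) (e v u)%:R * share v)%R.
Proof.
rewrite inE => /and3P[ul nu cu]; have [uV du] := lowP _ ul.
have sT : cluster u \subset cnbrs e V u by apply/subsetP => z; apply: cluster_cnbrs.
pose A := cnbrs e V u :\: cluster u.
have AP v : v \in A -> [/\ v \in V, e v u & q + #|cluster u| <= d v].
  move=> /setDP[vN vT]; have vV : v \in V by move: vN; rewrite inE => /andP[].
  split=> //; last first.
    apply: cluster_deg => //; first exact: no_clique.
    by apply: contra vT => h; rewrite inE vV.
  move: vN; rewrite inE vV es /= => /orP[/eqP vu|//].
  by rewrite vu cluster_refl in vT.
have cA : #|A| = q.+1 - #|cluster u|.
  by have := cardsID (cluster u) (cnbrs e V u); rewrite (setIidPr sT) card_cnbrs // du -/A;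
    gen_arith; lia.
have tq := card_cluster uV du.
apply: le_trans (_ : \sum_(v in A) share v <= _)%R.
  apply: sum_share_ge.
  - by rewrite -card_gt0 cA subn_gt0; apply: leqW (ltnW tq).
  - by move=> v /AP[_ _ hd]; apply: leq_trans hd; rewrite ltn_addr.
  - by move=> v /AP[_ _ hd]; rewrite cA; apply: surplus_cluster.
rewrite big_mkcond [leRHS]big_mkcond /=; apply: ler_sum => v _.
case: ifPn => [/AP[vV evu hd]|_].
  have -> : v \in big.
    by apply/bigP; split=> //; apply: leq_trans hd; rewrite -addn2 leq_add2l.
  by rewrite evu mul1r.
by case: ifP => // _; rewrite mulr_ge0 ?ler0n ?share_ge0.
Qed.

(** The low vertices of [C] form one cluster. For a singleton the big vertex of [C] suffices;
    otherwise all other vertices of [C] are big and contribute. *)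
Lemma clique_share C : rich_clique C ->
  (#|C :&: low|%:R <= \sum_(v in big | v \in C) share v)%R.
Proof.
move=> /andP[qC /exists_inP[b bC bb]]; have /qcliqueP[sC cC _] := qC.
have [->|[x /setIP[xC xl]]] := set_0Vmem (C :&: low).
  by rewrite cards0; apply: sumr_ge0 => v _; apply: share_ge0.
have [xV dx] := lowP _ xl.
have ClE : C :&: low = cluster x.
  apply/setP => v; rewrite in_setI; apply/andP/idP => [[vC vl]|vT].
    exact: (cluster_low qC xC).
  by split; [apply: (subsetP (cluster_sub_clique qC xC)) | apply: cluster_in_low vT].
rewrite ClE; have [c1|c2] := leqP #|cluster x| 1.
  have -> : #|cluster x| = 1 by apply/eqP; rewrite eqn_leq c1 cluster_pos.
  rewrite (bigD1 b) /=; last by rewrite bb bC.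
  apply: ler_wpDr; last exact: share_ge1.
  by apply: sumr_ge0 => v _; apply: share_ge0.
have sT := cluster_sub_clique qC xC.
pose A := C :\: cluster x.
have cA : #|A| = q - #|cluster x|.
  by have := cardsID (cluster x) C; rewrite (setIidPr sT) cC -/A; gen_arith; lia.
have AP v : v \in A -> q + #|cluster x| <= d v.
  by move=> /setDP[vC vT]; apply: (clique_high qC).
have tq := card_cluster xV dx.
apply: le_trans (_ : \sum_(v in A) share v <= _)%R.
  apply: sum_share_ge.
  - by rewrite -card_gt0 cA subn_gt0; apply: ltnW.
  - by move=> v /AP hd; apply: leq_trans hd; rewrite ltn_addr.
  - by move=> v /AP hd; rewrite cA; apply: surplus_clique.
rewrite big_mkcond [leRHS]big_mkcond /=; apply: ler_sum => v _.
case: ifPn => [vA|_].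
  have hd := AP v vA; case/setDP: vA => vC _.
  have -> : v \in big; last by rewrite vC.
  by apply/bigP; split; [apply: (subsetP sC) | apply: leq_trans hd; rewrite -addn2 leq_add2l].
by case: ifP => // _; apply: share_ge0.
Qed.

Lemma big_surplus :
  arcs e big lone + (q - 2) * #|grouped| + (q - 1) * #|rich| <= \sum_(v in big) surplus q (d v).
Proof.
rewrite -(ler_nat rat) !natrD natr_sum.
have d0 v : v \in big -> (0 < (d v)%:R :> rat)%R.
  by move=> /bigP[_ hd]; rewrite ltr0n; apply: leq_ltn_trans hd.
have -> : (\sum_(v in big) (surplus q (d v))%:R = \sum_(v in big) (d v)%:R * share v :> rat)%R.
  by apply: eq_bigr => v vb; rewrite mulrC divfK // gt_eqF ?d0.
apply: le_trans (_ : \sum_(v in big) (#|nbrs e lone v|%:R * share v + #|nbrs e grouped v|%:R * share v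
   + \sum_(C : {set T} | rich_clique C && (v \in C)) (q - 1)%:R * share v) <= _)%R; last first.
  apply: ler_sum => v vb; have h := half_edges vb.
  rewrite -(ler_nat rat) !natrD natr_sum in h.
  by rewrite -mulr_suml -!mulrDl; apply: (ler_wpM2r (share_ge0 v) h).
rewrite !big_split /=; apply: lerD; first apply: lerD.
- rewrite arcs_nbrs natr_sum; apply: ler_sum => v vb.
  by rewrite ler_peMr ?ler0n // share_ge1.
- have -> : (\sum_(v in big) #|nbrs e grouped v|%:R * share v =
      \sum_(u in grouped) \sum_(v in big) (e v u)%:R * share v)%R.
    rewrite exchange_big /=; apply: eq_bigr => v _.
    by rewrite -mulr_suml nbrsE natr_sum.
  rewrite mulnC -sum_nat_const natr_sum; apply: ler_sum => u; exact: grouped_share.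
rewrite (exchange_big_dep rich_clique) /=; last by move=> v C _ /andP[].
apply: le_trans (_ : \sum_(C | rich_clique C) (q - 1)%:R * #|C :&: low|%:R <= _)%R; last first.
  apply: ler_sum => C hC; rewrite -mulr_sumr; apply: ler_wpM2l; rewrite ?ler0n //.
  apply: le_trans (clique_share hC) _.
  by rewrite le_eqVlt; apply/orP; left; apply/eqP; apply: eq_bigl => v; rewrite hC.
rewrite -mulr_sumr natrM; apply: ler_wpM2l; rewrite ?ler0n // -natr_sum ler_nat.
rewrite -sum1_card; apply: leq_trans (_ : \sum_(x in rich) \sum_(C | rich_clique C) (x \in C) <= _).
  apply: leq_sum => x; rewrite inE => /andP[_ /existsP[C /andP[hC xC]]].
  by rewrite (bigD1 C) //= xC.
rewrite exchange_big /=; apply: leq_sum => C _.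
rewrite -sum1_card big_mkcond [X in _ <= X]big_mkcond /=; apply: leq_sum => x _.
rewrite in_setI; case: ifPn => // xr; have -> : x \in low by move: xr; rewrite inE => /andP[].
by case: (x \in C).
Qed.

(** A lone vertex has q edges: those to big vertices bring 1 each, those to [mid] are bounded with
    the poor vertices at a cost of 2 per lone vertex, and the low ones end in [rich]. A rich vertex
    receives q - 1, one more than it needs, which pays for its only possible lone neighbour. *)
Lemma discharge_four : (rho q e V <= 0)%R.
Proof.
apply: discharge_rho.
have split : V :\: low = big :|: mid.
  apply/setP => v; rewrite in_setD in_setU; apply/andP/idP => [[vl vV]|].
    exact: high_cases.
  case/orP => [/bigP[vV hd]|/midP[vV hd]]; split=> //; apply/negP => /lowP[_] h.
    by move: hd; rewrite h ltnNge leqnSn.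
  by move/eqP: hd; rewrite h ltn_eqF.
have dbm : [disjoint big & mid].
  rewrite disjoints_subset; apply/subsetP => v /bigP[_ hd]; rewrite inE.
  by apply/negP => /midP[_ h]; rewrite h ltnn in hd.
have sumE : \sum_(v in V :\: low) surplus q (d v) = \sum_(v in big) surplus q (d v) + 2 * #|mid|.
  rewrite split (big_setID big) /= setUK setDUl setDv set0U.
  have -> : mid :\: big = mid by apply/setDidPl; rewrite disjoint_sym.
  congr (_ + _); rewrite mulnC -sum_nat_const; apply: eq_bigr => v /midP[_ ->].
  by rewrite /surplus subSnn muln0.
have lone_low : lone \subset low by apply/subsetP => x; rewrite inE => /andP[].
have lowV : low \subset V by apply/subsetP => x /lowP[].
have loneE : q * #|lone| = arcs e lone low + (arcs e lone big + arcs e lone mid).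
  rewrite -arcsUr // -split; have := arcsIDr e low lone V; rewrite (setIidPr lowV) => <-.
  rewrite arcs_nbrs mulnC -sum_nat_const.
  by apply: eq_bigr => x /(subsetP lone_low)/lowP[].
have lr : arcs e lone low <= arcs e lone rich.
  rewrite !arcs_nbrs; apply: leq_sum => x xl; apply: subset_leq_card; apply/subsetP => y.
  move=> /setIdP[yl exy]; apply/setIdP; split=> //; exact: lone_nbr xl yl exy.
rewrite sumE low_partition.
have := big_surplus; have := poor_bound; have := rich_lone.
rewrite (arcsC big lone es).
have [p hp] : exists p, q = p + 2 by exists (q - 2); move: q3; clear; lia.
move: loneE lr; move: (\sum_(_ in _) _) => z; rewrite {1}hp.
have -> : q - 1 = p + 1 by rewrite hp; clear; lia.
have -> : q - 2 = p by rewrite hp addnK.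
by gen_arith; nia.
Qed.

End Discharge.

Lemma no_counterexample : False.
Proof.
have : (rho q e V <= 0)%R.
  by have [q4|q3'] := ltnP 3 q; [apply: discharge_four | apply: discharge_three; apply/eqP;
    rewrite eqn_leq q3' q3].
move=> h; have := lt_le_trans large h; rewrite /ky_bound; move: q3; clear.
by nia.
Qed.

End MinimalCounterexample.

Theorem kostochka_yancey (T : finType) (q : nat) (e : rel T) (V : {set T}) :
  2 < q -> sgr e -> crit q e V -> (rho q e V <= ky_bound q)%R.
Proof.
move=> q3; have [n] := ubnP (arcs e V V); elim: n e V => // n IHn e V hn.
(* The inner induction is on decreasing [twins]. These number at most #|V|^2, hence at most the
   square of the arcs, so the subtraction does not truncate. *)
have [m] := ubnP (arcs e V V * arcs e V V - twins e V); elim: m e V hn => // m IHm e V hn hm se cr.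
rewrite leNgt; apply/negP => large; apply: (no_counterexample q3 se cr _ large).
have twb (f : rel T) (W : {set T}) : sgr f -> crit q f W -> twins f W <= arcs f W W * arcs f W W.
  move=> sf cf; have h : #|W| <= arcs f W W.
    rewrite arcs_nbrs -sum1_card; apply: leq_sum => x xW.
    by apply: leq_trans (mindeg sf cf xW); apply: leq_trans q3.
  by apply: leq_trans (arcs_card _ _ _) _; apply: leq_mul.
move=> f W sf cf [h|[h1 h2]]; first by apply: IHn => //; apply: leq_trans h _.
apply: IHm => //; first by rewrite h1.
have := twb f W sf cf; have := twb e V se cr; rewrite h1.
by move: hm h2; move: (arcs e V V * _) (twins e V) (twins f W); clear => a b c; lia.
Qed.

(** * Sparse critical graphs *)

(** [a] is twice the number of edges. *)
Definition crit_exists_with (q n a : nat) : Prop :=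
  exists (T : finType) (e : rel T) (V : {set T}),
    [/\ sgr e, crit q e V, #|V| = n & arcs e V V = a].

(** Without isolated vertices, deleting a vertex also deletes an edge, so colourability after edge
    deletions is enough. *)
Lemma crit_intro (T : finType) (q : nat) (e : rel T) (V : {set T}) :
  sgr e -> ~~ qcol q e V -> (forall x, x \in V -> exists2 y, y \in V & e x y) ->
  (forall x y, x \in V -> y \in V -> e x y -> qcol q (del e x y) V) -> crit q e V.
Proof.
move=> [es ei] nc niso hdel; split=> // x xV.
have [y yV exy] := niso x xV; apply: qcol_sub (hdel x y xV yV exy); first exact: subsetDl.
move=> u v /setD1P[ux _] /setD1P[vx _] euv.
by rewrite /del euv (negbTE ux) (negbTE vx) /= andbF.
Qed.

Lemma complete_crit (q : nat) : 0 < q -> crit_exists_with q q.+1 (q.+1 * q).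
Proof.
move=> q0; pose e : rel 'I_q.+1 := fun x y => x != y.
have se : sgr e by split=> [x y|x]; rewrite /e ?eqxx // eq_sym.
exists 'I_q.+1, e, setT; split=> //.
- apply: crit_intro => //.
  + apply/negP => /qcolP[c cP].
    have inj : injective c.
      move=> x y cxy; apply/eqP; apply: contraT => nxy.
      by have := cP x y (in_setT _) (in_setT _) nxy; rewrite cxy eqxx.
    by have := leq_card c inj; rewrite !card_ord ltnn.
  + move=> x _; exists (if x == ord0 then ord_max else ord0); first exact: in_setT.
    by rewrite /e; case: (eqVneq x ord0) => [->|//]; rewrite -val_eqE /= eq_sym -lt0n.
  move=> x y _ _ exy; apply/qcolP.
  (* [unlift y] colours all vertices but y injectively; y repeats the colour of x. *)
  exists (fun z => odflt (odflt (Ordinal q0) (unlift y x)) (unlift y z)) => u v _ _.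
  rewrite /del /e; case: (unliftP y x) exy => [x' -> _|->]; last by rewrite /e eqxx.
  case: (unliftP y u) => [u' ->|->]; case: (unliftP y v) => [v' ->|->] /=.
  - by case/andP=> + _; apply: contra => /eqP->.
  - by rewrite eqxx andbT => /andP[_]; apply: contra => /eqP->; rewrite eqxx.
  - by rewrite eqxx /= => /andP[_]; apply: contra => /eqP <-; rewrite eqxx orbT.
  - by rewrite eqxx.
- by rewrite cardsT card_ord.
- by rewrite arcs_clique ?cardsT ?card_ord ?subn1 //; case: se.
Qed.

(** * The Hajos join with a complete graph *)

Section Hajos.
Variables (T : finType) (q : nat) (e : rel T) (V : {set T}) (x y : T).
Hypotheses (q3 : 2 < q) (se : sgr e) (cr : crit q e V).
Hypotheses (xV : x \in V) (yV : y \in V) (exy : e x y).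

Let q0 : 0 < q. Proof. exact: leq_trans q3. Qed.
Let es : symmetric e. Proof. by case: se. Qed.
Let ei : irreflexive e. Proof. by case: se. Qed.
Let i0 : 'I_q := Ordinal q0.

Definition hajos_cross (a : T) (i : 'I_q) : bool :=
  (a == x) && (i != i0) || (a == y) && (i == i0).

(* The Hajos join of the graph and a complete graph on [x] and q new vertices,
   along the edge [x y] and the edge from [x] to the new vertex [i0]. *)
Definition hajos : rel (T + 'I_q) := fun u v =>
  match u, v with
  | inl a, inl b => del e x y a b
  | inr i, inr j => i != j
  | inl a, inr i | inr i, inl a => hajos_cross a i
  end.

Definition hajos_vertices : {set T + 'I_q} :=
  [set u | if u is inl a then a \in V else true].

Local Notation E := hajos.
Local Notation W := hajos_vertices.

Lemma hajos_sgr : sgr E.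
Proof.
have [ds di] := del_sgr x y se.
by split=> [[a|i] [b|j]|[a|i]] //=; rewrite ?ds ?di ?eqxx // eq_sym.
Qed.

Let nxy : x != y. Proof. by apply: contraTneq exy => ->; rewrite ei. Qed.

(** The new vertices use all q colours, so one of them has the colour of x; it can only be [i0].
    Hence y differs from x, and the old graph would be coloured. *)
Lemma hajos_ncol : ~~ qcol q E W.
Proof.
apply/negP => /qcolP[c cP]; have [nc _ _] := cr; case/negP: nc; apply/qcolP.
have inW i : inr i \in W by rewrite inE.
have inV a : a \in V -> inl a \in W by rewrite inE.
have injr : injective (fun i => c (inr i)).
  move=> i j cij; apply/eqP; apply: contraT => nij.
  by have := cP (inr i) (inr j) (inW i) (inW j) nij; rewrite cij eqxx.
have [f _ fK] := injF_bij injr.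
have cf : c (inr (f (c (inl x)))) = c (inl x) by rewrite fK.
have f0 : f (c (inl x)) = i0.
  apply/eqP; apply: contraT => h; have := cP (inl x) (inr (f (c (inl x)))) (inV x xV) (inW _).
  by rewrite /= /hajos_cross eqxx h /= cf eqxx => /(_ isT).
have ncxy : c (inl x) != c (inl y).
  rewrite -cf f0; apply: cP; rewrite ?inW ?inV //=.
  by rewrite /hajos_cross !eqxx orbT.
exists (fun a => c (inl a)) => a b aV bV eab.
have [/andP[/eqP-> /eqP->] //|h1] := boolP ((a == x) && (b == y)).
have [/andP[/eqP-> /eqP->]|h2] := boolP ((a == y) && (b == x)); first by rewrite eq_sym.
by apply: cP; rewrite ?inV //= /del eab (negbTE h1) (negbTE h2).
Qed.

Lemma hajos_colour (g : rel (T + 'I_q)) (c : T -> 'I_q) (s : 'I_q -> 'I_q) :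
  symmetric g ->
  (forall a b, a \in V -> b \in V -> g (inl a) (inl b) -> c a != c b) ->
  (forall i j, g (inr i) (inr j) -> s i != s j) ->
  (forall a i, a \in V -> g (inl a) (inr i) -> c a != s i) -> qcol q g W.
Proof.
move=> gs h1 h2 h3; apply/qcolP.
exists (fun u => match u with inl a => c a | inr i => s i end).
case=> [a|i] [b|j]; rewrite !inE => aV bV guv //.
- exact: h1.
- exact: h3.
- by rewrite eq_sym; apply: h3; rewrite // gs.
- exact: h2.
Qed.

(** Without xy the old graph has a colouring in which x and y agree; without another edge it has one
    in which they differ. The new vertices are coloured by a transposition fitted to the colour of
    x. *)
Lemma hajos_del (u v : T + 'I_q) : u \in W -> v \in W -> E u v -> qcol q (del E u v) W.
Proof.
have hs u' v' := proj1 (del_sgr u' v' hajos_sgr).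
have [nc _ hdel] := cr.
have /qcolP[c cP] := hdel x y xV yV exy.
have cxy : c x = c y.
  apply/eqP; apply: contraT => ncxy; case/negP: nc; apply/qcolP; exists c => a b aV bV eab.
  have [/andP[/eqP-> /eqP->] //|h1] := boolP ((a == x) && (b == y)).
  have [/andP[/eqP-> /eqP->]|h2] := boolP ((a == y) && (b == x)); first by rewrite eq_sym.
  by apply: cP; rewrite // /del eab (negbTE h1) (negbTE h2).
wlog: u v / match u, v with inr _, inl _ => false | _, _ => true end.
  case: u v => [a|i] [b|j] H uW vW Euv.
  - exact: H.
  - exact: H.
  - have := H (inl b) (inr i) isT vW uW; rewrite (proj1 hajos_sgr) => /(_ Euv).
    by apply: qcol_sub => // p r _ _; rewrite /del; case/andP=> -> /=;
      rewrite orbC andbC [X in _ || X]andbC.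
  - exact: H.
case: u v => [a|i] [b|j] //= _; rewrite !inE => uW vW Euv.
- have {Euv} /andP[eab nab] := Euv.
  have /qcolP[c' cP'] := hdel a b uW vW eab.
  have cxy' : c' x != c' y.
    apply: cP' => //; rewrite /del exy /=; apply: contra nab.
    by rewrite [x == a]eq_sym [y == b]eq_sym [x == b]eq_sym [y == a]eq_sym [(b == x) && _]andbC.
  apply: (@hajos_colour _ c' (tperm i0 (c' x))) => //.
  + move=> p r pV rV /andP[/andP[epr _] npr]; apply: cP' => //.
    rewrite /del epr /=; apply: contra npr => /orP[] /andP[/eqP-> /eqP->]; rewrite !eqxx ?orbT //.
  + by move=> p r /andP[/= npr _]; rewrite (inj_eq perm_inj).
  + move=> p r pV /andP[/= /orP[/andP[/eqP-> r0]|/andP[/eqP-> /eqP->]] _].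
      by rewrite -{1}(tpermL i0 (c' x)) (inj_eq perm_inj) eq_sym.
    by rewrite tpermL eq_sym.
(* [j] may take the common colour of x and y, as its only edge to the old graph is deleted. *)
- apply: (@hajos_colour _ c (tperm j (c x))) => //.
  + by move=> p r pV rV /andP[h _]; apply: cP.
  + by move=> p r /andP[/= npr _]; rewrite (inj_eq perm_inj).
  move=> p r pV /andP[/= hpr npr].
  have -> : c p = tperm j (c x) j.
    by rewrite tpermL; case/orP: hpr => /andP[/eqP-> _].
  rewrite (inj_eq perm_inj); apply: contra npr => /eqP jr.
  move: Euv hpr; rewrite -jr /hajos_cross => /orP[] /andP[/eqP-> hj] /orP[] /andP[/eqP-> hj'];
    rewrite ?eqxx //.
    by rewrite hj' in hj.
  by rewrite hj in hj'.
(* [i] gives up the colour of x and y and shares that of [j]. *)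
- pose s := tperm i (c x).
  apply: (@hajos_colour _ c (fun l => if l == i then s j else s l)) => //.
  + by move=> p r pV rV /andP[h _]; apply: cP.
  + move=> p r /andP[/= npr nd].
    case: (eqVneq p i) nd npr => [->|pi]; case: (eqVneq r i) => [->|ri] nd npr.
    * by move: npr; rewrite ?eqxx.
    * by rewrite (inj_eq perm_inj); apply: contra nd => /eqP->; rewrite !eqxx.
    * by rewrite (inj_eq perm_inj); apply: contra nd => /eqP->; rewrite !eqxx orbT.
    * by rewrite (inj_eq perm_inj).
  move=> p r pV /andP[/= hpr _].
  have -> : c p = s i by rewrite tpermL; case/orP: hpr => /andP[/eqP-> _].
  by case: (eqVneq r i) => [_|ri]; rewrite (inj_eq perm_inj) // eq_sym.
Qed.

Lemma hajos_niso u : u \in W -> exists2 v, v \in W & E u v.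
Proof.
have i1 : exists i : 'I_q, i != i0.
  by exists (Ordinal (ltnW q3)); rewrite -val_eqE.
case: u => [a|i] uW.
  rewrite inE in uW; have [->|ax] := eqVneq a x.
    by have [i hi] := i1; exists (inr i); rewrite ?inE //= /hajos_cross eqxx hi.
  have [->|ay] := eqVneq a y.
    by exists (inr i0); rewrite ?inE //= /hajos_cross !eqxx orbT.
  have : 0 < #|nbrs e V a| by apply: leq_trans (mindeg se cr uW).
  case/card_gt0P => b; rewrite inE => /andP[bV eab]; exists (inl b); rewrite ?inE //=.
  by rewrite /del eab (negbTE ax) (negbTE ay).
have [j hj] := i1; have [->|hi] := eqVneq i i0.
  by exists (inr j); rewrite ?inE //= eq_sym.
by exists (inr i0); rewrite ?inE.
Qed.

Lemma hajos_crit : crit q E W.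
Proof.
apply: crit_intro; [exact: hajos_sgr|exact: hajos_ncol|exact: hajos_niso|exact: hajos_del].
Qed.

Let WE : W = (inl @: V) :|: (inr @: [set: 'I_q]).
Proof.
apply/setP => -[a|i]; rewrite !inE.
  rewrite (mem_imset _ _ (@inl_inj T 'I_q)); case: (a \in V) => //=.
  by symmetry; apply/imsetP => -[].
by symmetry; apply/orP; right; apply: imset_f; rewrite inE.
Qed.

Let dW : [disjoint (inl @: V : {set T + 'I_q}) & inr @: [set: 'I_q]].
Proof.
rewrite disjoints_subset; apply/subsetP => _ /imsetP[a _ ->]; rewrite inE.
by apply/imsetP => -[].
Qed.

Lemma hajos_card : #|W| = #|V| + q.
Proof.
rewrite WE cardsU (disjoint_setI0 dW) cards0 subn0.
by rewrite !card_imset ?cardsT ?card_ord //; [exact: inr_inj | exact: inl_inj].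
Qed.

Lemma hajos_arcs : arcs E W W = arcs e V V + (q * q + q - 2).
Proof.
have [hs _] := hajos_sgr.
rewrite WE arcsUU //.
have sumT (F : T + 'I_q -> nat) : \sum_(u in inl @: V) F u = \sum_(a in V) F (inl a).
  by rewrite big_imset //= => a b _ _; apply: inl_inj.
have sumI (F : T + 'I_q -> nat) : \sum_(u in inr @: [set: 'I_q]) F u = \sum_i F (inr i).
  by rewrite big_imset /=; [apply: eq_bigl => i; rewrite inE | move=> a b _ _; apply: inr_inj].
have h1 : arcs E (inl @: V) (inl @: V) + 2 = arcs e V V.
  rewrite (arcs_del se xV yV exy); congr (_ + _); rewrite /arcs sumT.
  by apply: eq_bigr => a _; rewrite sumT.
have h2 : arcs E (inr @: [set: 'I_q]) (inr @: [set: 'I_q]) = q * (q - 1).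
  rewrite arcs_clique; last 2 first.
  - by case: hajos_sgr.
  - by move=> _ _ /imsetP[i _ ->] /imsetP[j _ ->] /=; rewrite (inj_eq (@inr_inj _ _)).
  by rewrite card_imset ?cardsT ?card_ord //; apply: inr_inj.
have h3 : arcs E (inl @: V) (inr @: [set: 'I_q]) = q.
  rewrite /arcs sumT exchange_big /= sumI.
  transitivity (\sum_(i < q) 1); last by rewrite sum1_card card_ord.
  apply: eq_bigr => i _.
  have [->|hi] := eqVneq i i0.
    rewrite (bigD1 y) //= {1}/hajos_cross !eqxx orbT big1 // => a /andP[_ ay].
    by rewrite /hajos_cross eqxx (negbTE ay) andbF.
  rewrite (bigD1 x) //= {1}/hajos_cross eqxx hi big1 // => a /andP[_ ax].
  by rewrite /hajos_cross (negbTE hi) (negbTE ax) andbF.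
rewrite h2 h3; move: h1 q3; clear; move: (arcs _ _ _) (arcs _ _ _) => a b <- q2.
by have [p ->] : exists p, q = p + 2; [exists (q - 2); lia | nia].
Qed.

End Hajos.

Lemma hajos_step (q n a : nat) : 2 < q -> crit_exists_with q n a ->
  crit_exists_with q (n + q) (a + (q * q + q - 2)).
Proof.
move=> q3 [T [e [V [se cr <- <-]]]].
have q0 : 0 < q by apply: leq_trans q3.
have [x xV] := crit_neq0 q0 cr.
have : 0 < #|nbrs e V x| by apply: leq_trans (mindeg se cr xV).
case/card_gt0P => y; rewrite inE => /andP[yV exy].
exists (T + 'I_q)%type, (hajos e x y q3), (hajos_vertices q V); split.
- exact: hajos_sgr.
- exact: hajos_crit.
- exact: hajos_card.
- exact: hajos_arcs.
Qed.

Lemma hajos_iter (q n a j : nat) : 2 < q -> crit_exists_with q n a ->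
  crit_exists_with q (n + j * q) (a + j * (q * q + q - 2)).
Proof.
move=> q3 h; elim: j => [|j IH]; first by rewrite !mul0n !addn0.
by have := hajos_step q3 IH; rewrite -!addnA !mulSn ![_ + j * _]addnC.
Qed.

(** * Small critical graphs checked by computation *)

Section Tables.
Variables (q n : nat) (s : seq (nat * nat * seq nat)).

Definition table_edges : seq (nat * nat) := map fst s.

Definition table_adj (i j : nat) : bool :=
  ((i, j) \in table_edges) || ((j, i) \in table_edges).

Definition table_rel : rel 'I_n := fun x y => table_adj x y.

(** A backtracking search: [c] lists the colours of the vertices handled so far and m vertices
    remain. *)
Fixpoint extendable (m : nat) (c : seq nat) : bool :=
  if m is m'.+1 then
    has (fun a => all (fun j => table_adj j (size c) ==> (nth 0 c j != a)) (iota 0 (size c))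
      && extendable m' (rcons c a)) (iota 0 q)
  else true.

(* Each entry of the table is an edge with a colouring of the graph without it. *)
Definition table_ok : bool :=
  [&& all (fun p => p.1 < p.2) table_edges,
      all (fun i => has (table_adj i) (iota 0 n)) (iota 0 n) &
      all (fun p => [&& size p.2 == n, all (fun a => a < q) p.2 &
        all (fun f => (f == p.1) || (nth 0 p.2 f.1 != nth 0 p.2 f.2)) table_edges]) s].

(** Completeness of the search: its failure refutes colourability. *)
Lemma extendableP (f : nat -> nat) (m k : nat) :
  (forall i, i < m + k -> f i < q) ->
  (forall i j, i < m + k -> j < m + k -> table_adj i j -> f i != f j) ->
  extendable m (mkseq f k).
Proof.
elim: m k => //= m IH k fq fadj; apply/hasP; exists (f k).
  by rewrite mem_iota add0n /= fq // addSn ltnS leq_addl.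
rewrite size_mkseq; apply/andP; split.
  apply/allP => j; rewrite mem_iota add0n /= => jk; rewrite nth_mkseq //.
  by apply/implyP; apply: fadj; rewrite addSn ltnS ?leq_addl // ltnW // ltn_addl.
have -> : rcons (mkseq f k) (f k) = mkseq f k.+1.
  by rewrite /mkseq -addn1 iotaD add0n map_cat cats1.
by apply: IH => [i|i j]; rewrite addnS; [apply: fq | apply: fadj].
Qed.

Lemma table_crit : 0 < q -> table_ok -> ~~ extendable n [::] ->
  crit_exists_with q n (\sum_(0 <= i < n) \sum_(0 <= j < n) (table_adj i j : nat)).
Proof.
move=> q0 /and3P[hlt hcov hcol] next.
have tirr i : table_adj i i = false.
  by rewrite /table_adj orbb; apply/negP => /(allP hlt); rewrite /= ltnn.
have se : sgr table_rel.
  by split=> [x y|x]; rewrite /table_rel ?tirr // /table_adj orbC.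
exists 'I_n, table_rel, setT; split=> //; last first.
- rewrite /arcs big_mkord; apply: eq_big => [x|x _]; first by rewrite inE.
  by rewrite big_mkord; apply: eq_bigl => y; rewrite inE.
- by rewrite cardsT card_ord.
apply: crit_intro => //.
- apply: contra next => /qcolP[c cP].
  pose f i := if insub i is Some x then c x : nat else 0.
  have fE (x : 'I_n) : f x = c x by rewrite /f valK.
  apply: (@extendableP f n 0) => [i|i j]; rewrite addn0 => hi.
    by rewrite -[i]/(val (Ordinal hi)) fE.
  move=> hj hij; rewrite -[i]/(val (Ordinal hi)) -[j]/(val (Ordinal hj)) !fE.
  exact: (cP (Ordinal hi) (Ordinal hj)).
- move=> x _; have xn : val x \in iota 0 n by rewrite mem_iota add0n /=.
  have /hasP[j] := allP hcov _ xn; rewrite mem_iota add0n => jn xj.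
  by exists (Ordinal jn); rewrite ?inE.
move=> x y _ _ exy.
have [p ps hp] : exists2 p, p \in s & (p.1 == (x : nat, y : nat)) || (p.1 == (y : nat, x : nat)).
  by case/orP: exy => /mapP[p ps ep]; exists p; rewrite // -ep eqxx ?orbT.
have /and3P[/eqP sz /allP cq cadj] := allP hcol p ps.
apply/qcolP; exists (fun z : 'I_n => insubd (Ordinal q0) (nth 0 p.2 z)) => u v _ _ /andP[euv nuv].
have vE (z : 'I_n) : val (insubd (Ordinal q0) (nth 0 p.2 z)) = nth 0 p.2 z.
  by rewrite val_insubd cq // mem_nth // sz.
rewrite -val_eqE !vE.
have np (a b : 'I_n) : (a : nat, b : nat) == p.1 -> ((a == x) && (b == y)) || ((a == y) && (b == x)).
  by move/eqP=> hab; move: hp; rewrite -hab !xpair_eqE.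
case/orP: euv => hin; have := allP cadj _ hin => /orP[/np|//].
- by rewrite (negbTE nuv).
- by rewrite orbC andbC [X in _ || X]andbC (negbTE nuv).
- by rewrite eq_sym.
Qed.

End Tables.

(** The wheel with hub 5 and rim 0, 1, 4, 2, 3. *)
Definition wheel_table : seq (nat * nat * seq nat) := [::
  ((0, 1), [:: 0; 0; 0; 1; 1; 2]);
  ((0, 3), [:: 0; 1; 1; 0; 0; 2]);
  ((0, 5), [:: 0; 1; 1; 2; 2; 0]);
  ((1, 4), [:: 0; 1; 0; 1; 1; 2]);
  ((1, 5), [:: 0; 1; 0; 2; 2; 1]);
  ((2, 3), [:: 0; 1; 1; 1; 0; 2]);
  ((2, 4), [:: 0; 1; 0; 1; 0; 2]);
  ((2, 5), [:: 0; 1; 2; 1; 0; 2]);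
  ((3, 5), [:: 0; 1; 1; 2; 0; 2]);
  ((4, 5), [:: 0; 1; 0; 1; 2; 2])].

Definition eight_table : seq (nat * nat * seq nat) := [::
  ((0, 2), [:: 0; 0; 0; 1; 2; 1; 1; 2]);
  ((0, 5), [:: 0; 1; 1; 0; 2; 0; 0; 2]);
  ((0, 7), [:: 0; 0; 1; 2; 1; 2; 2; 0]);
  ((1, 3), [:: 0; 0; 1; 0; 2; 1; 1; 2]);
  ((1, 4), [:: 0; 0; 1; 2; 0; 1; 1; 2]);
  ((1, 5), [:: 0; 1; 1; 0; 2; 1; 0; 2]);
  ((1, 6), [:: 0; 0; 1; 2; 1; 2; 0; 2]);
  ((2, 3), [:: 0; 0; 1; 1; 2; 1; 1; 2]);
  ((2, 7), [:: 0; 0; 1; 2; 1; 2; 2; 1]);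
  ((3, 4), [:: 0; 0; 1; 2; 2; 1; 1; 2]);
  ((4, 5), [:: 0; 1; 1; 0; 2; 2; 0; 2]);
  ((4, 6), [:: 0; 0; 1; 2; 1; 2; 1; 2]);
  ((6, 7), [:: 0; 0; 1; 2; 1; 2; 2; 2])].

Definition ten_table : seq (nat * nat * seq nat) := [::
  ((0, 1), [:: 0; 0; 1; 2; 1; 0; 2; 3; 1; 3]);
  ((0, 2), [:: 0; 1; 0; 2; 0; 1; 2; 3; 0; 3]);
  ((0, 3), [:: 0; 1; 2; 0; 2; 0; 1; 3; 2; 3]);
  ((0, 9), [:: 0; 1; 2; 3; 2; 0; 1; 3; 2; 0]);
  ((1, 3), [:: 0; 1; 1; 1; 0; 2; 0; 3; 2; 3]);
  ((1, 4), [:: 0; 1; 1; 2; 1; 0; 2; 3; 0; 3]);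
  ((1, 8), [:: 0; 1; 1; 2; 0; 2; 0; 3; 1; 3]);
  ((1, 9), [:: 0; 1; 1; 2; 0; 3; 0; 2; 3; 1]);
  ((2, 5), [:: 0; 1; 1; 2; 0; 1; 2; 3; 0; 3]);
  ((2, 6), [:: 0; 1; 1; 2; 0; 2; 1; 3; 0; 3]);
  ((2, 7), [:: 0; 1; 1; 2; 0; 2; 3; 1; 0; 3]);
  ((3, 4), [:: 0; 1; 1; 2; 2; 0; 2; 3; 0; 3]);
  ((3, 8), [:: 0; 1; 1; 2; 0; 2; 0; 3; 2; 3]);
  ((3, 9), [:: 0; 1; 1; 2; 0; 3; 0; 2; 3; 2]);
  ((4, 5), [:: 0; 1; 1; 2; 0; 0; 2; 3; 0; 3]);
  ((4, 9), [:: 0; 1; 1; 2; 3; 0; 2; 3; 0; 3]);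
  ((5, 6), [:: 0; 1; 1; 2; 0; 2; 2; 3; 0; 3]);
  ((5, 7), [:: 0; 1; 1; 2; 0; 2; 3; 2; 0; 3]);
  ((6, 7), [:: 0; 1; 1; 2; 0; 2; 3; 3; 0; 3]);
  ((6, 8), [:: 0; 1; 1; 2; 0; 2; 0; 3; 0; 3]);
  ((7, 8), [:: 0; 1; 1; 2; 0; 2; 3; 0; 0; 3]);
  ((8, 9), [:: 0; 1; 1; 2; 0; 3; 0; 2; 3; 3])].

Lemma wheel_crit : crit_exists_with 3 6 20.
Proof.
have := @table_crit 3 6 wheel_table isT isT isT.
by rewrite unlock /=.
Qed.

Lemma eight_crit : crit_exists_with 3 8 26.
Proof.
have := @table_crit 3 8 eight_table isT isT isT.
by rewrite unlock /=.
Qed.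

Lemma ten_crit : crit_exists_with 4 10 44.
Proof.
have := @table_crit 4 10 ten_table isT isT isT.
by rewrite unlock /=.
Qed.

(** * Translation to the graphs of the statement *)

Section Bridge.
Variable T : finType.
Implicit Type G H : sgraph T.

Lemma adjacent_mem G x y : adjacent G x y -> x \in vertices G /\ y \in vertices G.
Proof.
by move=> /edgesP/andP[/subsetP sV _]; rewrite !sV // !inE eqxx ?orbT.
Qed.

Lemma adjacent_sgr G : sgr (adjacent G).
Proof.
split=> [x y|x]; rewrite /adjacent 1?setUC //.
by apply/negP => /edgesP/andP[_]; rewrite setUid cards1.
Qed.

Lemma edge_pair G s : s \in edges G -> exists x y, s = [set x; y] /\ x != y.
Proof.
by move=> /edgesP/andP[_ /cards2P[x [y [nxy ->]]]]; exists x, y.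
Qed.

Lemma set2_eq (x y u v : T) : [set x; y] = [set u; v] ->
  (x == u) && (y == v) || (x == v) && (y == u).
Proof.
move=> h.
have xi : x \in [set u; v] by rewrite -h set21.
have yi : y \in [set u; v] by rewrite -h set22.
have ui : u \in [set x; y] by rewrite h set21.
have vi : v \in [set x; y] by rewrite h set22.
move: xi yi ui vi; rewrite !inE.
have [->|nuv] := eqVneq u v; first by rewrite !orbb => -> ->.
by move=> /orP[] /eqP-> /orP[] /eqP->; rewrite !eqxx ?orbT //= [v == u]eq_sym (negbTE nuv).
Qed.

Lemma arcs_adjacent G :
  arcs (adjacent G) (vertices G) (vertices G) = 2 * #|edges G|.
Proof.
have -> : arcs (adjacent G) (vertices G) (vertices G) =
    \sum_(p : T * T) ([set p.1; p.2] \in edges G).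
  rewrite /arcs pair_big_dep /= big_mkcond /=; apply: eq_bigr => -[x y] _ /=.
  case: ifPn => // hxy; apply/esym/eqP; rewrite eqb0; apply: contra hxy => hE.
  by have [-> ->] := @adjacent_mem G x y hE.
have -> : \sum_(p : T * T) ([set p.1; p.2] \in edges G) =
    \sum_(s in edges G) \sum_(p : T * T) ([set p.1; p.2] == s).
  rewrite exchange_big /=; apply: eq_bigr => p _.
  case pE: (_ \in _).
    rewrite (bigD1 [set p.1; p.2]) //= eqxx big1 // => s /andP[_ ns].
    by rewrite eq_sym (negbTE ns).
  by rewrite big1 // => s sE; apply/eqP; rewrite eqb0; apply: contraFneq pE => ->.
rewrite mulnC -sum_nat_const; apply: eq_bigr => s /edge_pair[x [y [-> nxy]]].
rewrite (bigD1 (x, y)) //= eqxx (bigD1 (y, x)) /=; last first.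
  by rewrite xpair_eqE eq_sym (negbTE nxy).
rewrite setUC eqxx big1 // => -[u v] /= /andP[h1 h2].
apply/eqP; rewrite eqb0; apply/negP => /eqP/set2_eq.
by rewrite -!xpair_eqE (negbTE h1) (negbTE h2).
Qed.

Lemma colorable_qcol G q : 0 < q ->
  colorable G q <-> qcol q (adjacent G) (vertices G).
Proof.
case: q => // q _; split=> [[c [cq cP]]|/qcolP[c cP]].
  apply/qcolP; exists (fun x => inord (c x)) => x y xV yV exy.
  by rewrite -val_eqE /= !inordK ?cq //; apply/eqP/cP.
exists (fun x => c x : nat); split=> [x _ //|x y exy].
by have [xV yV] := adjacent_mem exy; apply/eqP; apply: cP.
Qed.

Lemma restrict_subproof G (P : pred {set T}) (W : {set T}) (e : {set T}) :
  e \in [set s in edges G | P s & s \subset W] -> (e \subset W) && (#|e| == 2).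
Proof. by rewrite inE => /and3P[/edgesP/andP[_ ->] _ ->]. Qed.

(** One construction for both deletions: [W] removes a vertex, [P] an edge. *)
Definition restrict G (P : pred {set T}) (W : {set T}) : sgraph T :=
  SGraph (@restrict_subproof G P W).

Lemma critical_crit G q : 0 < q -> critical q.+1 G ->
  crit q (adjacent G) (vertices G).
Proof.
move=> q0 [nc hsub]; rewrite subn1 /= in nc hsub.
have sub P (W : {set T}) : W \subset vertices G -> proper_subgraph (restrict G P W) G ->
    qcol q (fun x y => adjacent G x y && P [set x; y]) W.
  move=> sW /hsub/(colorable_qcol _ q0); apply: qcol_sub => // x y xW yW /andP[exy Pxy].
  by rewrite /adjacent inE (exy : [set x; y] \in edges G) Pxy /=; apply/subsetP => z;
    rewrite !inE => /orP[] /eqP->.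
have subG P (W : {set T}) : W \subset vertices G -> subgraph (restrict G P W) G.
  by move=> sW; rewrite /subgraph sW; apply/subsetP => s; rewrite inE => /andP[].
split.
- by apply/negP => /(colorable_qcol _ q0).
- move=> x xV; have sW : vertices G :\ x \subset vertices G by apply: subsetDl.
  apply: qcol_sub (sub predT _ sW _) => // [u v _ _ ->//|].
  rewrite /proper_subgraph subG //=; apply/negP => /andP[/subsetP/(_ x xV)].
  by rewrite !inE eqxx.
- move=> x y xV yV exy.
  apply: qcol_sub (sub (fun s => s != [set x; y]) _ (subxx _) _) => //.
    move=> u v _ _ /andP[euv nuv]; rewrite euv /=.
    by apply: contra nuv => /eqP/set2_eq.
  rewrite /proper_subgraph subG //=; apply/negP => /andP[_ /subsetP/(_ _ exy)].
  by rewrite inE eqxx andbF.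
Qed.

Lemma crit_critical G q : 0 < q -> crit q (adjacent G) (vertices G) ->
  critical q.+1 G.
Proof.
move=> q0 [nc cv ce]; rewrite /critical subn1 /=; split.
  by move/(colorable_qcol _ q0); apply/negP.
move=> H /andP[/andP[sV sE]]; rewrite negb_and => hn; apply/(colorable_qcol _ q0).
case/orP: hn => /subsetPn[x xG xH].
  apply: qcol_sub (cv x xG); first by rewrite subsetD1 sV.
  by move=> u v _ _ /(subsetP sE).
have [u [v [xE nuv]]] := edge_pair xG.
have euv : adjacent G u v by rewrite /adjacent -xE.
have [uV vV] := adjacent_mem euv.
apply: qcol_sub (ce u v uV vV euv) => // a b _ _ eab.
rewrite /del (subsetP sE _ eab : adjacent G a b) /=; apply: contra xH.
by rewrite xE; case/orP => /andP[/eqP <- /eqP <-] //; rewrite setUC.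
Qed.

Lemma graph_subproof (e : rel T) (V : {set T}) : sgr e -> forall s : {set T},
  s \in [set [set p.1; p.2] | p in [set p : T * T | [&& p.1 \in V, p.2 \in V & e p.1 p.2]]] ->
  (s \subset V) && (#|s| == 2).
Proof.
move=> [_ ei] s /imsetP[[x y]]; rewrite inE /= => /and3P[xV yV exy] ->.
rewrite subUset !sub1set xV yV cards2 /=.
by rewrite (contraTneq _ exy) // => ->; rewrite ei.
Qed.

Definition graph_of (e : rel T) (V : {set T}) (se : sgr e) : sgraph T :=
  SGraph (graph_subproof (V := V) se).

Lemma graph_adjacent (e : rel T) (V : {set T}) (se : sgr e) x y :
  adjacent (graph_of V se) x y = [&& x \in V, y \in V & e x y].
Proof.
have [es _] := se; rewrite /adjacent; apply/imsetP/idP => [[[u v]]|h].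
  rewrite inE /= => /and3P[uV vV euv] /set2_eq /orP[] /andP[/eqP-> /eqP->].
    by rewrite uV vV.
  by rewrite uV vV es.
by exists (x, y); rewrite ?inE.
Qed.

End Bridge.

Lemma critical_of_crit (q n m : nat) : 0 < q -> crit_exists_with q n (2 * m) ->
  critical_edge_count q.+1 n m.
Proof.
move=> q0 [T [e [V [se cr cV aV]]]]; exists T, (graph_of V se).
have adjE x y : x \in V -> y \in V -> adjacent (graph_of V se) x y = e x y.
  by move=> xV yV; rewrite graph_adjacent xV yV.
split=> //.
  apply: crit_critical => //; have [nc cv ce] := cr; split.
  - by apply: contra nc; apply: qcol_sub => // x y xV yV; rewrite adjE.
  - move=> x xV; apply: qcol_sub (cv x xV) => // u v /setD1P[_ uV] /setD1P[_ vV].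
    by rewrite adjE.
  - move=> x y xV yV; rewrite adjE // => exy.
    apply: qcol_sub (ce x y xV yV exy) => // u v uV vV.
    by rewrite /del adjE.
apply/eqP; rewrite -(eqn_pmul2l (isT : 0 < 2)) -arcs_adjacent -aV; apply/eqP.
exact: eq_arcs.
Qed.

Lemma critical_lower (q n m : nat) : 2 < q -> critical_edge_count q.+1 n m ->
  ((q%:Z * q%:Z + q%:Z - 2) * n%:Z - (q%:Z * q%:Z - q%:Z - 2) <= 2 * q%:Z * m%:Z)%R.
Proof.
move=> q3 [T [G [cr <- <-]]].
have := kostochka_yancey q3 (adjacent_sgr G) (critical_crit (ltnW (ltnW q3)) cr).
by rewrite /rho /ky_bound arcs_adjacent PoszM; lra.
Qed.

Local Open Scope ring_scope.

Lemma F_ceil (q n : nat) : (0 < q)%N ->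
  F q.+1 n = Num.ceil (((q%:R * q%:R + q%:R - 2) * n%:R - (q%:R * q%:R - q%:R - 2)) / (2 * q%:R) : rat).
Proof.
move=> q0; congr Num.ceil; rewrite -addn1 natrD addrK.
by congr (_ / _); ring.
Qed.

(** The strict inequality puts m - 1 below the unrounded value, so m is at most its ceiling [F]. The
    lower bound for all critical graphs, applied to the given one too, supplies the rest. *)
Lemma is_f_intro (q n m : nat) : (2 < q)%N -> crit_exists_with q n (2 * m) ->
  (2 * q%:Z * (m%:Z - 1) < (q%:Z * q%:Z + q%:Z - 2) * n%:Z - (q%:Z * q%:Z - q%:Z - 2)) ->
  is_f q.+1 n m /\ m%:Z = F q.+1 n.
Proof.
move=> q3 hex hlt; have q0 : (0 < q)%N by apply: leq_trans q3.
have mem := critical_of_crit q0 hex.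
have toQ (z t : int) : (z <= t) = (z%:~R <= t%:~R :> rat) by rewrite ler_int.
have q2 : 0 < 2 * q%:R :> rat by rewrite mulr_gt0 // ltr0n.
pose N : int := (q%:Z * q%:Z + q%:Z - 2) * n%:Z - (q%:Z * q%:Z - q%:Z - 2).
have NE : (q%:R * q%:R + q%:R - 2) * n%:R - (q%:R * q%:R - q%:R - 2) = N%:~R :> rat.
  by rewrite /N !(rmorphB, rmorphD, rmorphM) /=.
have FE : F q.+1 n = Num.ceil (N%:~R / (2 * q%:R) : rat) by rewrite F_ceil // NE.
have leF (m' : nat) : critical_edge_count q.+1 n m' -> F q.+1 n <= m'%:Z.
  move=> /(critical_lower q3) h; rewrite FE ceil_le_int // ler_pdivrMr //.
  have -> : m'%:~R * (2 * q%:R) = (2 * q%:Z * m'%:Z)%:~R :> rat.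
    by rewrite !rmorphM /= mulrC.
  by rewrite ler_int.
have mF : m%:Z = F q.+1 n.
  apply/le_anti; rewrite leF // andbT FE -ltzD1 addrC -ltrBlDl ceil_gt_int ltr_pdivlMr //.
  have -> : (m%:Z - 1)%:~R * (2 * q%:R) = (2 * q%:Z * (m%:Z - 1))%:~R :> rat.
    by rewrite !rmorphM /= mulrC.
  by rewrite ltr_int.
by split=> //; split=> // m' /leF; rewrite -mF lez_nat.
Qed.

Theorem theorem37 (k n : nat) (hk : (4 <= k)%N)
  (hkn : [\/ (n = 1 %[mod k - 1])%N /\ (k <= n)%N,
             [/\ k = 4%N, n <> 5%N & (4 <= n)%N] |
             [/\ k = 5%N, (n = 2 %[mod 4])%N & (10 <= n)%N]]) :
  exists2 m : nat, is_f k n m &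
    m%:Z = F k n /\
    F k n = Num.ceil
      (1 / 2 * ((k%:R - 2 / (k%:R - 1)) * n%:R
                - k%:R * (k%:R - 3) / (k%:R - 1)) : rat).
Proof.
have alt : F k n = Num.ceil
      (1 / 2 * ((k%:R - 2 / (k%:R - 1)) * n%:R
                - k%:R * (k%:R - 3) / (k%:R - 1)) : rat).
  have hk1 : k%:R - 1 != 0 :> rat.
    by rewrite subr_eq0 pnatr_eq1; apply: contraTneq hk => ->.
  by congr Num.ceil; field.
suff [m [h1 h2]] : exists m : nat, is_f k n m /\ m%:Z = F k n by exists m.
have [q hq] : exists q, k = q.+1 by exists k.-1; rewrite prednK // (ltn_trans _ hk).
have q3 : (2 < q)%N by rewrite hq in hk.
rewrite hq; move: hkn; rewrite hq subn1 /= => -[[hn kn]|[[hq3] n5 n4]|[[hq4] hn n10]].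
- have [j hj] : exists j, n = (q.+1 + j * q)%N.
    have [p hp] : exists p, n = p.+1 by exists n.-1; rewrite prednK // (leq_trans _ kn).
    have : (q %| p)%N.
      by move/eqP: hn; rewrite hp -addn1 -[X in _ == X %[mod _]]add0n eqn_modDr mod0n.
    case/dvdnP => i hi; exists (i - 1)%N; rewrite hp hi.
    have i0 : (0 < i)%N by move: kn; rewrite hp hi ltnS; case: i {hi} => //; rewrite mul0n;
      case: (q) q3.
    by case: i i0 {hi} => // i _; rewrite subn1 /= mulSn addSn.
  have h := hajos_iter j q3 (complete_crit (ltnW (ltnW q3))).
  (* r is the number of edges of K_k, and each join adds r - 1 edges. *)
  have [r hr] : exists r, (q * q + q = 2 * r)%N.
    by exists (q * q + q)./2; rewrite mul2n halfK oddD oddM andbb addbb subn0.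
  have r0 : (0 < r)%N by move: hr; case: r => //; rewrite muln0; case: (q) q3.
  pose m := (r + j * (r - 1))%N.
  have hm : (q.+1 * q + j * (q * q + q - 2) = 2 * m)%N.
    have -> : (q.+1 * q = q * q + q)%N by rewrite mulSn addnC.
    have -> : (q * q + q - 2 = 2 * (r - 1))%N by rewrite hr mulnBr muln1.
    by rewrite hr /m mulnDr mulnCA.
  rewrite -hj hm in h; exists m; apply: is_f_intro => //.
  have mZ : m%:Z = r%:Z + j%:Z * (r%:Z - 1) by rewrite /m PoszD PoszM -subzn.
  have hrZ : 2 * r%:Z = q%:Z * q%:Z + q%:Z by rewrite -!PoszM -PoszD hr.
  have -> : 2 * q%:Z * (m%:Z - 1) = q%:Z * (2 * r%:Z + j%:Z * (2 * r%:Z - 2) - 2).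
    by rewrite mZ; ring.
  rewrite hrZ hj PoszD PoszM; move: q3; clear; lia.
- have q3' : q = 3 by case: hq3.
  rewrite q3'.
  (* One starting graph per residue modulo 3; excluding n = 5 makes the residue 2 begin at 8. *)
  have [j [hj|hj|hj]] : exists j, [\/ n = (4 + j * 3)%N, n = (6 + j * 3)%N | n = (8 + j * 3)%N].
    have := divn_eq n 3; have : (n %% 3 < 3)%N by rewrite ltn_mod.
    case: (n %% 3)%N => [|[|[|//]]] _ hd.
    + by exists (n %/ 3 - 2)%N; apply: Or32; lia.
    + by exists (n %/ 3 - 1)%N; apply: Or31; lia.
    + by exists (n %/ 3 - 2)%N; apply: Or33; lia.
  + exists (6 + j * 5)%N; apply: is_f_intro => //; last by rewrite hj; lia.
    by have := @hajos_iter 3 _ _ j isT (@complete_crit 3 isT); rewrite -hj;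
      congr crit_exists_with; lia.
  + exists (10 + j * 5)%N; apply: is_f_intro => //; last by rewrite hj; lia.
    by have := @hajos_iter 3 _ _ j isT wheel_crit; rewrite -hj; congr crit_exists_with; lia.
  + exists (13 + j * 5)%N; apply: is_f_intro => //; last by rewrite hj; lia.
    by have := @hajos_iter 3 _ _ j isT eight_crit; rewrite -hj; congr crit_exists_with; lia.
- have q4' : q = 4 by case: hq4.
  rewrite q4'.
  have [j hj] : exists j, n = (10 + j * 4)%N.
    by exists (n %/ 4 - 2)%N; have := divn_eq n 4; rewrite hn; lia.
  exists (22 + j * 9)%N; apply: is_f_intro => //; last by rewrite hj; lia.
  by have := @hajos_iter 4 _ _ j isT ten_crit; rewrite -hj; congr crit_exists_with; lia.
Qed.
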